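(* Let $d>1$, let $\{f_n\}_{n\in\mathbb{N}}$ be a $d$-decaying Gauss like iterated function system, let $b>1$, and let $\varphi$ be the potential function with $\varphi(j)=e^{(\log j)^b}$ for all $j\ge 1$. (I) When $\Phi(n)=e^{n^\alpha}$ with $\alpha>0$: (I-1) $\dim_H E_\varphi(\Phi)=1$ if $\alpha<\frac{b}{b+1}$ and $\{f_n\}$ satisfies the bounded distortion property; (I-2) $\dim_H E_\varphi(\Phi)=\frac1d$ if $\alpha>\frac{b}{b+1}$. (II) When $\Phi(n)=e^{\beta^n}$ with $\beta>1$, $\dim_H E_\varphi(\Phi)=\frac{1}{d\beta^{1/b}-\beta^{1/b}+1}$.
   Context: $\mathbb{N}=\{1,2,\dots\}$; $\dim_H$ denotes Hausdorff dimension. Let $d>1$ be real. A family $\{f_n\}_{n\in\mathbb{N}}$ of $C^1$ maps from $[0,1]$ to itself is a $d$-decaying Gauss like iterated function system if: (1) for any $i\ne j$ in $\mathbb{N}$, $f_i((0,1))\cap f_j((0,1))=\emptyset$; (2) $\bigcup_{i=1}^\infty f_i([0,1])=[0,1)$; (3) if $f_i(x)<f_j(x)$ for all $x\in(0,1)$ then $i<j$; (4) there exist $m\in\mathbb{N}$ and $0<A<1$ such that for all $(a_1,\dots,a_m)\in\mathbb{N}^m$ and all $x\in[0,1]$, $0<|(f_{a_1}\circ\cdots\circ f_{a_m})'(x)|\le A<1$; (5) for any $\delta>0$ there are constants $K_1=K_1(\delta)>0$, $K_2=K_2(\delta)>0$ such that for each $i\in\mathbb{N}$ there exist constants $\xi_i,\lambda_i$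 with $\frac{K_1}{i^{d+\delta}}\le \xi_i\le |f_i'(x)|\le\lambda_i\le \frac{K_2}{i^{d-\delta}}$ for all $x\in[0,1]$. The basic interval of order $n$ of a word $a_1\cdots a_n\in\mathbb{N}^n$ is $I_n(a_1,\dots,a_n)=f_{a_1}\circ\cdots\circ f_{a_n}([0,1])$, and $|I|$ is the diameter of an interval $I$. All but countably many $x\in[0,1]$ have a unique symbolic expansion $(a_1(x),a_2(x),\dots)\in\mathbb{N}^{\mathbb{N}}$ with $x=\lim_{n\to\infty}f_{a_1(x)}\circ\cdots\circ f_{a_n(x)}(1)$. Bounded distortion property: there exist constants $K_3,K_4>0$ such that for any two finite words $a_1\cdots a_n$ and $b_1\cdots b_m$ over $\mathbb{N}$, $K_3\le \frac{|I_{n+m}(a_1,\dots,a_n,b_1,\dots,b_m)|}{|I_n(a_1,\dots,a_n)|\cdot|I_m(b_1,\dots,b_m)|}\le K_4$. A potential function is a function $\varphi:[0,1]\to\mathbb{R}_+$ that is constant on the interior of each $I_1(j)$, $j\in\mathbb{N}$; $\varphi(j)$ denotes this constant value. Its Birkhoff sums are $S_n\varphi(x)=\sum_{k=1}^n\varphi(a_k)$ if $x\in I_n(a_1,\dots,a_n)$; these are well defined outside a countable set (which does not affect Hausdorff dimension). For $\Phi:\mathbb{N}\to\mathbb{R}_+$, $E_\varphi(\Phi)=\{x\in(0,1):\lim_{n\to\infty}S_n\varphi(x)/\Phi(n)=1\}$. *)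

(* Defs.v *)
From mathcomp Require Import all_boot all_order all_algebra.
From mathcomp Require Import all_classical all_reals all_analysis.

Set Implicit Arguments.
Unset Strict Implicit.
Unset Printing Implicit Defensive.

Import Order.TTheory GRing.Theory Num.Theory.
Import numFieldNormedType.Exports.

Local Open Scope classical_set_scope.
Local Open Scope ring_scope.

Section hausdorff_dimension.
Context {R : realType}.
Local Open Scope ereal_scope.

(* The supremum is taken in [0, +oo], so that diam set0 = 0. *)
Definition diam (A : set R) : \bar R :=
  maxe 0 (ereal_sup [set `|p.1 - p.2|%R%:E | p in A `*` A]).

(* The test on U only matters for s = 0, where 0 `^ 0 = 1: the empty set must
   contribute nothing and a singleton must contribute 1. *)
Definition diam_pow (s : R) (U : set R) : \bar R :=
  if U == set0 then 0 else diam U `^ s.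

Definition delta_cover (delta : R) (A : set R) (U : (set R)^nat) : Prop :=
  A `<=` \bigcup_k U k /\ forall k, diam (U k) <= delta%:E.

Definition hausdorff_premeasure (s delta : R) (A : set R) : \bar R :=
  ereal_inf [set \sum_(k <oo) diam_pow s (U k) | U in delta_cover delta A].

Definition hausdorff_measure (s : R) (A : set R) : \bar R :=
  ereal_sup [set hausdorff_premeasure s delta A | delta in [set x | (0 < x)%R]].

Definition hausdorff_dim (A : set R) : \bar R :=
  ereal_inf [set s%:E | s in [set s | (0 <= s)%R /\ hausdorff_measure s A = 0]].

End hausdorff_dimension.

Section gauss_like_ifs.
Context {R : realType}.
Implicit Types (f : nat -> R -> R) (phi : R -> R).

(* A map of [0, 1] is represented by a function g : R -> R whose values outside
   [0, 1] are irrelevant. Derivatives are therefore taken relative to [0, 1],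
   hence one-sided at 0 and 1. *)
Definition quotient01 (g : R -> R) (x : R) : R -> R :=
  fun y => (g y - g x) / (y - x).

Definition derivable01 (g : R -> R) (x : R) : Prop :=
  cvg (quotient01 g x @ within `[0, 1]%classic x^').

Definition derive01 (g : R -> R) (x : R) : R :=
  lim (quotient01 g x @ within `[0, 1]%classic x^').

Definition C1_01 (g : R -> R) : Prop :=
  (forall x : R, x \in `[0, 1] -> derivable01 g x) /\
  {within `[0, 1]%classic, continuous (derive01 g)}.

(* Families and letters are indexed by {1, 2, ...}: index 0 of a family
   f : nat -> R -> R is ignored, and letters are required to be positive. *)
Definition word (w : seq nat) : bool := all (fun i => (0 < i)%N) w.

Definition word_map f (w : seq nat) : R -> R :=
  foldr (fun i g => f i \o g) id w.

Definition basic_interval f (w : seq nat) : set R :=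
  word_map f w @` `[0, 1]%classic.

Record gauss_like_ifs (d : R) f : Prop := GaussLikeIFS {
  ifs_self : forall i, (0 < i)%N ->
    forall x : R, x \in `[0, 1] -> f i x \in `[0, 1] ;
  ifs_C1 : forall i, (0 < i)%N -> C1_01 (f i) ;
  ifs_disjoint : forall i j, (0 < i)%N -> (0 < j)%N -> i <> j ->
    (f i @` `]0, 1[%classic) `&` (f j @` `]0, 1[%classic) = set0 ;
  ifs_cover : \bigcup_(i in [set i | (0 < i)%N]) (f i @` `[0, 1]%classic) = `[0, 1[%classic ;
  ifs_order : forall i j, (0 < i)%N -> (0 < j)%N ->
    (forall x : R, x \in `]0, 1[ -> f i x < f j x) -> (i < j)%N ;
  ifs_contraction : exists (m : nat) (A : R),
    [/\ (0 < m)%N, 0 < A, A < 1 &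
      forall w, word w -> size w = m -> forall x : R, x \in `[0, 1] ->
        0 < `|derive01 (word_map f w) x| <= A] ;
  ifs_decay : forall delta : R, 0 < delta ->
    exists K1 K2 : R, [/\ 0 < K1, 0 < K2 &
      forall i, (0 < i)%N -> exists xi lambda : R,
        forall x : R, x \in `[0, 1] ->
        [/\ K1 / i%:R `^ (d + delta) <= xi,
            xi <= `|derive01 (f i) x|,
            `|derive01 (f i) x| <= lambda &
            lambda <= K2 / i%:R `^ (d - delta)]]
}.

Definition bounded_distortion f : Prop :=
  exists K3 K4 : R, [/\ 0 < K3, 0 < K4 &
    forall u v, word u -> word v ->
      K3 <= fine (diam (basic_interval f (u ++ v))) /
            (fine (diam (basic_interval f u)) *
             fine (diam (basic_interval f v))) <= K4].

Definition potential f phi : Prop :=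
  (forall x : R, x \in `[0, 1] -> 0 <= phi x) /\
  (forall j, (0 < j)%N -> exists c : R,
    forall x, (basic_interval f [:: j])° x -> phi x = c).

(* The value phi(j) of a potential on the interior of I_1(j). *)
Definition potential_value f phi (j : nat) : R :=
  get [set c | forall x, (basic_interval f [:: j])° x -> phi x = c].

(* a 0, a 1, ... are the letters a_1(x), a_2(x), ... *)
Definition expansion f (x : R) (a : nat -> nat) : Prop :=
  (forall k, (0 < a k)%N) /\ forall n, basic_interval f (mkseq a n) x.

Definition birkhoff_sum f phi (a : nat -> nat) (n : nat) : R :=
  \sum_(k < n) potential_value f phi (a k).

(* The expansion is unique outside a countable set of points x; at the remaining
   points any expansion is allowed, which does not affect the dimension. *)
Definition birkhoff_growth_set f phi (Phi : nat -> R) : set R :=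
  [set x | (x \in `]0, 1[) /\ exists a, expansion f x a /\
    (fun n => birkhoff_sum f phi a n / Phi n) @ \oo --> (1 : R)].

End gauss_like_ifs.

(* Main.v *)
Require Import Defs.
From mathcomp Require Import all_boot all_order all_algebra.
From mathcomp Require Import all_classical all_reals all_analysis.
From mathcomp Require Import ring lra zify.
Import Order.TTheory GRing.Theory Num.Theory.
Import numFieldNormedType.Exports.
Local Open Scope classical_set_scope.
Local Open Scope ring_scope.

(* A potential only enters through its values, so S_n = sum_(k < n) exp((ln a_k)^b) on the
   expansion a_0 a_1 ... of x.

   Upper bounds. If S_n ~ exp(n^alpha) with alpha > b/(b+1), then the mean of ln a_0, ..., ln a_(n-1)
   tends to infinity: telescoping ln S_k, about N^alpha indices below N carry a digit with
   ln a_k >= c N^(alpha/b), and alpha + alpha/b > 1. For such points the order-n intervals already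
   form an efficient cover for every exponent s > 1/d. If S_n ~ exp(beta^n), put B = beta^(1/b); then
   |ln a_(k-1) - B^k| <= 1 eventually, there are few words of order n, and one covers by the part of
   each order-n interval where the next digit is that large.

   Lower bounds. If t |-> h t maps a set which is not Lebesgue null into A with
   |t - t'| <= C |h t - h t'|^s, then A is not null for the s-dimensional Hausdorff measure.
   For 1/d and for the doubly exponential case, t in [0, 1) is read in a mixed radix and its digits
   select every other letter of a window [u, u + 2 u^(1-delta)], u = exp((ln (Phi(n+1) - Phi n))^(1/b));
   skipping letters separates the intervals.
   For dimension 1, t itself ranges over the points whose letters are bounded by exp((k + k0)^w), and h
   inserts prescribed letters in its expansion at the places where floor(n^eta) jumps. These letters
   produce the growth exp(n^alpha), they are so sparse and small that by bounded distortion lengths of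
   intervals change by a factor exp(-o(n)), and they keep h t away from the ends of the intervals. *)

Set Implicit Arguments.
Unset Strict Implicit.
Unset Printing Implicit Defensive.

(** * Null sets of Hausdorff measures *)

(** Where the exponents come from. In (II) the logarithms of the letters are about B^k: the words of
    order n number about exp(sum of B^k), their intervals have length about exp(- d * sum of B^k),
    and keeping only large next letters multiplies this by exp(- (d - 1) B^(n+1)). The sum is close
    to B^(n+1) / (B - 1), so number and size balance at s = 1 / (d + (d - 1)(B - 1)). In (I-1),
    producing the growth exp(n^alpha) at about n^eta places takes letters with logarithm about
    n^(alpha / b), which costs a factor exp(- n^(eta + alpha / b)) in length; rounding n^eta is
    harmless for eta > alpha. A suitable eta exists exactly when alpha + alpha / b < 1, that is,
    alpha < b / (b + 1). The obstacle in (I-2) and (II) is that only single letters are controlled: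
    a word of length n carries a factor K^n, and the exponent d is known up to delta only. Both are
    absorbed because the sum of the logarithms of the letters is superlinear in n and delta is
    arbitrary. *)

Section null_sets.
Context {R : realType}.

Lemma ler_sum_uniq (I : eqType) (l L : seq I) (F : I -> R) :
  uniq l -> uniq L -> {subset l <= L} -> (forall i, 0 <= F i) ->
  \sum_(i <- l) F i <= \sum_(i <- L) F i.
Proof.
move=> ul uL lL F0.
rewrite [leRHS](bigID (mem l)) /= -[leLHS]addr0 lerD ?sumr_ge0//.
rewrite le_eqVlt; apply/orP; left; apply/eqP.
rewrite -[RHS]big_filter; apply: perm_big; apply: uniq_perm => //.
  exact: filter_uniq.
by move=> p; rewrite mem_filter; case: (boolP (p \in l)) => [/lL ->|].
Qed.

(* For s > 0 a small total of the D k `^ s forces each D k to be small, so that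
   snull s A means that A is null for the s-dimensional Hausdorff measure. *)
Definition snull (s : R) (A : set R) : Prop := forall eps : R, 0 < eps ->
  exists (U : nat -> set R) (D : nat -> R),
    [/\ A `<=` \bigcup_k U k,
        forall k, 0 <= D k,
        forall k x y, U k x -> U k y -> `|x - y| <= D k &
        forall n, \sum_(k < n) D k `^ s <= eps].

Lemma diam_le (A : set R) (r : R) : 0 <= r ->
  (forall x y, A x -> A y -> `|x - y| <= r) -> (diam A <= r%:E)%E.
Proof.
move=> r0 h; rewrite /diam ge_max lee_fin r0/=.
by apply: ge_ereal_sup => _ [[x y] [Ax Ay] <-]; rewrite lee_fin; apply: h.
Qed.

Lemma le_diam (A : set R) x y : A x -> A y -> (`|x - y|%:E <= diam A)%E.
Proof.
move=> Ax Ay; rewrite /diam le_max; apply/orP; right.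
by apply: ereal_sup_ubound; exists (x, y).
Qed.

Lemma diam_ge0 (A : set R) : (0 <= diam A)%E.
Proof. by rewrite /diam le_max lexx. Qed.

Lemma diam_pow_ge0 (s : R) A : (0 <= diam_pow s A)%E.
Proof. by rewrite /diam_pow; case: ifP => // _; exact: poweR_ge0. Qed.

(** Covers of mesh 1 have diameters at most 1, so raising the exponent from [s] to [r] lowers the
    sum. The strict inequality makes [r] positive even for [s = 0], so that pieces of diameter 0
    cost nothing. *)
Lemma hausdorff_measure_null_snull (s r : R) A : 0 <= s -> s < r ->
  hausdorff_measure s A = 0%E -> snull r A.
Proof.
move=> s0 sr h eps e0.
have r0 : 0 < r by exact: le_lt_trans sr.
have : (hausdorff_premeasure s 1 A < eps%:E)%E.
  apply: (@le_lt_trans _ _ 0%E); last by rewrite lte_fin.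
  by rewrite -h; apply: ereal_sup_ubound; exists 1 => //=; exact: ltr01.
move=> /ereal_inf_lt[_ [U [AU dU] <-] sU].
exists U, (fun k => fine (diam (U k))).
have df k : diam (U k) \is a fin_num.
  by rewrite ge0_fin_numE ?diam_ge0// (le_lt_trans (dU k))// ltry.
split => //.
- by move=> k; apply: fine_ge0; exact: diam_ge0.
- by move=> k x y Ux Uy; rewrite -lee_fin fineK //; exact: le_diam.
- move=> n; rewrite -lee_fin; apply: le_trans (ltW sU).
  apply: le_trans (nneseries_lim_ge n _); last by move=> k _ _; exact: diam_pow_ge0.
  rewrite -sumEFin big_mkord; apply: lee_sum => k _.
  rewrite /diam_pow; case: ifPn => [/eqP ->|_].
    by rewrite /diam set0X image_set0 ereal_sup0 maxEge leNye /= powR0// gt_eqF.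
  have := dU k; rewrite -(fineK (df k)) /= !lee_fin => d1.
  have : 0 <= fine (diam (U k)) by apply: fine_ge0; exact: diam_ge0.
  rewrite le_eqVlt => /orP[/eqP<-|dp].
    by rewrite powR0 ?gt_eqF// powR_ge0.
  by apply: ger_powR; [rewrite dp d1 | exact: ltW].
Qed.

Lemma snull_hausdorff_measure_null (s : R) A : 0 < s ->
  snull s A -> hausdorff_measure s A = 0%E.
Proof.
move=> s0 h; apply/eqP; rewrite eq_le; apply/andP; split; last first.
  apply: (@le_trans _ _ (hausdorff_premeasure s 1 A)).
    apply: le_ereal_inf_tmp => _ [U _ <-].
    by apply: nneseries_ge0 => k _ _; exact: diam_pow_ge0.
  by apply: ereal_sup_ubound; exists 1 => //=; exact: ltr01.
apply: ge_ereal_sup => _ [dl /= dl0 <-].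
apply/lee_addgt0Pr => e e0; rewrite add0e.
have [|U [D [AU D0 dU sU]]] := h (Num.min e (dl `^ s)).
  by rewrite lt_min e0 powR_gt0.
have Dk k : D k `^ s <= Num.min e (dl `^ s).
  apply: le_trans (sU k.+1); rewrite big_ord_recr /= ler_wpDl//.
  by apply: sumr_ge0 => i _; exact: powR_ge0.
have Ddl k : D k <= dl.
  have := Dk k; rewrite le_min => /andP[_].
  move=> le1; rewrite leNgt; apply/negP => hlt.
  have : dl `^ s < D k `^ s by apply: (gt0_ltr_powR s0); rewrite ?nnegrE ?D0 ?(ltW dl0).
  by rewrite ltNge le1.
apply: (@le_trans _ _ (\sum_(k <oo) diam_pow s (U k))%E).
  apply: ereal_inf_lbound; exists U => //; split=> // k.
  by apply: diam_le; [exact: ltW|move=> x y Ux Uy; exact: le_trans (dU _ _ _ Ux Uy) _].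
apply: lime_le; first by apply: is_cvg_nneseries => k _ _; exact: diam_pow_ge0.
apply: nearW => n; rewrite big_mkord.
apply: (@le_trans _ _ (\sum_(k < n) D k `^ s)%:E); last first.
  by rewrite lee_fin (le_trans (sU n))// ge_min lexx.
rewrite -sumEFin; apply: lee_sum => k _.
rewrite /diam_pow; case: ifPn => _; first by rewrite lee_fin powR_ge0.
have := diam_le (D0 k) (dU k); have := diam_ge0 (U k).
case: (diam (U k)) => //= r; rewrite !lee_fin => rge rle.
by apply: ge0_ler_powR; rewrite ?nnegrE// ltW.
Qed.

(** The cap [s1] is for covering arguments that work only in a window of exponents above [s0], as in
    the doubly exponential case. *)
Lemma hausdorff_dim_le (s0 s1 : R) A : 0 <= s0 -> s0 < s1 ->
  (forall s, s0 < s -> s < s1 -> snull s A) -> (hausdorff_dim A <= s0%:E)%E.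
Proof.
move=> s00 s01 h; apply/lee_addgt0Pr => e e0; rewrite -EFinD.
pose s := Num.min (s0 + e) ((s0 + s1) / 2).
have sgt : s0 < s by rewrite /s lt_min; apply/andP; split; lra.
have slt : s < s1 by rewrite /s gt_min; apply/orP; right; lra.
have sle : s <= s0 + e by rewrite /s ge_min lexx.
apply: (@le_trans _ _ s%:E); last by rewrite lee_fin.
apply: ereal_inf_lbound; exists s => //; split; first by lra.
by apply: snull_hausdorff_measure_null; [lra|exact: h].
Qed.

Lemma le_hausdorff_dim (s0 : R) A : 0 < s0 ->
  (forall s, 0 < s -> s < s0 -> ~ snull s A) -> (s0%:E <= hausdorff_dim A)%E.
Proof.
move=> s00 h; apply: le_ereal_inf_tmp => _ [s [s_ge0 hs] <-].
rewrite lee_fin leNgt; apply/negP => ss0.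
(* The midpoint leaves room for the loss of exponent in [hausdorff_measure_null_snull]. *)
apply: (h ((s + s0) / 2)); [lra|lra|].
by apply: hausdorff_measure_null_snull hs => //; lra.
Qed.

(** Covers are naturally indexed by words. They are transported to [nat] by [pickle_inv]; numbers
    that code nothing get the empty set and size 0, which is free since [s > 0]. *)
Lemma snull_countable (I : countType) (s : R) A : 0 < s ->
  (forall eps : R, 0 < eps -> exists (U : I -> set R) (D : I -> R),
    [/\ A `<=` [set x | exists i, U i x],
        forall i, 0 <= D i,
        forall i x y, U i x -> U i y -> `|x - y| <= D i &
        forall l, uniq l -> \sum_(i <- l) D i `^ s <= eps]) -> snull s A.
Proof.
move=> s0 h eps e0; have [U [D [AU D0 dU sU]]] := h eps e0.
exists (fun k => if pickle_inv k is Some i then U i else set0),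
  (fun k => if pickle_inv k is Some i then D i else 0).
split.
- by move=> x /AU[i Ui]; exists (pickle i) => //; rewrite pickleK_inv.
- by move=> k; case: (pickle_inv k).
- by move=> k x y; case: (pickle_inv k) => // i; exact: dU.
- move=> n; apply: le_trans (sU (pmap (@pickle_inv I) (iota 0 n)) _); last first.
    by apply: (pmap_uniq (@pickle_invK I)); exact: iota_uniq.
  rewrite -(big_mkord xpredT (fun k => (if pickle_inv k is Some i then D i else 0) `^ s)).
  rewrite /index_iota subn0; elim: (iota 0 n) => [|k l IH]; first by rewrite !big_nil.
  rewrite big_cons /=; case: (pickle_inv k) => [i|] /=; first by rewrite big_cons lerD2l.
  by rewrite powR0 ?gt_eqF// add0r.
Qed.

(** Countable stability is what allows the threshold hidden in a limit, or an initial word, to be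
    fixed before covering. The set [A i] receives the budget [eps / 2 ^+ (pickle i).+1]. *)
Lemma snull_bigcup (I : countType) (s : R) (A : I -> set R) : 0 < s ->
  (forall i, snull s (A i)) -> snull s [set x | exists i, A i x].
Proof.
move=> s0 h; apply: (@snull_countable (I * nat)%type) => // eps e0.
have hh i : exists UD : (nat -> set R) * (nat -> R),
    [/\ A i `<=` \bigcup_k UD.1 k, forall k, 0 <= UD.2 k,
      forall k x y, UD.1 k x -> UD.1 k y -> `|x - y| <= UD.2 k &
      forall n, \sum_(k < n) UD.2 k `^ s <= eps / 2 ^+ (pickle i).+1].
  have [|U [D H]] := h i (eps / 2 ^+ (pickle i).+1); last by exists (U, D).
  by rewrite divr_gt0// exprn_gt0.
have /choice[W HW] := hh.
exists (fun ik => (W ik.1).1 ik.2), (fun ik => (W ik.1).2 ik.2); split.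
- move=> x [i Aix]; have [/(_ x Aix)[k _ Uk] _ _ _] := HW i.
  by exists (i, k).
- by move=> [i k]; have [_ + _ _] := HW i; apply.
- by move=> [i k] x y; have [_ _ + _] := HW i; apply.
- move=> l ul.
  (* The finite list is enlarged to a rectangle, where the sum is taken one set [A i] at a time. *)
  pose M := (\max_(p <- l) maxn (pickle p.1) p.2)%N.
  have lM p : p \in l -> (pickle p.1 <= M)%N /\ (p.2 <= M)%N.
    move=> pl; have : (maxn (pickle p.1) p.2 <= M)%N by exact: (@leq_bigmax_seq _ l xpredT (fun p => maxn (pickle p.1) p.2)).
    by rewrite geq_max => /andP.
  pose S := pmap (@pickle_inv I) (iota 0 M.+1).
  have uS : uniq S by apply: (pmap_uniq (@pickle_invK I)); exact: iota_uniq.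
  pose L := [seq (i, k) | i <- S, k <- iota 0 M.+1].
  have uL : uniq L by apply: allpairs_uniq => //; [exact: iota_uniq|move=> [? ?] [? ?]].
  have lL : {subset l <= L}.
    move=> p pl; have [p1 p2] := lM p pl.
    rewrite [p]surjective_pairing; apply: allpairs_f.
      rewrite mem_pmap; apply/mapP; exists (pickle p.1); last by rewrite pickleK_inv.
      by rewrite mem_iota.
    by rewrite mem_iota.
  apply: (@le_trans _ _ (\sum_(p <- L) (W p.1).2 p.2 `^ s)).
    by apply: ler_sum_uniq => // p; exact: powR_ge0.
  rewrite /L big_allpairs_dep /=.
  apply: (@le_trans _ _ (\sum_(i <- S) eps / 2 ^+ (pickle i).+1)).
    apply: ler_sum => i _; have [_ _ _ /(_ M.+1)] := HW i.
    by rewrite -(big_mkord xpredT (fun k => (W i).2 k `^ s)) /index_iota subn0.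
  apply: (@le_trans _ _ (\sum_(k <- iota 0 M.+1) eps / 2 ^+ k.+1)).
    rewrite /S; elim: (iota 0 M.+1) => [|k l0 IH]; first by rewrite !big_nil.
    rewrite big_cons /=; case E: (pickle_inv k) => [i|] /=.
      have := @pickle_invK I k; rewrite /ocancel E /= => <-.
      by rewrite big_cons lerD2l.
    by apply: (le_trans IH); rewrite ler_wpDl// divr_ge0 ?ltW// exprn_gt0.
  have -> : \sum_(k <- iota 0 M.+1) eps / 2 ^+ k.+1 = eps - eps / 2 ^+ M.+1.
    elim: (M.+1) => [|n IH]; first by rewrite big_nil expr0 divr1 subrr.
    rewrite -addn1 iotaD big_cat /= IH big_seq1 add0n addn1 exprS.
    have : (2 : R) ^+ n != 0 by rewrite expf_neq0.
    by move=> ?; field.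
  by rewrite gerBl divr_ge0 ?ltW// exprn_gt0.
Qed.

Lemma snull_subset (s : R) (A B : set R) : A `<=` B -> snull s B -> snull s A.
Proof.
move=> AB h eps /h[U [D [BU D0 dU sU]]]; exists U, D; split=> //.
exact: subset_trans BU.
Qed.

Lemma snull_holder (s C : R) (T A : set R) (h : R -> R) : 0 < C -> 0 < s ->
  (forall t, T t -> A (h t)) ->
  (forall t t', T t -> T t' -> `|t - t'| <= C * `|h t - h t'| `^ s) ->
  snull s A -> snull 1 T.
Proof.
move=> C0 s0 hT hC hA eps e0.
have [|U [D [AU D0 dU sU]]] := hA (eps / C); first by rewrite divr_gt0.
exists (fun k => T `&` h @^-1` U k), (fun k => C * D k `^ s); split.
- by move=> t Tt; have [k _ Uk] := AU _ (hT t Tt); exists k.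
- by move=> k; rewrite mulr_ge0 ?powR_ge0// ltW.
- move=> k x y [Tx Ux] [Ty Uy]; apply: (le_trans (hC _ _ Tx Ty)).
  by rewrite ler_pM2l// ge0_ler_powR ?nnegrE ?D0 ?(ltW s0)// (dU _ _ _ Ux Uy).
- move=> n; rewrite (eq_bigr (fun k : 'I_n => C * D k `^ s)).
    by rewrite -mulr_sumr mulrC -ler_pdivlMr//; exact: sU.
  by move=> k _; rewrite powRr1// mulr_ge0 ?powR_ge0// ltW.
Qed.

(** The only use of Lebesgue measure. The factor 2 comes from replacing [U i], which may fail to be
    measurable, by the interval of radius [D i] around one of its points. *)
Lemma cover01_le (I : countType) (U : I -> set R) (D : I -> R) (e : R) :
  `[0, 1[%classic `<=` [set x | exists i, U i x] ->
  (forall i, 0 <= D i) ->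
  (forall i x y, U i x -> U i y -> `|x - y| <= D i) ->
  (forall l, uniq l -> \sum_(i <- l) D i <= e) -> 1 <= 2 * e.
Proof.
move=> hU D0 dU sU.
pose c i : R := xget 0 (U i).
pose F k : set R := if pickle_inv k is Some i then `[c i - D i, c i + D i]%classic else set0.
have mF k : measurable (F k).
  by rewrite /F; case: (pickle_inv k) => [i|]; [exact: measurable_itv|exact: measurable0].
have sub : `[0, 1[%classic `<=` \bigcup_k F k.
  move=> x /hU[i Ui]; exists (pickle i) => //; rewrite /F pickleK_inv /= in_itv /=.
  have /(dU _ _ _ Ui) : U i (c i) by exact: xgetPex (ex_intro _ _ Ui).
  rewrite ler_norml => /andP[]; lra.
have /= := measure_sigma_subadditive (@lebesgue_measure R) mF (measurable_itv _) sub.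
rewrite lebesgue_measure_itv /= lte_fin ltr01 sube0 => h1.
rewrite -lee_fin; apply: (le_trans h1).
apply: lime_le; first by apply: is_cvg_nneseries => k _ _; exact: measure_ge0.
apply: nearW => n.
apply: (@le_trans _ _ (\sum_(i <- pmap (@pickle_inv I) (iota 0 n)) (2 * D i))%:E); last first.
  rewrite lee_fin -mulr_sumr ler_pM2l// sU//.
  by apply: (pmap_uniq (@pickle_invK I)); exact: iota_uniq.
rewrite /index_iota subn0; elim: (iota 0 n) => [|k l IH]; first by rewrite !big_nil.
rewrite big_cons /= {1}/F; case: (pickle_inv k) => [i|] /=; last first.
  by rewrite measure0 add0e.
rewrite big_cons EFinD leeD//.
rewrite lebesgue_measure_itv /=; case: ifP => _.
  by rewrite -EFinB lee_fin; lra.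
by rewrite lee_fin mulr_ge0.
Qed.

End null_sets.

(** * Powers and the mean value theorem on the unit interval *)

Section power_estimates.
Context {R : realType}.
Implicit Types x y p b c q : R.

Lemma ln_sub_le x y : 0 < x -> 0 < y -> ln x - ln y <= (x - y) / y.
Proof.
move=> x0 y0; rewrite -ln_div ?posrE//.
have -> : x / y = 1 + (x - y) / y by field; rewrite gt_eqF.
apply: le_ln1Dx.
have -> : (x - y) / y = x / y - 1 by field; rewrite gt_eqF.
by rewrite ltrBDr addNr divr_gt0.
Qed.

Lemma powR_expR x p : 0 < x -> x `^ p = expR (p * ln x).
Proof. by move=> x0; rewrite /powR gt_eqF. Qed.

(** The inequality [1 + u <= expR u] in the variable [ln x], hence valid for [b] of either sign;
    negative exponents serve for tails of series. *)
Lemma powR_tangent_le x y b : 0 < x -> 0 < y ->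
  y `^ b * (1 + b * (ln x - ln y)) <= x `^ b.
Proof.
move=> x0 y0; rewrite !powR_expR//.
have -> : b * ln x = b * ln y + b * (ln x - ln y) by ring.
by rewrite expRD ler_pM2l ?expR_gt0// expR_ge1Dx.
Qed.

(** From [u <= expR u] at [u = c * x / p], raised to the power [p]. *)
Lemma powR_le_expR x p c : 0 < p -> 0 < c -> 0 <= x ->
  x `^ p <= (p / c) `^ p * expR (c * x).
Proof.
move=> p0 c0 x0.
have -> : expR (c * x) = (expR (c * x / p)) `^ p.
  by rewrite -expRM divfK // gt_eqF.
rewrite -powRM ?expR_ge0 ?divr_ge0 ?(ltW p0) ?(ltW c0)//.
apply: ge0_ler_powR; rewrite ?nnegrE ?(ltW p0)//.
  by rewrite mulr_ge0 ?expR_ge0 ?divr_ge0 ?ltW.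
have h := expR_ge1Dx (c * x / p).
have pc : 0 < p / c by rewrite divr_gt0.
apply: (@le_trans _ _ (p / c * (c * x / p))).
  by rewrite le_eqVlt; apply/orP; left; apply/eqP; field; rewrite !gt_eqF.
by rewrite ler_pM2l//; lra.
Qed.

Lemma powR_superadditive x y b : 0 <= x -> 0 <= y -> 1 <= b ->
  x `^ b + y `^ b <= (x + y) `^ b.
Proof.
move=> x0 y0 b1; have b0 : 0 < b by lra.
have b10 : 0 <= b - 1 by lra.
have xy0 : 0 <= x + y by lra.
rewrite -(mulr_powRB1 x0 b0) -(mulr_powRB1 y0 b0) -(mulr_powRB1 xy0 b0) mulrDl.
by apply: lerD; apply: ler_wpM2l => //; apply: ge0_ler_powR; rewrite ?nnegrE//; lra.
Qed.

Lemma powR_incr_le x y b : 0 < x -> 0 <= y -> 0 <= b ->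
  (x + y) `^ b - x `^ b <= (x + y) `^ b * (b * (y / x)).
Proof.
move=> x0 y0 b0; have xy0 : 0 < x + y by lra.
have := powR_tangent_le b x0 xy0.
have := ln_sub_le xy0 x0; rewrite addrAC subrr add0r => h1 h2.
have : b * (ln (x + y) - ln x) <= b * (y / x) by rewrite ler_wpM2l.
have := powR_gt0 b xy0.
by set P := (x + y) `^ b in h2 * => P0 h3; nra.
Qed.

(** Integral comparison in discrete form: the tangent inequality bounds each term by a difference of
    values of k^(-q) / q, and these telescope. *)
Lemma tail_sum_le q (v M : nat) : 0 < q -> (0 < v)%N ->
  \sum_(v <= k < M) (k.+1)%:R `^ (- (1 + q)) <= v%:R `^ (- q) / q :> R.
Proof.
move=> q0 v0.
have step k : (0 < k)%N ->
    (k.+1)%:R `^ (- (1 + q)) <= (k%:R `^ (- q) - (k.+1)%:R `^ (- q)) / q :> R.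
  move=> k0; have k0' : 0 < k%:R :> R by rewrite ltr0n.
  have k1' : 0 < k.+1%:R :> R by rewrite ltr0n.
  rewrite ler_pdivlMr//.
  have := powR_tangent_le (- q) k0' k1'; have := ln_sub_le k0' k1'.
  have -> : (k%:R - k.+1%:R : R) = -1 by rewrite -natr1; ring.
  have -> : (k.+1%:R : R) `^ (- (1 + q)) = k.+1%:R `^ (- q) * k.+1%:R^-1.
    rewrite opprD addrC powRD ?powR_inv1 ?ler0n//; apply/implyP => _.
    by rewrite gt_eqF.
  have := powR_gt0 (- q) k1'; set P := _ `^ _; set l := ln _ - ln _; rewrite mulN1r.
  set i := (k.+1%:R)^-1 => P0 h1 h2; have : q * i <= - q * l by rewrite mulNr -mulrN ler_pM2l//; lra.
  by move=> h3; have := ler_wpM2l (ltW P0) h3; lra.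
have [Mv|vM] := leqP M v; first by rewrite big_geq// divr_ge0 ?powR_ge0 ?ltW.
apply: (@le_trans _ _ (\sum_(v <= k < M) (k%:R `^ (- q) - (k.+1)%:R `^ (- q)) / q)).
  by rewrite big_nat [leRHS]big_nat; apply: ler_sum => k /andP[vk _]; apply: step; exact: leq_trans vk.
rewrite -mulr_suml ler_pM2r ?invr_gt0//.
rewrite (eq_bigr (fun k => (- ((k.+1)%:R `^ (- q))) - (- (k%:R `^ (- q))))).
  rewrite (telescope_sumr (fun k => - (k%:R `^ (- q)))) ?(ltnW vM)//.
  by have := powR_ge0 (M%:R : R) (- q); lra.
by move=> k _; ring.
Qed.

End power_estimates.

Section C1_unit_interval.
Context {R : realType}.
Implicit Types (g : R -> R).

Lemma derivable01_cvg g x e : derivable01 g x -> 0 < e ->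
  exists2 r, 0 < r & forall y, y \in `[0, 1] -> y != x -> `|x - y| < r ->
    `|derive01 g x - quotient01 g x y| <= e.
Proof.
move=> h e0.
have /cvgrPdist_le/(_ e e0) : quotient01 g x y @[y --> within `[0, 1]%classic x^'] --> derive01 g x by [].
rewrite /within /= /dnbhs /within /=.
case/nbhs_ballP => r r0 hr; exists r => // y y01 yx xy.
exact: hr.
Qed.

Lemma C1_01_continuous g : C1_01 g -> {within `[0, 1], continuous g}.
Proof.
move=> [dg _]; apply/subspace_continuousP => x x01; apply/cvgrPdist_le => e e0.
have [r r0 hr] := derivable01_cvg (dg x x01) ltr01.
set l := derive01 g x in hr.
rewrite /within /=; apply/nbhs_ballP.
have l0 : 0 < `|l| + 1 by rewrite ltr_wpDl.
exists (Num.min r (e / (`|l| + 1))); first by rewrite /= lt_min r0 divr_gt0.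
move=> y; rewrite /ball /= lt_min => /andP[yr ye] y01.
have [->|yx] := eqVneq y x; first by rewrite subrr normr0 ltW.
have := hr y y01 yx yr.
have yx' : y - x != 0 by rewrite subr_eq0.
have -> : g x - g y = - (quotient01 g x y * (y - x)) by rewrite /quotient01 divfK// opprB.
rewrite normrN normrM => h.
have : `|quotient01 g x y| <= `|l| + 1.
  have := ler_normD (quotient01 g x y - l) l; rewrite subrK distrC; lra.
move=> h1; apply: (@le_trans _ _ ((`|l| + 1) * `|y - x|)); first by rewrite ler_wpM2r.
by rewrite mulrC -ler_pdivlMr// distrC ltW.
Qed.

Lemma C1_01_mvt g x y : C1_01 g -> x \in `[0, 1] -> y \in `[0, 1] -> x <= y ->
  exists2 c, c \in `[0, 1] & g y - g x = derive01 g c * (y - x).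
Proof.
move=> Cg x01 y01 xy.
move: (x01) (y01); rewrite !in_itv /= => /andP[x0 x1] /andP[y0 y1].
have [|||c cxy E] := @MVT_segment _ g (derive01 g) x y => //.
- move=> z; rewrite in_itv /= => /andP[xz zy].
  have z01 : z \in `[0, 1] by rewrite in_itv /=; lra.
  (* At an interior point the derivative relative to [0, 1] is the ordinary two-sided one. *)
  have cv : (fun h : R => h^-1 *: ((g \o shift z) (h *: (1 : R)) - g z)) @ 0^' --> derive01 g z.
    apply/cvgrPdist_le => e e0; have [r r0 hr] := derivable01_cvg (Cg.1 z z01) e0.
    rewrite /dnbhs /within /=; apply/nbhs_ballP.
    exists (Num.min r (Num.min z (1 - z))); first by rewrite /= !lt_min r0/=; lra.
    move=> h; rewrite /ball /= !lt_min sub0r normrN => /and3P[hr' hz hz1] h0.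
    have hz2 : h + z \in `[0, 1].
      by rewrite in_itv /=; move: hz hz1; rewrite !ltr_norml => /andP[? ?] /andP[? ?]; lra.
    have := hr (h + z) hz2; rewrite -subr_eq0 addrK => /(_ h0).
    have -> : `|z - (h + z)| = `|h| by rewrite opprD addrCA subrr addr0 normrN.
    move=> /(_ hr'); rewrite /quotient01 addrK mulrC.
    by rewrite /= [_ *: 1]mulr1.
  split; last exact: cvg_lim.
  by apply/cvg_ex; exists (derive01 g z).
- apply: continuous_subspaceW (C1_01_continuous Cg).
  by move=> z /=; rewrite !in_itv /= => /andP[? ?]; lra.
- exists c => //; move: cxy; rewrite !in_itv /= => /andP[? ?]; lra.
Qed.

End C1_unit_interval.

(** * The intervals of order one *)

Section first_level.
Context {R : realType}.
Variables (d : R) (f : nat -> R -> R).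
Hypothesis hf : gauss_like_ifs d f.

(** By the mean value theorem the derivative bounds become bounds on distances, which multiply along
    words without any chain rule. *)
Lemma ifs_bilipschitz (dl : R) : 0 < dl ->
  exists K1 K2 : R, [/\ 0 < K1, 0 < K2 &
    forall i x y, (0 < i)%N -> x \in `[0, 1] -> y \in `[0, 1] ->
      K1 * i%:R `^ (- (d + dl)) * `|x - y| <= `|f i x - f i y| <=
      K2 * i%:R `^ (- (d - dl)) * `|x - y|].
Proof.
move=> dl0; have [K1 [K2 [K10 K20 H]]] := ifs_decay hf dl0.
exists K1, K2; split => // i x y i0 x01 y01.
have [xi [la {}H]] := H i i0.
wlog xy : x y x01 y01 / x <= y => [wl|].
  have [|/ltW yx] := leP x y; first exact: wl.
  by have := wl y x y01 x01 yx; rewrite distrC [`|f i y - _|]distrC.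
have [z z01 E] := C1_01_mvt (ifs_C1 hf i0) x01 y01 xy.
have [h1 h2 h3 h4] := H z z01.
rewrite distrC [`|f i x - _|]distrC E normrM !powRN; apply/andP; split; apply: ler_wpM2r => //; lra.
Qed.

Lemma ifs_injective i : (0 < i)%N -> {in `[0, 1] &, injective (f i)}.
Proof.
move=> i0 x y x01 y01 E.
have [K1 [K2 [K10 K20 H]]] := ifs_bilipschitz (@ltr01 R).
have /andP[+ _] := H i x y i0 x01 y01.
rewrite E subrr normr0 => h; apply/eqP; rewrite -subr_eq0 -normr_le0.
have p : 0 < K1 * (i%:R : R) `^ (- (d + 1)) by rewrite mulr_gt0 ?powR_gt0 ?ltr0n.
by rewrite -(pmulr_rle0 _ p).
Qed.

Let lo i := Num.min (f i 0) (f i 1).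
Let hi i := Num.max (f i 0) (f i 1).

Let in0 : (0 : R) \in `[0, 1]. Proof. by rewrite in_itv /= lexx ler01. Qed.
Let in1 : (1 : R) \in `[0, 1]. Proof. by rewrite in_itv /= lexx ler01. Qed.

Let image_itv i : (0 < i)%N -> f i @` `[0, 1] = `[lo i, hi i]%classic.
Proof.
move=> i0; apply: continuous_inj_image_segment.
- exact: ler01.
- exact: C1_01_continuous (ifs_C1 hf i0).
- exact: ifs_injective.
Qed.

Let lo_hi i : (0 < i)%N -> lo i < hi i.
Proof.
move=> i0; have : f i 0 != f i 1.
  apply/eqP => /(ifs_injective i0 in0 in1)/eqP; rewrite eq_sym.
  by rewrite oner_eq0.
by rewrite /lo /hi neq_lt => /orP[h|h]; rewrite gt_min !lt_max h ?orbT.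
Qed.

Let open_image i y : (0 < i)%N -> lo i < y < hi i -> (f i @` `]0, 1[%classic) y.
Proof.
move=> i0 /andP[h1 h2].
have : (f i @` `[0, 1]) y by rewrite image_itv//= in_itv /=; lra.
case=> x x01 E; exists x => //; move: x01 h1 h2; rewrite /= !in_itv /= -E => /andP[x0 x1].
rewrite /lo /hi gt_min lt_max => h1 h2; apply/andP; split.
  rewrite lt_def x0 andbT; apply/eqP => xE; rewrite xE in h1 h2; move: h1 h2; rewrite !ltxx /= => h1 /lt_trans /(_ h1).
  by rewrite ltxx.
rewrite lt_def x1 andbT eq_sym; apply/eqP => xE; rewrite xE in h1 h2; move: h1 h2; rewrite !ltxx /= ?orbF => h1 /lt_trans /(_ h1).
by rewrite ltxx.
Qed.

Let image_bounds i x : (0 < i)%N -> x \in `[0, 1] -> lo i <= f i x <= hi i.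
Proof.
move=> i0 x01; have : (f i @` `[0, 1]) (f i x) by exists x.
by rewrite image_itv//= in_itv.
Qed.

(** [ifs_order] deduces an order of indices from an order of maps; the converse is needed here.
    Disjoint open images force the two intervals to lie in one of the two orders, and [ifs_order]
    excludes the wrong one. *)
Let hi_le_lo i j : (0 < i)%N -> (i < j)%N -> hi i <= lo j.
Proof.
move=> i0 ij; have j0 : (0 < j)%N by apply: leq_trans ij.
have disj := ifs_disjoint hf i0 j0.
have {}disj : f i @` `]0, 1[ `&` f j @` `]0, 1[ = set0 by apply: disj; lia.
rewrite leNgt; apply/negP => h.
have [h'|h'] := ltP (lo i) (hi j); last first.
  suff : (j < i)%N by lia.
  apply: (ifs_order hf) => // x x01.
  have x01' : x \in `[0, 1] by move: x01; rewrite !in_itv /= => /andP[? ?]; lra.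
  have /andP[? ?] := image_bounds i0 x01'; have /andP[? ?] := image_bounds j0 x01'.
  rewrite lt_def; apply/andP; split; last by lra.
  apply/eqP => E; rewrite -[False]/(set0 (f i x)) -disj; split; first by exists x.
  by exists x.
have := lo_hi i0; have := lo_hi j0 => h1 h2.
(* Overlapping intervals would share the midpoint of their intersection, which lies in both open
   images. *)
pose m := (Num.max (lo i) (lo j) + Num.min (hi i) (hi j)) / 2.
have hm : Num.max (lo i) (lo j) < Num.min (hi i) (hi j).
  by rewrite gt_max !lt_min h1 h2 h h'.
have m1 : Num.max (lo i) (lo j) < m by rewrite /m; lra.
have m2 : m < Num.min (hi i) (hi j) by rewrite /m; lra.
move: m1 m2; rewrite gt_max lt_min => /andP[? ?] /andP[? ?].
by rewrite -[False]/(set0 m) -disj; split; apply: open_image => //; apply/andP.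
Qed.

(* c n is the right end of the interval of the letter n, and c 0 = 0; the letter n.+1
   occupies [c n, c n.+1]. *)
Record cells (c : nat -> R) : Prop := Cells {
  cells0 : c 0%N = 0 ;
  cells_lt : forall n, c n < c n.+1 ;
  cells_lt1 : forall n, c n < 1 ;
  cells_sup : forall y, y < 1 -> exists n, y <= c n ;
  cells_image : forall n, f n.+1 @` `[0, 1] = `[c n, c n.+1]%classic }.

(** The images are ordered, do not overlap and have union [0, 1): a gap between consecutive ones
    would contain an uncovered point, and covering points near 1 makes the right ends tend to 1. *)
Lemma ifs_cells : exists c, cells c.
Proof.
have inunion y : 0 <= y < 1 -> exists2 i, (0 < i)%N & lo i <= y <= hi i.
  move=> y01; have : `[0, 1[%classic y by rewrite /= in_itv.
  rewrite -(ifs_cover hf) => -[i i0]; rewrite (image_itv i0) /= in_itv /= => h.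
  by exists i.
have lohi01 i : (0 < i)%N -> 0 <= lo i /\ hi i < 1.
  move=> i0; have sub y : lo i <= y <= hi i -> 0 <= y < 1.
    move=> h; have : (\bigcup_(i in [set i | (0 < i)%N]) (f i @` `[0, 1]%classic)) y.
      by exists i => //; rewrite image_itv//= in_itv.
    by rewrite (ifs_cover hf) /= in_itv.
  have := lo_hi i0 => h; split.
    by have /andP[] : 0 <= lo i < 1 by apply: sub; lra.
  by have /andP[] : 0 <= hi i < 1 by apply: sub; lra.
have lo1 : lo 1 = 0.
  have [//|i i0 /andP[h1 h2]] := inunion 0; first by rewrite lexx ltr01.
  have [h3 h4] := lohi01 i i0; have [h5 h6] := lohi01 1%N isT.
  have [i1|i1] := eqVneq i 1%N; first by rewrite i1 in h1; lra.
  have i2 : (1 < i)%N by lia.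
  have := hi_le_lo (isT : (0 < 1)%N) i2; have := lo_hi (isT : (0 < 1)%N); lra.
have hilo i : (0 < i)%N -> hi i = lo i.+1.
  move=> i0; apply/eqP; rewrite eq_le hi_le_lo//= leNgt; apply/negP => h.
  have [h1 h2] := lohi01 i i0; have [h3 h4] := lohi01 i.+1 isT.
  have := lo_hi i0; have := lo_hi (isT : (0 < i.+1)%N) => h5 h6.
  (* The midpoint of a gap lies in the image of some letter [k]; the order of the images excludes
     both [k <= i] and [i < k]. *)
  have [|k k0 /andP[k1 k2]] := inunion ((hi i + lo i.+1) / 2); first by lra.
  have [ki|ik] := leqP k i.
    suff : hi k <= hi i by lra.
    move: ki; rewrite leq_eqVlt => /orP[/eqP->//|ki].
    by have := hi_le_lo k0 ki; lra.
  suff : lo i.+1 <= lo k by lra.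
  move: ik; rewrite leq_eqVlt => /orP[/eqP->//|ik].
  by have := hi_le_lo (isT : (0 < i.+1)%N) ik; have := lo_hi k0; lra.
exists (fun n => if n is 0%N then 0 else hi n); split => //.
- by move=> [|n]; [rewrite -lo1; exact: lo_hi|rewrite hilo//; exact: lo_hi].
- by move=> [|n]; [exact: ltr01|case: (lohi01 n.+1 isT)].
- move=> y y1; have [y0|y0] := ltP y 0; first by exists 0%N; exact: ltW.
  by have [|[//|i] _ /andP[_ ?]] := inunion y; [rewrite y0|exists i.+1].
- by move=> [|n]; rewrite image_itv//; [rewrite lo1|rewrite -hilo].
Qed.

Section cell_lengths.
Variable c : nat -> R.
Hypothesis hc : cells c.

Lemma cells_le n m : (n <= m)%N -> c n <= c m.
Proof.
elim: m => [|m IH]; first by rewrite leqn0 => /eqP ->.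
rewrite leq_eqVlt => /orP[/eqP->//|]; rewrite ltnS => /IH h.
by have := cells_lt hc m; lra.
Qed.

Lemma cell_length n : c n.+1 - c n = `|f n.+1 1 - f n.+1 0|.
Proof.
have := @image_itv n.+1 isT; rewrite (cells_image hc) => E.
have h := @lo_hi n.+1 isT; have h' := cells_lt hc n.
have e1 : c n = lo n.+1.
  apply/eqP; rewrite eq_le; apply/andP; split.
    have : `[lo n.+1, hi n.+1]%classic (lo n.+1) by rewrite /= in_itv /=; lra.
    by rewrite -E /= in_itv /= => /andP[].
  have : `[c n, c n.+1]%classic (c n) by rewrite /= in_itv /=; lra.
  by rewrite E /= in_itv /= => /andP[].
have e2 : c n.+1 = hi n.+1.
  apply/eqP; rewrite eq_le; apply/andP; split.
    have : `[c n, c n.+1]%classic (c n.+1) by rewrite /= in_itv /=; lra.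
    by rewrite E /= in_itv /= => /andP[].
  have : `[lo n.+1, hi n.+1]%classic (hi n.+1) by rewrite /= in_itv /=; lra.
  by rewrite -E /= in_itv /= => /andP[].
rewrite e1 e2 /lo /hi; case: (ltgtP (f n.+1 0) (f n.+1 1)) => hh.
- by rewrite gtr0_norm//; lra.
- by rewrite ltr0_norm//; lra.
- by rewrite hh subrr normr0.
Qed.

Lemma cell_length_bounds (dl : R) : 0 < dl -> exists K1 K2 : R,
  [/\ 0 < K1, 0 < K2 & forall n,
     K1 * n.+1%:R `^ (- (d + dl)) <= c n.+1 - c n <= K2 * n.+1%:R `^ (- (d - dl))].
Proof.
move=> dl0; have [K1 [K2 [K10 K20 H]]] := ifs_bilipschitz dl0.
exists K1, K2; split => // n; rewrite cell_length.
by have := H n.+1 1 0 isT in1 in0; rewrite subr0 normr1 !mulr1.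
Qed.

(** The cells beyond [v] fill the interval from [c v] to 1, and summing their lengths, of order
    k^(-(d - dl)), lowers the exponent by one. This is the origin of the factor d - 1 in (II). *)
Lemma cell_tail_le (dl : R) : 0 < dl -> dl < d - 1 ->
  exists2 C : R, 0 < C & forall v, (0 < v)%N -> 1 - c v <= C * v%:R `^ (- (d - 1 - dl)).
Proof.
move=> dl0 dl1; have [K1 [K2 [K10 K20 H]]] := cell_length_bounds dl0.
have q0 : 0 < d - 1 - dl by lra.
exists (K2 / (d - 1 - dl)) => [|v v0]; first by rewrite divr_gt0.
have bnd M : (v <= M)%N -> c M - c v <= K2 / (d - 1 - dl) * v%:R `^ (- (d - 1 - dl)).
  move=> vM; rewrite -(telescope_sumr c)//.
  rewrite mulrAC -mulrA; apply: (@le_trans _ _ (K2 * \sum_(v <= k < M) k.+1%:R `^ (- (1 + (d - 1 - dl))))).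
    rewrite mulr_sumr; apply: ler_sum => k _; have /andP[_] := H k.
    by have -> : 1 + (d - 1 - dl) = d - dl by lra.
  by rewrite ler_pM2l//; exact: tail_sum_le.
apply/ler_addgt0Pr => e e0.
have [|M hM] := cells_sup hc (y := 1 - e); first by lra.
have := bnd _ (leq_maxr M v); have := cells_le (leq_maxl M v); lra.
Qed.

Lemma cells_cvg1 (e : R) : 0 < e -> exists n, 1 - c n <= e.
Proof. by move=> e0; have [|n hn] := cells_sup hc (y := 1 - e); [lra|exists n; lra]. Qed.

(** The letter [j] occupies the interval from [c j.-1] to [c j], so this lower bound is 0 for
    adjacent letters and useful only if a letter is skipped. *)
Lemma letter_lt (i j : nat) x y : (0 < i)%N -> (i < j)%N -> x \in `[0, 1] -> y \in `[0, 1] ->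
  c j.-1 - c i <= f j y - f i x.
Proof.
case: i => [//|i] _; case: j => [//|j] ij x01 y01 /=.
have : (f i.+1 @` `[0, 1]) (f i.+1 x) by exists x.
have : (f j.+1 @` `[0, 1]) (f j.+1 y) by exists y.
rewrite !(cells_image hc) /= !in_itv /= => /andP[? ?] /andP[? ?]; lra.
Qed.

Lemma letter_ge i x : (0 < i)%N -> x \in `[0, 1] -> c i.-1 <= f i x <= c i.
Proof.
case: i => [//|i] _ x01; have : (f i.+1 @` `[0, 1]) (f i.+1 x) by exists x.
by rewrite (cells_image hc) /= in_itv.
Qed.

End cell_lengths.
End first_level.

(** * Words and symbolic expansions *)

Section word_sums.
Context {R : realType}.

Fixpoint words_below (M N : nat) : seq (seq nat) :=
  if N is N'.+1 then [seq i :: w | i <- iota 0 M, w <- words_below M N'] else [:: [::]].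

Lemma mem_words_below M N w : size w = N -> all (fun i => (i < M)%N) w ->
  w \in words_below M N.
Proof.
elim: N w => [|N IH] [|i w] //= [sw] /andP[iM wM].
by apply: (@allpairs_f _ _ _ cons); [rewrite mem_iota|exact: IH].
Qed.

Lemma words_below_uniq M N : uniq (words_below M N).
Proof.
elim: N => [//|N IH] /=; apply: allpairs_uniq => //; first exact: iota_uniq.
by move=> [i w] [j v] /= _ _ [-> ->].
Qed.

Definition word_weight (g : nat -> nat -> R) (w : seq nat) : R :=
  \prod_(k < size w) g k (nth 0%N w k).

Lemma word_weight_ge0 g w : (forall k i, 0 <= g k i) -> 0 <= word_weight g w.
Proof. by move=> g0; apply: prodr_ge0. Qed.

(** A finite list of words of length [N] lies in a box of words with letters below some [M], over
    which the sum of products factorizes into one-letter sums. *)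
Lemma sum_word_weight_le (g : nat -> nat -> R) (G : nat -> R) (N : nat) (l : seq (seq nat)) :
  (forall k i, 0 <= g k i) ->
  (forall k M, \sum_(i <- iota 0 M) g k i <= G k) ->
  uniq l -> (forall w, w \in l -> size w = N) ->
  \sum_(w <- l) word_weight g w <= \prod_(k < N) G k.
Proof.
move=> g0 gG ul sl.
have [M hM] : exists M, forall w, w \in l -> all (fun i => (i < M)%N) w.
  exists (\max_(w <- l) \max_(i <- w) i.+1)%N => w wl; apply/allP => i iw.
  apply: (@leq_trans (\max_(i <- w) i.+1)%N).
    exact: (@leq_bigmax_seq _ w xpredT (fun i => i.+1)).
  exact: (@leq_bigmax_seq _ l xpredT (fun w => (\max_(i <- w) i.+1)%N)).
apply: (@le_trans _ _ (\sum_(w <- words_below M N) word_weight g w)).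
  apply: ler_sum_uniq => //; first exact: words_below_uniq.
    by move=> w wl; apply: mem_words_below; [exact: sl|exact: hM].
  by move=> w; exact: word_weight_ge0.
elim: N g G g0 gG {sl ul hM} => [|N IH] g G g0 gG.
  by rewrite /= big_seq1 /word_weight /= !big_ord0.
rewrite [words_below _ _]/= big_allpairs_dep /= big_ord_recl /=.
have -> : \sum_(i <- iota 0 M) \sum_(w <- words_below M N) word_weight g (i :: w) =
    (\sum_(i <- iota 0 M) g 0%N i) * \sum_(w <- words_below M N) word_weight (fun k => g k.+1) w.
  rewrite mulr_suml; apply: eq_bigr => i _; rewrite mulr_sumr; apply: eq_bigr => w _.
  by rewrite /word_weight /= big_ord_recl.
apply: ler_pM => //.
- by apply: sumr_ge0 => i _.
- by apply: sumr_ge0 => w _; exact: word_weight_ge0.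
- exact: (IH (fun k => g k.+1) (fun k => G k.+1)).
Qed.

End word_sums.

Section words.
Context {R : realType}.
Variables (d : R) (f : nat -> R -> R).
Hypothesis hf : gauss_like_ifs d f.

Lemma in01_0 : (0 : R) \in `[0, 1]. Proof. by rewrite in_itv /= lexx ler01. Qed.
Lemma in01_1 : (1 : R) \in `[0, 1]. Proof. by rewrite in_itv /= lexx ler01. Qed.
Hint Resolve in01_0 in01_1 : core.

Lemma word_map_cat u v (x : R) : word_map f (u ++ v) x = word_map f u (word_map f v x).
Proof. by elim: u => //= i u ->. Qed.

Lemma word_map_self w x : word w -> x \in `[0, 1] -> word_map f w x \in `[0, 1].
Proof.
elim: w => //= i w IH /andP[i0 ww] x01.
by apply: (ifs_self hf i0); exact: IH.
Qed.

Lemma word_map_upper (g : nat -> R) w x y : (forall i, 0 <= g i) ->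
  (forall i x y, (0 < i)%N -> x \in `[0, 1] -> y \in `[0, 1] ->
     `|f i x - f i y| <= g i * `|x - y|) ->
  word w -> x \in `[0, 1] -> y \in `[0, 1] ->
  `|word_map f w x - word_map f w y| <= (\prod_(k < size w) g (nth 0%N w k)) * `|x - y|.
Proof.
move=> g0 hg; elim: w => [|i w IH] /=; first by rewrite big_ord0 mul1r.
move=> /andP[i0 ww] x01 y01; rewrite big_ord_recl /= -mulrA.
apply: (le_trans (hg _ _ _ i0 (word_map_self ww x01) (word_map_self ww y01))).
by apply: ler_wpM2l => //; exact: IH.
Qed.

Lemma word_map_lower (g : nat -> R) w x y : (forall i, 0 <= g i) ->
  (forall i x y, (0 < i)%N -> x \in `[0, 1] -> y \in `[0, 1] ->
     g i * `|x - y| <= `|f i x - f i y|) ->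
  word w -> x \in `[0, 1] -> y \in `[0, 1] ->
  (\prod_(k < size w) g (nth 0%N w k)) * `|x - y| <= `|word_map f w x - word_map f w y|.
Proof.
move=> g0 hg; elim: w => [|i w IH] /=; first by rewrite big_ord0 mul1r.
move=> /andP[i0 ww] x01 y01; rewrite big_ord_recl /= -mulrA.
apply: le_trans (hg _ _ _ i0 (word_map_self ww x01) (word_map_self ww y01)).
by apply: ler_wpM2l => //; exact: IH.
Qed.

Lemma word_map_injective w : word w -> {in `[0, 1] &, injective (word_map f w)}.
Proof.
elim: w => [_ x y //|i w IH] /= /andP[i0 ww] x y x01 y01 E; apply: (IH ww) => //.
by apply: (ifs_injective hf i0) E; exact: word_map_self.
Qed.

Lemma word_map_continuous w : word w -> {within `[0, 1], continuous (word_map f w)}.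
Proof.
move=> ww; have [K1 [K2 [K10 K20 H]]] := ifs_bilipschitz hf ltr01.
pose g i := K2 * (i%:R : R) `^ (- (d - 1)).
have g0 i : 0 <= g i by rewrite mulr_ge0 ?powR_ge0 ?ltW.
have up := word_map_upper g0 (fun i x y i0 x01 y01 => (andP (H i x y i0 x01 y01)).2) ww.
set L := \prod_(_ < _) _ in up.
have L0 : 0 <= L by apply: prodr_ge0.
have L1 : 0 < L + 1 by lra.
apply/subspace_continuousP => x x01; apply/cvgrPdist_le => e e0.
rewrite /within /=; apply/nbhs_ballP; exists (e / (L + 1)); first by rewrite /= divr_gt0.
move=> y; rewrite /ball /= => xy y01.
apply: (le_trans (up x y x01 y01)); apply: (@le_trans _ _ ((L + 1) * `|x - y|)).
  by apply: ler_wpM2r => //; lra.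
by rewrite mulrC -ler_pdivlMr// ltW.
Qed.

Lemma word_map_monotone w : word w ->
  {in `[0, 1] &, {mono word_map f w : x y / x <= y}} \/
  {in `[0, 1] &, {mono word_map f w : x y /~ x <= y}}.
Proof.
move=> ww; have [h|h] := leP (word_map f w 0) (word_map f w 1).
  left; apply: segment_continuous_inj_le => //; [exact: word_map_continuous|exact: word_map_injective].
right; apply: segment_continuous_inj_ge; first exact: ltW.
- exact: word_map_continuous.
- exact: word_map_injective.
Qed.

Lemma basic_interval_itv w : word w -> basic_interval f w =
  `[Num.min (word_map f w 0) (word_map f w 1), Num.max (word_map f w 0) (word_map f w 1)]%classic.
Proof.
move=> ww; apply: continuous_inj_image_segment.
- exact: ler01.
- exact: word_map_continuous.
- exact: word_map_injective.
Qed.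

Lemma basic_interval_catl u v x : word v -> basic_interval f (u ++ v) x -> basic_interval f u x.
Proof.
move=> wv [z z01 <-]; rewrite word_map_cat; exists (word_map f v z) => //.
exact: word_map_self.
Qed.

Lemma word_mkseq (a : nat -> nat) n : (forall k, (0 < a k)%N) -> word (mkseq a n).
Proof. by move=> a0; apply/allP => i /mapP[k _ ->]. Qed.

Lemma mkseq_add (a : nat -> nat) n m : mkseq a (n + m) = mkseq a n ++ mkseq (fun k => a (n + k)%N) m.
Proof.
rewrite /mkseq iotaD map_cat add0n; congr (_ ++ _).
rewrite -[in LHS](addn0 n) iotaDl -map_comp; exact: eq_map.
Qed.

Lemma mkseq_split (a : nat -> nat) n m : (n <= m)%N ->
  exists2 v, (forall k, (0 < a k)%N) -> word v & mkseq a m = mkseq a n ++ v.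
Proof.
move=> nm; exists (mkseq (fun k => a (n + k)%N) (m - n)) => [a0|].
  exact: word_mkseq.
by rewrite -mkseq_add subnKC.
Qed.

(** Nested compact intervals meet, here at the supremum of their left ends. The word maps may
    reverse orientation, whence [Num.min] and [Num.max]. *)
Lemma expansion_exists (a : nat -> nat) : (forall k, (0 < a k)%N) -> exists x, expansion f x a.
Proof.
move=> a0; pose F n := word_map f (mkseq a n).
pose lo n := Num.min (F n 0) (F n 1); pose hi n := Num.max (F n 0) (F n 1).
have IE n : basic_interval f (mkseq a n) = `[lo n, hi n]%classic.
  by rewrite basic_interval_itv//; exact: word_mkseq.
have F0 n m : (n <= m)%N -> lo n <= F m 0 <= hi n.
  move=> nm; have : basic_interval f (mkseq a n) (F m 0).
    have [v wv E] := mkseq_split a nm.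
    apply: (@basic_interval_catl _ v); first exact: wv.
    by rewrite -E; exists 0 => //; exact: in01_0.
  by rewrite IE /= in_itv.
have lohi n m : lo n <= hi m.
  have /andP[h _] := F0 n (maxn n m) (leq_maxl _ _).
  have /andP[_ h'] := F0 m (maxn n m) (leq_maxr _ _).
  exact: le_trans h'.
pose S := [set lo n | n in [set: nat]].
have hS : has_sup S.
  by split; [exists (lo 0%N), 0%N|exists (hi 0%N) => _ [n _ <-]].
exists (sup S); split => // n; rewrite IE /= in_itv /=; apply/andP; split.
  by apply: ub_le_sup; [case: hS|exists n].
by apply: ge_sup; [case: hS|move=> _ [m _ <-]].
Qed.

Lemma expansion_in01 x a : expansion f x a -> x \in `[0, 1].
Proof. by move=> [_ /(_ 0%N)] [z z01 <-]. Qed.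

(** Each longer prefix gives its own preimage of [x] under the map of the first [n] letters;
    injectivity of that map shows that they all coincide. *)
Lemma expansion_tail x a n : expansion f x a ->
  exists z, expansion f z (fun k => a (n + k)%N) /\ x = word_map f (mkseq a n) z.
Proof.
move=> [a0 H].
have [z0 z001 E] := H n; exists z0; split=> //; split => // m.
have := H (n + m)%N; rewrite mkseq_add => -[y y01]; rewrite word_map_cat => E'.
have wm : word (mkseq (fun k => a (n + k)%N) m) by exact: word_mkseq.
rewrite -E in E'; have := word_map_injective (word_mkseq n a0) (word_map_self wm y01) z001 E'.
by move=> <-; exists y.
Qed.

Lemma expansion_first x a : expansion f x a -> exists2 z, z \in `[0, 1] & x = f (a 0%N) z.
Proof. by move=> [a0 /(_ 1%N)] [z z01 <-]; exists z. Qed.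

Lemma expansion_separation (g : nat -> R) c x x' a a' n : cells f c ->
  (forall i, 0 <= g i) ->
  (forall i x y, (0 < i)%N -> x \in `[0, 1] -> y \in `[0, 1] ->
     g i * `|x - y| <= `|f i x - f i y|) ->
  expansion f x a -> expansion f x' a' ->
  (forall k, (k < n)%N -> a k = a' k) -> (a n < a' n)%N ->
  (\prod_(k < n) g (a k)) * (c (a' n).-1 - c (a n)) <= `|x - x'|.
Proof.
move=> hc g0 hg ex ex' eqa lt.
have [z [ez ->]] := expansion_tail n ex; have [z' [ez' ->]] := expansion_tail n ex'.
have -> : mkseq a' n = mkseq a n.
  by apply/esym/eq_in_map => k; rewrite mem_iota => /andP[_ kn]; exact: eqa.
have wa : word (mkseq a n) by apply: word_mkseq; case: ex.
have h := word_map_lower g0 hg wa (expansion_in01 ez) (expansion_in01 ez').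
have E : \prod_(k < size (mkseq a n)) g (nth 0%N (mkseq a n) k) = \prod_(k < n) g (a k).
  rewrite size_mkseq; apply: eq_bigr => k _; by rewrite nth_mkseq.
rewrite E in h; apply: le_trans h; apply: ler_wpM2l; first exact: prodr_ge0.
have [y y01 ->] := expansion_first ez; have [y' y01' ->] := expansion_first ez'.
rewrite addn0; have a0 : (0 < a n)%N by case: ex.
have := letter_lt hc a0 lt y01 y01'; rewrite distrC => /le_trans; apply; exact: ler_norm.
Qed.

Lemma expansion_gt0_lt1 c x a : cells f c -> expansion f x a -> (1 < a 0%N)%N -> x \in `]0, 1[.
Proof.
move=> hc ex a1; have [z z01 ->] := expansion_first ex.
have a0 : (0 < a 0%N)%N by apply: leq_trans a1.
have /andP[h1 h2] := letter_ge hc a0 z01.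
have := cells_lt1 hc (a 0%N); have := cells_lt hc 0%N; rewrite (cells0 hc) => h3 h4.
have h5 : c 1%N <= c (a 0%N).-1 by apply: (cells_le hc); lia.
by rewrite in_itv /=; lra.
Qed.

Lemma birkhoff_sumE (b : R) phi a n :
  (forall j : nat, (0 < j)%N -> potential_value f phi j = expR (ln (j%:R : R) `^ b)) ->
  (forall k, (0 < a k)%N) ->
  birkhoff_sum f phi a n = \sum_(k < n) expR (ln ((a k)%:R : R) `^ b).
Proof. by move=> hval a0; apply: eq_bigr => k _; exact: hval. Qed.

End words.

(** * Upper bounds for the dimension *)

Section upper_bounds.
Context {R : realType}.

Lemma powR_prod (I : Type) (l : seq I) (F : I -> R) (s : R) : (forall i, 0 <= F i) ->
  (\prod_(i <- l) F i) `^ s = \prod_(i <- l) F i `^ s.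
Proof.
move=> F0; elim: l => [|i l IH]; first by rewrite !big_nil powR1.
by rewrite !big_cons powRM ?IH// prodr_ge0.
Qed.

Lemma exists_inv_exp2_le (eps : R) : 0 < eps -> exists N0, forall N, (N0 <= N)%N -> (2 ^+ N)^-1 <= eps.
Proof.
move=> e0; exists (Num.truncn eps^-1).+1 => N NN.
have e1 : 0 <= eps^-1 by rewrite invr_ge0 ltW.
rewrite -[leRHS]invrK lef_pV2 ?posrE ?exprn_gt0 ?invr_gt0//.
have /andP[_ h] := truncn_itv e1.
apply: (le_trans (ltW h)); rewrite -natrX ler_nat.
by apply: leq_trans NN _; rewrite ltnW// ltn_expl.
Qed.

Lemma sum_powR_le (e : R) (M : nat) : 0 < e ->
  \sum_(i <- iota 0 M) (if (0 < i)%N then (i%:R : R) `^ (- (1 + e)) else 0) <= 1 + e^-1.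
Proof.
move=> e0; have h0 : 0 <= 1 + e^-1 by rewrite addr_ge0 ?invr_ge0 ?ltW.
have -> : iota 0 M = index_iota 0 M by rewrite /index_iota subn0.
case: M => [|[|M]]; first by rewrite big_geq.
  by rewrite big_nat1.
rewrite big_nat_recl// big_nat_recl// /= add0r powR1 lerD2l.
have := @tail_sum_le R e 1 M.+1 e0 isT; rewrite powR1 mul1r; apply: le_trans.
by rewrite big_add1 /=.
Qed.

Variables (d : R) (f : nat -> R -> R).
Hypotheses (d1 : 1 < d) (hf : gauss_like_ifs d f).

(* Half of the excess of s over 1 / d makes the sum over one letter converge; the other half
   gains a factor (a_0 ... a_(N-1))^(-e) <= exp(- e L N). *)
Lemma snull_log_mean (s : R) (A : set R) : 1 / d < s ->
  (forall x, A x -> exists a, expansion f x a /\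
    forall L : R, exists N0, forall N, (N0 <= N)%N ->
      L * N%:R <= \sum_(k < N) ln ((a k)%:R : R)) ->
  snull s A.
Proof.
move=> ds hA.
have d0 : 0 < d := lt_trans ltr01 d1; have d1' := d1.
have s0 : 0 < s by apply: lt_trans ds; rewrite divr_gt0.
have {ds}sd : 1 < s * d by rewrite -ltr_pdivrMr.
pose dl := (s * d - 1) / (2 * s); pose e := (s * d - 1) / 4.
have dl0 : 0 < dl by rewrite divr_gt0// ?mulr_gt0//; lra.
have e0 : 0 < e by rewrite /e; lra.
have sdl : s * (d - dl) = 1 + e + e by rewrite /dl /e; field; rewrite gt_eqF.
have [K1 [K2 [K10 K20 H]]] := ifs_bilipschitz hf dl0.
have [G EG G0] : exists2 G, G = K2 `^ s * (1 + e^-1) & 0 < G.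
  by eexists => //; rewrite mulr_gt0 ?powR_gt0// addr_gt0 ?invr_gt0.
(* With this mean the gain exp(- e L N) equals (2 G)^(-N), which beats the product G^N of the
   one-letter sums and leaves 2^(-N). *)
pose L := ln (2 * G) / e.
(* On each [AN N0] the threshold is uniform, so one order [N] serves all points. *)
pose AN N0 := [set x | exists a, expansion f x a /\
  forall N, (N0 <= N)%N -> L * N%:R <= \sum_(k < N) ln ((a k)%:R : R)].
apply: (@snull_subset _ _ _ [set x | exists N0, AN N0 x]).
  by move=> x /hA[a [ea /(_ L)[N0 hN]]]; exists N0, a.
apply: snull_bigcup => // N0; apply: (@snull_countable _ (seq nat)) => // eps eps0.
have [N1 hN1] := exists_inv_exp2_le eps0.
pose N := maxn N0 N1.
pose P w := [&& size w == N, word w & L * N%:R <= \sum_(k < size w) ln ((nth 0%N w k)%:R : R)].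
pose g1 i := K2 * (i%:R : R) `^ (- (d - dl)).
have g10 i : 0 <= g1 i by rewrite mulr_ge0 ?powR_ge0 ?ltW.
have up i x y i0 x01 y01 := (andP (H i x y i0 x01 y01)).2.
exists (fun w => if P w then basic_interval f w else set0),
  (fun w => if P w then \prod_(k < size w) g1 (nth 0%N w k) else 0); split.
- move=> x [a [ea hN]]; exists (mkseq a N).
  have -> : P (mkseq a N).
    rewrite /P size_mkseq eqxx word_mkseq /=; last by case: ea.
    rewrite (eq_bigr (fun k : 'I_N => ln ((a k)%:R : R))); first by apply: hN; rewrite leq_maxl.
    by move=> k _; rewrite nth_mkseq.
  by case: ea.
- by move=> w; case: ifP => // _; exact: prodr_ge0.
- move=> w x y; case: ifP => // /and3P[_ ww _] [z z01 <-] [z' z01' <-].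
  have := word_map_upper hf g10 up ww z01 z01'; move=> /le_trans; apply.
  rewrite -[leRHS]mulr1; apply: ler_wpM2l; first exact: prodr_ge0.
  by move: z01 z01'; rewrite /= !in_itv /= ler_norml => /andP[? ?] /andP[? ?]; lra.
- move=> l ul.
  pose g (k i : nat) := K2 `^ s * (if (0 < i)%N then (i%:R : R) `^ (- (1 + e)) else 0).
  have g0 k i : 0 <= g k i by rewrite mulr_ge0 ?powR_ge0//; case: ifP => // _; exact: powR_ge0.
  have gG k M : \sum_(i <- iota 0 M) g k i <= G.
    by rewrite EG -mulr_sumr ler_pM2l ?powR_gt0// sum_powR_le.
  rewrite (bigID P) /= [X in _ + X]big1 ?addr0; last first.
    by move=> w /negbTE ->; rewrite powR0// gt_eqF.
  have step w : P w -> (if P w then \prod_(k < size w) g1 (nth 0%N w k) else 0) `^ s <=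
      word_weight g w * expR (- e * (L * N%:R)).
    move=> Pw; rewrite Pw; move: Pw => /and3P[_ ww hw].
    rewrite powR_prod//.
    apply: (@le_trans _ _ (word_weight g w * expR (- e * \sum_(k < size w) ln ((nth 0%N w k)%:R : R)))).
      rewrite mulr_sumr expR_sum /word_weight -big_split /=; apply: ler_prod => k _.
      rewrite powR_ge0 /=.
      have i0 : (0 < nth 0%N w k)%N by move/allP: ww; apply; rewrite mem_nth.
      rewrite /g1 /g i0 powRM ?powR_ge0 ?(ltW K20)// -mulrA ler_pM2l ?powR_gt0//.
      have i0' : 0 < (nth 0%N w k)%:R :> R by rewrite ltr0n.
      rewrite -powRrM !powR_expR// -expRD ler_expR.
      have -> : - (d - dl) * s = - (1 + e + e) by rewrite -sdl; ring.
      by rewrite le_eqVlt; apply/orP; left; apply/eqP; ring.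
    apply: ler_wpM2l; first exact: word_weight_ge0.
    by rewrite ler_expR !mulNr lerN2 ler_pM2l.
  apply: (@le_trans _ _ (\sum_(w <- l | P w) word_weight g w * expR (- e * (L * N%:R)))).
    exact: ler_sum.
  rewrite -mulr_suml -big_filter.
  apply: (@le_trans _ _ ((\prod_(k < N) G) * expR (- e * (L * N%:R)))).
    apply: ler_wpM2r; first exact: expR_ge0.
    apply: (sum_word_weight_le g0 (fun k M => gG k M)); first exact: filter_uniq.
    by move=> w; rewrite mem_filter => /andP[/and3P[/eqP]].
  apply: le_trans (hN1 N (leq_maxr _ _)).
  rewrite prodr_const card_ord.
  have -> : - e * (L * N%:R) = N%:R * - ln (2 * G) by rewrite /L; field; rewrite gt_eqF.
  have G2 : 0 < 2 * G by rewrite pmulr_rgt0.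
  rewrite expRM_natl expRN lnK ?posrE// exprVn exprMn.
  have GN : G ^+ N != 0 by rewrite expf_neq0// gt_eqF.
  have aux (x y : R) : x != 0 -> x / (y * x) = y^-1 by move=> x0; rewrite invfM mulrCA mulfV ?mulr1.
  by rewrite aux.
Qed.

Lemma sum_indicator_le (Y : R) (M : nat) : 0 <= Y ->
  \sum_(i <- iota 0 M) ((0 < i)%N && (i%:R <= Y))%:R <= Y.
Proof.
move=> Y0.
(* The second bound carries the induction: if the last index is itself at most [Y], counting all
   positive indices so far already gives at most [Y]. *)
suff [h _] : \sum_(i <- iota 0 M) ((0 < i)%N && (i%:R <= Y))%:R <= Y /\
  \sum_(i <- iota 0 M) ((0 < i)%N && (i%:R <= Y))%:R <= M.-1%:R :> R by [].
elim: M => [|M [IH1 IH2]]; first by rewrite big_nil.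
rewrite -addn1 iotaD big_cat /= add0n big_seq1 addn1.
case: M IH1 IH2 => [|M] IH1 IH2; first by rewrite big_nil add0r.
set S := \sum_(i <- _) _ in IH1 IH2 *; case: (boolP (M.+1%:R <= Y)) => /= h.
  have E : M.+1%:R = M%:R + 1 :> R by rewrite natr1.
  by rewrite /= in IH2; split; rewrite -?E; lra.
by rewrite /= addr0; split => //; apply: (le_trans IH2); rewrite ler_nat.
Qed.

Lemma itv_dist_le (l u x y : R) : x \in `[l, u] -> y \in `[l, u] -> `|x - y| <= u - l.
Proof. by rewrite !in_itv /= ler_norml => /andP[? ?] /andP[? ?]; lra. Qed.

Lemma sum_geometric_le (B : R) n : 1 < B -> \sum_(k < n) B ^+ k.+1 <= B ^+ n.+1 / (B - 1).
Proof.
move=> B1; rewrite ler_pdivlMr; last by lra.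
elim: n => [|n IH]; first by rewrite big_ord0 mul0r exprn_ge0//; lra.
rewrite big_ord_recr /= mulrDl [B ^+ n.+2]exprS.
by set X := B ^+ n.+1 in IH *; set S := \sum_(_ < _) _ in IH *; lra.
Qed.

(** B^n dominates a positive multiple of n^2, and a quadratic dominates the linear function as soon
    as n exceeds the constant [M]. *)
Lemma exp_beats_linear (B c1 c2 t : R) (n0 : nat) : 1 < B -> 0 < t ->
  exists2 n, (n0 <= n)%N & c1 * n%:R + c2 <= t * B ^+ n.
Proof.
move=> B1 t0.
have lB : 0 < ln B by rewrite ln_gt0.
pose K := (2 / ln B) `^ 2.
have K0 : 0 < K by rewrite powR_gt0// divr_gt0.
have quad n : t / K * n%:R ^+ 2 <= t * B ^+ n.
  have := powR_le_expR (ltr0n R 2) lB (ler0n R n).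
  rewrite expRM_natr lnK ?posrE; last by lra.
  rewrite -/K => h; rewrite -(powR_mulrn 2 (ler0n R n)).
  rewrite mulrAC ler_pdivrMr// -mulrA ler_pM2l// mulrC; exact: h.
have tK : 0 < t / K by rewrite divr_gt0.
pose M := (`|c1| + `|c2|) / (t / K).
have M0 : 0 <= M by rewrite divr_ge0 ?addr_ge0// ltW.
pose n := maxn n0 (Num.truncn M).+1.
exists n; first by rewrite leq_maxl.
apply: le_trans (quad n).
have Mn : M <= n%:R.
  have /andP[_ /ltW/le_trans] := truncn_itv M0; apply.
  by rewrite ler_nat leq_maxr.
have n1 : 1 <= n%:R :> R by rewrite ler1n (leq_trans _ (leq_maxr _ _)).
have : M * (t / K) = `|c1| + `|c2| by rewrite /M divfK// gt_eqF.
have := ler_norm c1; have := ler_norm c2; have := normr_ge0 c1; have := normr_ge0 c2.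
set a1 := `|c1|; set a2 := `|c2|; set T := t / K in tK * => ? ? ? ? E.
have h1 : T * M <= T * n%:R by rewrite ler_pM2l.
rewrite expr2 mulrA; nra.
Qed.

(** Write Y_k = B^(k+1). At position k there are at most exp(Y_k + 1) letters, each contributing
    about exp(- s d Y_k), and restricting the next letter contributes about exp(- s (d - 1) Y_n).
    For s < 1 / d the first two leave a positive multiple [sg] of the sum of the Y_k, which is at
    most Y_n / (B - 1); the hypothesis on [s] makes the total exponent - t Y_n with [t > 0]. *)
Lemma snull_log_geometric (B s : R) (A : set R) : 1 < B ->
  1 / (d + (d - 1) * (B - 1)) < s -> s < 1 / d ->
  (forall x, A x -> exists a, expansion f x a /\
    exists N0, forall k, (N0 <= k)%N ->
      B ^+ k.+1 - 1 <= ln ((a k)%:R : R) <= B ^+ k.+1 + 1) ->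
  snull s A.
Proof.
move=> B1 sD sd hA.
have d0 : 0 < d := lt_trans ltr01 d1; have d1' := d1.
have D0 : 0 < d + (d - 1) * (B - 1) by rewrite addr_gt0// mulr_gt0 ?subr_gt0.
have {}sd : s * d < 1 by rewrite -ltr_pdivlMr.
have s0 : 0 < s by apply: lt_trans sD; rewrite divr_gt0.
have {}sD : 1 < s * (d + (d - 1) * (B - 1)) by rewrite -ltr_pdivrMr.
(* The first bound makes [dl] use up at most half of the excess of [s * (d + (d - 1) * (B - 1))]
   over 1, so that [t > 0]; the second keeps [q > 0]. *)
pose dl := Num.min ((s * (d + (d - 1) * (B - 1)) - 1) / (2 * s * B)) ((d - 1) / 2).
have sB : 0 < 2 * s * B by rewrite !mulr_gt0//; lra.
have dl0 : 0 < dl.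
  by rewrite /dl lt_min; apply/andP; split; [rewrite divr_gt0// subr_gt0|lra].
have dl1 : dl < d - 1 by rewrite /dl gt_min; apply/orP; right; lra.
have ddl0 : 0 <= d - dl by lra.
have dl2 : dl * (2 * s * B) <= s * (d + (d - 1) * (B - 1)) - 1.
  by rewrite -ler_pdivlMr// /dl ge_min lexx.
pose q := d - 1 - dl; pose sg := 1 - s * (d - dl).
have q0 : 0 < q by rewrite /q; lra.
have sg0 : 0 < sg by rewrite /sg; nra.
pose t := s * q - sg / (B - 1).
have t0 : 0 < t.
  rewrite /t subr_gt0 ltr_pdivrMr; last by lra.
  by rewrite /q /sg; nra.
clear sd sD dl2 sB D0.
have [K1 [K2 [K10 K20 H]]] := ifs_bilipschitz hf dl0.
have [c hc] := ifs_cells hf.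
have [C C0 hC] := cell_tail_le hf hc dl0 dl1.
pose g1 i := K2 * (i%:R : R) `^ (- (d - dl)).
have g10 i : 0 <= g1 i by rewrite mulr_ge0 ?powR_ge0 ?ltW.
have up i x y i0 x01 y01 := (andP (H i x y i0 x01 y01)).2.
(* The whole initial word is fixed, not only its length: its letters are unrestricted, and for s < 1
   / d a sum over all values of a letter would not be controlled. *)
pose AN w0 := [set x | exists a, [/\ expansion f x a, mkseq a (size w0) = w0 &
  forall k, (size w0 <= k)%N -> B ^+ k.+1 - 1 <= ln ((a k)%:R : R) <= B ^+ k.+1 + 1]].
apply: (@snull_subset _ _ _ [set x | exists w0, AN w0 x]).
  move=> x /hA[a [ea [N0 hN]]]; exists (mkseq a N0), a.
  by rewrite size_mkseq.
apply: snull_bigcup => // w0; apply: (@snull_countable _ (seq nat)) => // eps eps0.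
pose N0 := size w0.
pose K := K2 `^ s.
have K0 : 0 < K by rewrite powR_gt0.
pose c1 := ln K + (1 + (d - dl) * s).
pose c2 := s * ln (C * (4 `^ q * expR q)).
have C40 : 0 < C * (4 `^ q * expR q) by rewrite !mulr_gt0 ?powR_gt0 ?expR_gt0.
(* The order [n] is so large that t B^n exceeds all linear terms and [ln eps]; the summand [3 * t]
   yields Y_n >= 3, hence [y >= 4]. *)
have [n nN0 hn] := @exp_beats_linear B `|c1| (`|c2| + `|ln eps| + 3 * t) t N0 B1 t0.
pose Y k := B ^+ k.+1.
have Y0 k : 0 < Y k by rewrite exprn_gt0//; lra.
have BY : B ^+ n <= Y n by rewrite /Y exprS ler_peMl ?exprn_ge0//; lra.
have hYn : `|c1| * n%:R + (`|c2| + `|ln eps| + 3 * t) <= t * Y n.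
  by apply: (le_trans hn); rewrite ler_pM2l.
clear hn BY.
have Y3 : 3 <= Y n.
  rewrite -(ler_pM2l t0); apply: le_trans hYn.
  by have := mulr_ge0 (normr_ge0 c1) (ler0n R n); have := normr_ge0 c2; have := normr_ge0 (ln eps); lra.
pose y := expR (Y n - 1).
have y4 : 4 <= y.
  have h1 : 2 <= expR 1 :> R by have := expR_ge1Dx (1 : R); lra.
  apply: (@le_trans _ _ (expR 1 * expR 1)); first by nra.
  by rewrite -expRD /y ler_expR; lra.
pose v := Num.truncn (y / 2).
have /andP[v1 v2] : v%:R <= y / 2 < v.+1%:R by apply: truncn_itv; lra.
rewrite -[v.+1%:R]natr1 in v2.
have v0 : (0 < v)%N by rewrite -(ltr0n R); lra.
have hv : 1 - c v <= C * (4 `^ q * expR q) * expR (- q * Y n).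
  apply: (le_trans (hC v v0)); rewrite -mulrA ler_pM2l//.
  have vy : y / 4 <= v%:R by lra.
  have -> : 4 `^ q * expR q * expR (- q * Y n) = (y / 4) `^ (- q).
    rewrite powRM ?expR_ge0 ?invr_ge0// -powR_inv1// -powRrM mulN1r opprK.
    rewrite /y -expRM -mulrA -expRD mulrC; congr (expR _ * _); ring.
  rewrite !powRN lef_pV2 ?posrE ?powR_gt0 ?ltr0n//; last by lra.
  by apply: ge0_ler_powR; rewrite ?nnegrE ?ler0n//; lra.
have vy : v%:R < y by lra.
have cv1 : c v < 1 by exact: cells_lt1 hc v.
have cv0 : 0 <= 1 - c v by rewrite subr_ge0 ltW.
clear v1 v2 y4.
pose P w := [&& size w == n, word w, take N0 w == w0 &
  all (fun k => B ^+ k.+1 - 1 <= ln ((nth 0%N w k)%:R : R) <= B ^+ k.+1 + 1) (iota N0 (n - N0))].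
exists (fun w => if P w then word_map f w @` `[c v, 1]%classic else set0),
  (fun w => if P w then (\prod_(k < size w) g1 (nth 0%N w k)) * (1 - c v) else 0).
have cv01 z : z \in `[c v, 1] -> z \in `[0, 1].
  rewrite !in_itv /= => /andP[h ->]; rewrite andbT; apply: le_trans h.
  by have := cells_le hc (leq0n v); rewrite (cells0 hc).
split.
- move=> x [a [ea wa ha]]; exists (mkseq a n).
  have a0 : forall k, (0 < a k)%N by case: ea.
  have -> : P (mkseq a n).
    rewrite /P size_mkseq eqxx word_mkseq//=; apply/andP; split.
      by rewrite /mkseq -map_take take_iota (minn_idPl nN0) -[X in _ == X]wa.
    apply/allP => k; rewrite mem_iota subnKC// => /andP[Nk kn].
    by rewrite nth_mkseq//; exact: ha.
  have [z [ez ->]] := expansion_tail hf n ea; exists z => //.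
  have [z' z01' E] := expansion_first ez.
  rewrite addn0 in E.
  have an : y <= (a n)%:R.
    have /andP[h _] := ha n nN0.
    by rewrite -[leRHS]lnK ?posrE ?ltr0n// ler_expR.
  have va : (v <= (a n).-1)%N.
    have : (v < a n)%N by rewrite -(ltr_nat R); exact: lt_le_trans an.
    by case: (a n).
  have /andP[h1 h2] := letter_ge hc (a0 n) z01'.
  rewrite /= in_itv /= E (le_trans (cells_le hc va) h1)/=.
  exact: le_trans h2 (ltW (cells_lt1 hc (a n))).
- by move=> w; case: ifP => // _; rewrite mulr_ge0 ?prodr_ge0.
- move=> w x x'; case: ifP => // /and4P[_ ww _ _] [z z01 <-] [z' z01' <-].
  have := word_map_upper hf g10 up ww (cv01 _ z01) (cv01 _ z01'); move=> /le_trans; apply.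
  apply: ler_wpM2l; first exact: prodr_ge0.
  exact: itv_dist_le.
move=> l ul.
pose r := (d - dl) * s.
have r0 : 0 <= r by rewrite mulr_ge0 ?(ltW s0).
(* On the positions of [w0] the weight selects the prescribed letter. Afterwards it selects the
   letters up to exp(Y_k + 1), all with the bound valid for the smallest of them, exp(Y_k - 1). *)
pose g (k i : nat) := K * (if (k < N0)%N then (i == nth 0%N w0 k)%:R else
  ((0 < i)%N && (i%:R <= expR (Y k + 1)))%:R * expR (- r * (Y k - 1))).
have g0 k i : 0 <= g k i.
  rewrite /g mulr_ge0 ?(ltW K0)//; case: ifP => _; first exact: ler0n.
  by rewrite mulr_ge0 ?ler0n ?expR_ge0.
pose G k := K * expR (1 + r + sg * Y k).
have gG k M : \sum_(i <- iota 0 M) g k i <= G k.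
  rewrite -mulr_sumr ler_pM2l//; case: (ltnP k N0) => kN.
    apply: (@le_trans _ _ 1); last first.
      by rewrite -[leLHS]expR0 ler_expR !addr_ge0 ?ler01// ltW// mulr_gt0.
    have -> : \sum_(i <- iota 0 M) (i == nth 0%N w0 k)%:R = (count_mem (nth 0%N w0 k) (iota 0 M))%:R :> R.
      by elim: (iota 0 M) => [|i s' IH]; rewrite ?big_nil// big_cons IH /= natrD.
    by rewrite lern1 count_uniq_mem ?iota_uniq ?leq_b1.
  rewrite -mulr_suml.
  apply: (@le_trans _ _ (expR (Y k + 1) * expR (- r * (Y k - 1)))).
    by apply: ler_wpM2r; rewrite ?expR_ge0// sum_indicator_le// expR_ge0.
  rewrite -expRD ler_expR le_eqVlt; apply/orP; left; apply/eqP; rewrite /sg /r; ring.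
rewrite (bigID P) /= [X in _ + X]big1 ?addr0; last first.
  by move=> w /negbTE ->; rewrite powR0// gt_eqF.
have step w : P w -> (if P w then (\prod_(k < size w) g1 (nth 0%N w k)) * (1 - c v) else 0) `^ s <=
    word_weight g w * (1 - c v) `^ s.
  move=> Pw; rewrite Pw; move: Pw => /and4P[/eqP sw ww /eqP tw /allP hw].
  rewrite powRM ?prodr_ge0//.
  apply: ler_wpM2r; first exact: powR_ge0.
  rewrite powR_prod// /word_weight; apply: ler_prod => k _; rewrite powR_ge0 /=.
  have i0 : (0 < nth 0%N w k)%N by move/allP: ww; apply; rewrite mem_nth.
  have i0' : 0 < (nth 0%N w k)%:R :> R by rewrite ltr0n.
  rewrite /g1 /g powRM ?powR_ge0 ?(ltW K20)// ler_pM2l//.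
  rewrite -powRrM mulNr -/r powR_expR//.
  case: ifPn => kN.
    rewrite -tw nth_take// eqxx -[leRHS]expR0 ler_expR mulNr oppr_le0.
    by apply: mulr_ge0 => //; apply: ln_ge0; rewrite ler1n.
  have /andP[h1 h2] : B ^+ k.+1 - 1 <= ln ((nth 0%N w k)%:R : R) <= B ^+ k.+1 + 1.
    by apply: hw; rewrite mem_iota subnKC// -sw ltn_ord andbT leqNgt.
  have -> : (0 < nth 0%N w k)%N && ((nth 0%N w k)%:R <= expR (Y k + 1)).
    by rewrite i0 /= -[leLHS]lnK ?posrE// ler_expR.
  by rewrite mul1r ler_expR !mulNr lerN2; apply: ler_wpM2l.
apply: (@le_trans _ _ (\sum_(w <- l | P w) word_weight g w * (1 - c v) `^ s)).
  exact: ler_sum.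
rewrite -mulr_suml -big_filter.
apply: (@le_trans _ _ ((\prod_(k < n) G k) * (1 - c v) `^ s)).
  apply: ler_wpM2r; first exact: powR_ge0.
  apply: (sum_word_weight_le g0 gG); first exact: filter_uniq.
  by move=> w; rewrite mem_filter => /andP[/and4P[/eqP]].
have hv' : (1 - c v) `^ s <= expR (c2 - s * q * Y n).
  have -> : expR (c2 - s * q * Y n) = (C * (4 `^ q * expR q) * expR (- q * Y n)) `^ s.
    rewrite powRM ?expR_ge0 ?(ltW C40)// -expRM (powR_expR _ C40) -expRD.
    by congr expR; rewrite /c2; ring.
  apply: ge0_ler_powR => //; rewrite ?nnegrE ?(ltW s0)//.
  by apply: mulr_ge0; [exact: ltW|exact: expR_ge0].
have hG : \prod_(k < n) G k <= expR (c1 * n%:R + sg * (Y n / (B - 1))).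
  have -> : \prod_(k < n) G k = expR (\sum_(k < n) (ln K + (1 + r + sg * Y k))).
    by rewrite expR_sum; apply: eq_bigr => k _; rewrite expRD lnK.
  rewrite ler_expR.
  have -> : \sum_(k < n) (ln K + (1 + r + sg * Y k)) = c1 * n%:R + sg * \sum_(k < n) Y k.
    rewrite mulr_sumr (eq_bigr (fun k : 'I_n => c1 + sg * Y k)).
      by rewrite big_split /= sumr_const card_ord mulr_natr.
    by move=> k _; rewrite /c1 /r; ring.
  by rewrite lerD2l ler_pM2l// sum_geometric_le.
apply: (@le_trans _ _ (expR (c1 * n%:R + sg * (Y n / (B - 1))) * expR (c2 - s * q * Y n))).
  by apply: ler_pM => //; [apply: prodr_ge0 => k _; rewrite mulr_ge0 ?expR_ge0 ?(ltW K0)|exact: powR_ge0].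
rewrite -expRD -[leRHS]lnK ?posrE// ler_expR.
have -> : c1 * n%:R + sg * (Y n / (B - 1)) + (c2 - s * q * Y n) = c1 * n%:R + c2 - t * Y n.
  by rewrite /t; ring.
have h1 : c1 * n%:R <= `|c1| * n%:R by rewrite ler_wpM2r ?ler_norm.
have h2 := ler_norm c2; have h3 := ler_norm (- ln eps); rewrite normrN in h3.
lra.
Qed.

End upper_bounds.

(** * Lower bounds through mixed radix expansions *)

Section unit_interval_not_null.
Context {R : realType}.

(** If [T] were null, a cover of it of cost 1/8 together with the pieces [V j] would cover [0, 1) at
    cost 1/4, while [cover01_le] requires at least 1/2. *)
Lemma snull1_cover01 (J : countType) (T : set R) (V : J -> set R) (D : J -> R) :
  `[0, 1[%classic `<=` T `|` [set x | exists j, V j x] ->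
  (forall j, 0 <= D j) ->
  (forall j x y, V j x -> V j y -> `|x - y| <= D j) ->
  (forall l, uniq l -> \sum_(j <- l) D j <= 1 / 8) -> ~ snull 1 T.
Proof.
move=> sub D0 dV sD hT.
have [|U [E [TU E0 dU sE]]] := hT (1 / 8); first by lra.
suff : 1 <= 2 * (1 / 8 + 1 / 8) :> R by lra.
pose I : countType := (nat + J)%type.
apply: (@cover01_le _ I (fun i => match i with inl k => U k | inr j => V j end)
  (fun i => match i with inl k => E k | inr j => D j end)).
- by move=> x /sub[/TU[k _ Uk]|[j Vj]]; [exists (inl k)|exists (inr j)].
- by case.
- by case.
- move=> l ul.
  pose l1 := pmap (fun i : I => if i is inl k then Some k else None) l.
  pose l2 := pmap (fun i : I => if i is inr j then Some j else None) l.
  have ul1 : uniq l1 by apply: (@pmap_uniq _ _ _ inl) ul => -[].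
  have ul2 : uniq l2 by apply: (@pmap_uniq _ _ _ inr) ul => -[].
  have -> : \sum_(i <- l) (match i with inl k => E k | inr j => D j end) =
      \sum_(k <- l1) E k + \sum_(j <- l2) D j.
    rewrite /l1 /l2; elim: l {ul l1 l2 ul1 ul2} => [|[k|j] l IH] /=; first by rewrite !big_nil addr0.
      by rewrite !big_cons IH addrA.
    by rewrite !big_cons IH addrCA.
  apply: lerD; last exact: sD.
  pose M := (\max_(k <- l1) k)%N.
  apply: le_trans (sE M.+1).
  rewrite -(big_mkord xpredT (fun k => E k `^ 1)) /index_iota subn0.
  have -> : \sum_(k <- iota 0 M.+1) E k `^ 1 = \sum_(k <- iota 0 M.+1) E k.
    by apply: eq_bigr => k _; rewrite powRr1.
  apply: ler_sum_uniq => //; first exact: iota_uniq.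
  move=> k kl; rewrite mem_iota /= add0n ltnS.
  exact: (@leq_bigmax_seq _ l1 xpredT id).
Qed.

End unit_interval_not_null.

Section mixed_radix.
Context {R : realType}.
Variable N : nat -> nat.
Hypothesis N0 : forall n, (0 < N n)%N.

(* radix_rem t n is the remainder in [0, 1) after n digits in the mixed radix N 0, N 1, ... *)
Fixpoint radix_rem (t : R) (n : nat) : R :=
  if n is n'.+1 then (N n')%:R * radix_rem t n' - (Num.truncn ((N n')%:R * radix_rem t n'))%:R
  else t.

Definition radix_digit (t : R) n : nat := Num.truncn ((N n)%:R * radix_rem t n).

Lemma radix_rem_ge0_lt1 t n : 0 <= t < 1 -> 0 <= radix_rem t n < 1.
Proof.
move=> t01; elim: n => [//|n /andP[IH _]] /=.
have h : 0 <= (N n)%:R * radix_rem t n by rewrite mulr_ge0.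
have /andP[h1 h2] := truncn_itv h; rewrite -[_.+1%:R]natr1 in h2; lra.
Qed.

Lemma radix_digit_lt t n : 0 <= t < 1 -> (radix_digit t n < N n)%N.
Proof.
move=> t01; have /andP[h1 h2] := radix_rem_ge0_lt1 n t01.
rewrite -(ltr_nat R) /radix_digit.
have h : 0 <= (N n)%:R * radix_rem t n by rewrite mulr_ge0.
have /andP[/le_lt_trans + _] := truncn_itv h; apply.
by rewrite -[ltRHS]mulr1 ltr_pM2l// ltr0n.
Qed.

Lemma radix_step t n : (N n)%:R * radix_rem t n = (radix_digit t n)%:R + radix_rem t n.+1.
Proof. by rewrite /= /radix_digit addrC subrK. Qed.

Definition radix_prod n : R := \prod_(k < n) (N k)%:R.

Lemma radix_prod_gt0 n : 0 < radix_prod n.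
Proof. by apply: prodr_gt0 => k _; rewrite ltr0n. Qed.

Lemma radix_agree t t' n : (forall k, (k < n)%N -> radix_digit t k = radix_digit t' k) ->
  radix_rem t n - radix_rem t' n = radix_prod n * (t - t').
Proof.
elim: n => [|n IH] h; first by rewrite /radix_prod big_ord0 mul1r.
have {IH} E := IH (fun k kn => h k (ltnW kn)).
have e1 := radix_step t n; have e2 := radix_step t' n; rewrite (h n (ltnSn n)) in e1.
have -> : radix_rem t n.+1 - radix_rem t' n.+1 = (N n)%:R * (radix_rem t n - radix_rem t' n).
  by rewrite mulrBr e1 e2; ring.
by rewrite E /radix_prod big_ord_recr /= mulrA [_%:R * _]mulrC.
Qed.

(** If the digits first differ at [n], by [r], then [t] and [t'] are within 2 r / (radix_prod n * N
    n), while their images are at least r * rho n apart. As r <= N n and s <= 1, r / N n is at most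
    its [s]-th power, so it suffices to ask for the Hölder bound at the scale r = N n. *)
Lemma mixed_radix_not_snull (s C : R) (A : set R) (H : (nat -> nat) -> R) (rho : nat -> R) :
  0 < s -> s <= 1 -> 0 < C ->
  (forall e, (forall k, (e k < N k)%N) -> A (H e)) ->
  (forall n, 0 < rho n) ->
  (forall e e' n, (forall k, (e k < N k)%N) -> (forall k, (e' k < N k)%N) ->
    (forall k, (k < n)%N -> e k = e' k) -> (e n < e' n)%N ->
    ((e' n)%:R - (e n)%:R) * rho n <= `|H e - H e'|) ->
  (forall n, 1 <= C * radix_prod n * ((N n)%:R * rho n) `^ s) ->
  (forall M : R, exists n, M <= radix_prod n) ->
  ~ snull s A.
Proof.
move=> s0 s1 C0 HA rho0 sep cond unb hA.
have key t t' n : 0 <= t < 1 -> 0 <= t' < 1 ->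
    (forall k, (k < n)%N -> radix_digit t k = radix_digit t' k) ->
    (radix_digit t n < radix_digit t' n)%N ->
    `|t - t'| <= 2 * C * `|H (radix_digit t) - H (radix_digit t')| `^ s.
  move=> t01 t01' agr lt.
  have dlt k := radix_digit_lt k t01; have dlt' k := radix_digit_lt k t01'.
  have := sep _ _ n dlt dlt' agr lt.
  set r : R := (radix_digit t' n)%:R - (radix_digit t n)%:R => hs.
  have r1 : 1 <= r.
    by rewrite /r lerBrDr addrC natr1 ler_nat.
  have Nn0 : 0 < (N n)%:R :> R by rewrite ltr0n.
  have rN : r <= (N n)%:R.
    have : (radix_digit t' n)%:R <= (N n)%:R :> R by rewrite ler_nat ltnW.
    by have := ler0n R (radix_digit t n); rewrite /r; lra.
  have Pn := radix_prod_gt0 n.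
  have h1 : `|t - t'| * (radix_prod n * (N n)%:R) <= 2 * r.
    rewrite mulrA [_ * radix_prod n]mulrC -{1}(gtr0_norm Pn) -normrM -(radix_agree agr).
    rewrite -(gtr0_norm Nn0) -normrM.
    have /andP[a1 a2] := radix_rem_ge0_lt1 n.+1 t01.
    have /andP[b1 b2] := radix_rem_ge0_lt1 n.+1 t01'.
    have -> : (radix_rem t n - radix_rem t' n) * (N n)%:R = - r + (radix_rem t n.+1 - radix_rem t' n.+1).
      rewrite mulrC mulrBr !radix_step /r; ring.
    by rewrite ler_norml; lra.
  have h2 : (r * rho n) `^ s <= `|H (radix_digit t) - H (radix_digit t')| `^ s.
    by apply: ge0_ler_powR; rewrite ?nnegrE ?(ltW s0)// mulr_ge0// ?(ltW (rho0 n))//; lra.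
  have h3 : r / (N n)%:R * ((N n)%:R * rho n) `^ s <= (r * rho n) `^ s.
    have -> : r * rho n = (r / (N n)%:R) * ((N n)%:R * rho n) by field; rewrite gt_eqF.
    rewrite [leRHS]powRM ?mulr_ge0 ?invr_ge0 ?(ltW Nn0) ?(ltW (rho0 n))//; last by lra.
    apply: ler_wpM2r; first exact: powR_ge0.
    apply: ger1_powR => //; rewrite divr_gt0//=; last by lra.
    by rewrite ler_pdivrMr// mul1r.
  apply: (@le_trans _ _ (2 * C * (r / (N n)%:R * ((N n)%:R * rho n) `^ s))); last first.
    by apply: ler_wpM2l; [rewrite mulr_ge0// ltW|exact: le_trans h2].
  have PN0 : 0 < radix_prod n * (N n)%:R by rewrite mulr_gt0.
  rewrite -(ler_pM2r PN0); apply: (le_trans h1).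
  have -> : 2 * C * (r / (N n)%:R * ((N n)%:R * rho n) `^ s) * (radix_prod n * (N n)%:R) =
      2 * r * (C * radix_prod n * ((N n)%:R * rho n) `^ s) by field; rewrite gt_eqF.
  by rewrite -[leLHS]mulr1; apply: ler_wpM2l => //; lra.
(* All of [0, 1) is parametrized by digits, so the exceptional family is empty. *)
apply: (@snull1_cover01 R unit `[0, 1[%classic (fun _ => set0) (fun _ => 0)).
- by move=> x; left.
- by [].
- by [].
- by move=> l _; rewrite big1// divr_ge0.

- apply: (@snull_holder _ s (2 * C) _ A (fun t => H (radix_digit t))) => //.
  + by rewrite mulr_gt0.
  + move=> t; rewrite /= in_itv /= => t01; apply: HA => k; exact: radix_digit_lt.
  + move=> t t'; rewrite /= !in_itv /= => t01 t01'.
    have [agr|] := pselect (forall k, radix_digit t k = radix_digit t' k).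
      have -> : `|t - t'| = 0.
        apply/eqP; rewrite eq_le normr_ge0 andbT leNgt; apply/negP => tt.
        have [n hn] := unb (`|t - t'|^-1).
        have h := radix_agree (fun k (_ : (k < n)%N) => agr k).
        have /andP[a1 a2] := radix_rem_ge0_lt1 n t01.
        have /andP[b1 b2] := radix_rem_ge0_lt1 n t01'.
        have : `|radix_rem t n - radix_rem t' n| < 1 by rewrite ltr_norml; lra.
        rewrite h normrM (gtr0_norm (radix_prod_gt0 n)).
        apply/negP; rewrite -leNgt -ler_pdivrMr// mul1r//.
      by rewrite mulr_ge0 ?powR_ge0// mulr_ge0// ltW.
    move=> /existsNP ex.
    have {}ex : exists k, radix_digit t k != radix_digit t' k by case: ex => k /eqP; exists k.
    case: (ex_minnP ex) => n dn minn.
    have agr k : (k < n)%N -> radix_digit t k = radix_digit t' k.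
      by move=> kn; apply/eqP; apply: contraTT kn => /minn; rewrite -leqNgt.
    move: dn; rewrite neq_ltn => /orP[lt|lt]; first exact: key lt.
    rewrite distrC [`|H _ - _|]distrC; apply: key lt => // k kn.
    by rewrite agr.
Qed.

End mixed_radix.

(** * Asymptotics of sums over letters chosen in windows *)

Section digit_asymptotics.
Context {R : realType}.

(** A relative width 3 exp(- dl L) moves ln a by at most that much, hence its b-th power by this
    times a power of L; half of [dl] absorbs the power. *)
Lemma ln_pow_window (b dl : R) : 1 < b -> 0 < dl -> exists2 C : R, 0 < C &
  forall L a : R, 1 <= L -> expR L <= a <= expR L * (1 + 3 * expR (- dl * L)) ->
    0 <= ln a `^ b - L `^ b <= C * expR (- (dl / 2) * L).
Proof.
move=> b1 dl0; have b0 : 0 < b by lra.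
have dl20 : 0 < dl / 2 by lra.
pose C1 := (b / (dl / 2)) `^ b.
have C10 : 0 < C1 by rewrite powR_gt0// divr_gt0.
exists (C1 * expR (dl / 2 * 3) * (b * 3)) => [|L a L1 /andP[a1 a2]].
  by rewrite mulr_gt0// ?mulr_gt0// expR_gt0.
have L0 : 0 < L by lra.
have a0 : 0 < a by apply: lt_le_trans a1; exact: expR_gt0.
have La : L <= ln a by rewrite -[leLHS]expRK ler_ln// posrE expR_gt0.
rewrite subr_ge0; apply/andP; split.
  by apply: ge0_ler_powR; rewrite ?nnegrE ?(ltW b0)//; lra.
pose x := 3 * expR (- dl * L).
have x0 : 0 < x by rewrite mulr_gt0 ?expR_gt0.
have x3 : x <= 3.
  have : expR (- dl * L) <= 1 by rewrite -[leRHS]expR0 ler_expR mulNr oppr_le0 mulr_ge0// ltW.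
  by rewrite /x; lra.
have aL : ln a <= L + x.
  apply: (@le_trans _ _ (ln (expR L * (1 + x)))).
    by rewrite ler_ln ?posrE// mulr_gt0 ?expR_gt0//; lra.
  rewrite lnM ?posrE ?expR_gt0//; last by lra.
  by rewrite expRK lerD2l le_ln1Dx//; lra.
have h1 : ln a `^ b <= (L + x) `^ b by apply: ge0_ler_powR; rewrite ?nnegrE ?(ltW b0)//; lra.
have h2 := powR_incr_le L0 (ltW x0) (ltW b0).
have h3 : (L + x) `^ b <= C1 * expR (dl / 2 * (L + 3)).
  have Lx : 0 <= L + x by lra.
  apply: (le_trans (powR_le_expR b0 dl20 Lx)).
  by rewrite /C1 ler_pM2l// ler_expR ler_pM2l//; lra.
have h4 : b * (x / L) <= b * x.
  by rewrite ler_pM2l// ler_pdivrMr// ler_peMr// ltW.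
have P0 := powR_ge0 (L + x) b.
apply: (@le_trans _ _ ((C1 * expR (dl / 2 * (L + 3))) * (b * x))).
  apply: (@le_trans _ _ ((L + x) `^ b * (b * (x / L)))); first by lra.
  apply: ler_pM => //; rewrite mulr_ge0 ?(ltW b0)// divr_ge0// ltW//.
rewrite /x mulrDr expRD le_eqVlt; apply/orP; left; apply/eqP.
have -> : expR (- (dl / 2) * L) = expR (dl / 2 * L) * expR (- dl * L).
  by rewrite -expRD; congr expR; field.
ring.
Qed.

(** The errors of the increments telescope to at most e / 2 * (Phi n - Phi m); what happened before
    [m] is eventually below the other half. *)
Lemma stolz_cesaro_sum (Phi p : nat -> R) :
  (forall M : R, \forall n \near \oo, M <= Phi n) ->
  (\forall n \near \oo, 0 < Phi n.+1 - Phi n) ->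
  (forall e : R, 0 < e -> \forall n \near \oo,
     `|p n - (Phi n.+1 - Phi n)| <= e * (Phi n.+1 - Phi n)) ->
  (fun n => (\sum_(k < n) p k) / Phi n) @ \oo --> (1 : R).
Proof.
move=> Phioo D0 pD; apply/cvgrPdist_le => e e0.
have e20 : 0 < e / 2 by lra.
have [n0 _ hn0] := pD _ e20; have [n1 _ hn1] := D0.
pose m := maxn n0 n1.
pose S n := \sum_(k < n) p k.
have key n : (m <= n)%N -> `|S n - S m - (Phi n - Phi m)| <= e / 2 * (Phi n - Phi m).
  elim: n => [|n IH]; first by rewrite leqn0 => /eqP ->; rewrite !subrr normr0 mulr0.
  rewrite leq_eqVlt => /orP[/eqP ->|]; first by rewrite !subrr normr0 mulr0.
  rewrite ltnS => mn; have {}IH := IH mn.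
  have h := hn0 n (leq_trans (leq_maxl _ _) mn).
  have -> : S n.+1 = S n + p n by rewrite /S big_ord_recr.
  have -> : S n + p n - S m - (Phi n.+1 - Phi m) =
    (S n - S m - (Phi n - Phi m)) + (p n - (Phi n.+1 - Phi n)) by ring.
  apply: (le_trans (ler_normD _ _)).
  by move: h IH => /=; lra.
pose M := `|S m - Phi m| + e / 2 * `|Phi m|.
have M0 : 0 <= M by rewrite addr_ge0// mulr_ge0// ltW.
have h2 := Phioo (M / (e / 2) + 1).
near=> n.
have mn : (m <= n)%N by near: n; exists m.
have Pn : M / (e / 2) + 1 <= Phi n by near: n.
have Pn0 : 0 < Phi n by apply: lt_le_trans Pn; rewrite ltr_wpDl// divr_ge0// ltW.
have PM : M <= e / 2 * Phi n.
  by rewrite -ler_pdivrMl// mulrC; lra.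
have h := key n mn.
rewrite -/(S n).
have -> : 1 - S n / Phi n = - (S n - Phi n) / Phi n by field; rewrite gt_eqF.
rewrite normrM normrN normfV (gtr0_norm Pn0) ler_pdivrMr//.
have -> : S n - Phi n = (S n - S m - (Phi n - Phi m)) + (S m - Phi m) by ring.
apply: (le_trans (ler_normD _ _)).
have := ler_norm (- Phi m); rewrite normrN /M in PM * => h3; nra.
Unshelve. all: by end_near.
Qed.

End digit_asymptotics.

Section window_digits.
Context {R : realType}.
Variables (b : R) (l : nat -> R).
Hypotheses (b1 : 1 < b) (loo : forall M : R, \forall n \near \oo, M <= l n).

(* When l n < 0 this is 1, because powR is 1 on negative numbers. *)
Definition root_log n := l n `^ (1 / b).

Lemma root_log_ge0 n : 0 <= root_log n. Proof. exact: powR_ge0. Qed.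

Lemma root_logK n : 0 <= l n -> root_log n `^ b = l n.
Proof.
have b1' := b1.
by move=> l0; rewrite /root_log -powRrM div1r mulVf ?powRr1// gt_eqF//; lra.
Qed.

Lemma root_log_oo (M : R) : \forall n \near \oo, M <= root_log n.
Proof.
have b1' := b1.
have ib : 0 < 1 / b by rewrite divr_gt0//; lra.
near=> n.
have h : `|M| `^ b <= l n by near: n; exact: loo.
apply: (le_trans (ler_norm M)).
have -> : `|M| = (`|M| `^ b) `^ (1 / b).
  by rewrite -powRrM div1r mulfV ?powRr1// gt_eqF//; lra.
apply: ge0_ler_powR; rewrite ?nnegrE ?(ltW ib) ?powR_ge0//.
by apply: le_trans h; exact: powR_ge0.
Unshelve. all: by end_near.
Qed.

Lemma window_digits_growth (Phi : nat -> R) (dl : R) (a : nat -> nat) :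
  0 < dl ->
  (forall M : R, \forall n \near \oo, M <= Phi n) ->
  (\forall n \near \oo, Phi n.+1 - Phi n = expR (l n)) ->
  (forall n, expR (root_log n) <= (a n)%:R <= expR (root_log n) * (1 + 3 * expR (- dl * root_log n))) ->
  (fun n => (\sum_(k < n) expR (ln ((a k)%:R : R) `^ b)) / Phi n) @ \oo --> (1 : R).
Proof.
move=> dl0 Phioo PhiD ha; apply: (@stolz_cesaro_sum _ Phi (fun k => expR (ln ((a k)%:R : R) `^ b))) => //.
  by apply: filterS PhiD => n ->; exact: expR_gt0.
move=> e e0; have [C C0 hC] := ln_pow_window b1 dl0.
(* For 0 <= x <= e1 <= 1/2 one has expR x - 1 <= 2 * e1 <= e. *)
have [e1 [e10 e1e e11]] : exists e1 : R, [/\ 0 < e1, 2 * e1 <= e & 2 * e1 <= 1].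
  have E : 2 * (Num.min 1 e / 2) = Num.min 1 e by field.
  exists (Num.min 1 e / 2); rewrite E !ge_min !lexx orbT.
  by split=> //; rewrite divr_gt0// lt_min ltr01.
near=> n.
have hD : Phi n.+1 - Phi n = expR (l n) by near: n.
have L1 : 1 <= root_log n by near: n; exact: (root_log_oo 1).
have l0 : 0 <= l n by near: n; exact: loo.
have hL : ln (C / e1) / (dl / 2) <= root_log n by near: n; exact: (root_log_oo _).
have /andP[h1 h2] := hC _ _ L1 (ha n).
rewrite root_logK// in h1 h2.
have hx : C * expR (- (dl / 2) * root_log n) <= e1.
  rewrite mulrC -ler_pdivlMr//.
  have -> : e1 / C = expR (ln (e1 / C)) by rewrite lnK// posrE divr_gt0.
  rewrite ler_expR.
  have -> : ln (e1 / C) = - ln (C / e1) by rewrite !ln_div ?posrE// opprB.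
  by rewrite mulNr lerN2 -ler_pdivrMl ?divr_gt0// mulrC.
rewrite hD.
set x := ln _ `^ b - l n in h1 h2.
have -> : expR (ln (a n)%:R `^ b) - expR (l n) = expR (l n) * (expR x - 1).
  by rewrite mulrBr mulr1 -expRD /x; congr (expR _ - _); ring.
rewrite normrM (gtr0_norm (expR_gt0 _)) mulrC ler_pM2r ?expR_gt0//.
have ex1 : 1 <= expR x by rewrite -[leLHS]expR0 ler_expR.
rewrite ger0_norm; last by lra.
have x1 : x <= e1 by apply: (le_trans h2).
apply: le_trans e1e.
have : expR (- x) >= 1 - x by have := expR_ge1Dx (- x); lra.
have : expR x * expR (- x) = 1 by exact: expRxMexpNx_1.
set u := expR x in ex1 *; set v := expR (- x) => uv h; nra.
Unshelve. all: by end_near.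
Qed.

End window_digits.

(** * Lower bound for growth sets from letters in windows *)

Section growth_lower_bound.
Context {R : realType}.

Lemma cells_sub_lower (c : nat -> R) (g : R) (i j : nat) : (i <= j)%N ->
  (forall k, (i <= k)%N -> (k < j)%N -> g <= c k.+1 - c k) -> (j - i)%:R * g <= c j - c i.
Proof.
elim: j => [|j IH]; first by rewrite leqn0 => /eqP -> _; rewrite subrr mul0r.
rewrite leq_eqVlt => /orP[/eqP ->|]; first by rewrite subnn subrr mul0r.
rewrite ltnS => ij h; rewrite subSn// -natr1 mulrDl mul1r.
have h1 := h j ij (ltnSn j); have := IH ij (fun k ik kj => h k ik (ltnW kj)); lra.
Qed.

Lemma truncn_ge_half (x : R) : 1 <= x -> x / 2 <= (Num.truncn x)%:R.
Proof.
move=> x1; have x0 : 0 <= x by lra.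
have /andP[_ h] := truncn_itv x0.
have : 1 <= (Num.truncn x)%:R :> R by rewrite ler1n -[in leqLHS](truncn1 R) le_truncn.
by rewrite -natr1 in h; lra.
Qed.

(** Between the letters q + 2 e and q + 2 e' lie 2 (e' - e) - 1 full cells; since e < e', this is at
    least e' - e. *)
Lemma window_gap (q e e' : nat) : (e < e')%N -> (e' - e <= (q + 2 * e').-1 - (q + 2 * e))%N.
Proof. by lia. Qed.

Variables (d b : R) (f : nat -> R -> R) (phi : R -> R).
Hypotheses (d1 : 1 < d) (hf : gauss_like_ifs d f) (b1 : 1 < b).
Hypothesis hval : forall j : nat, (0 < j)%N ->
  potential_value f phi j = expR (ln (j%:R : R) `^ b).

Variables (Phi l : nat -> R) (kap : R).
Hypotheses (Phioo : forall M : R, \forall n \near \oo, M <= Phi n)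
  (loo : forall M : R, \forall n \near \oo, M <= l n)
  (PhiD : \forall n \near \oo, Phi n.+1 - Phi n = expR (l n))
  (kap0 : 0 <= kap)
  (lratio : forall e : R, 0 < e ->
     \forall n \near \oo, l n.+1 <= ((1 + kap) `^ b + e) * l n).

Let L := root_log b l.
Let L0 n : 0 <= L n. Proof. exact: root_log_ge0. Qed.

(** Every letter costs a constant factor. As [L] tends to infinity, the resulting exp(O(n)) is
    negligible against the exponential of the sum of the [L k]. *)
Let linear_le_sum (e : R) : 0 < e -> exists C, forall n, n%:R <= e * (\sum_(k < n) L k) + C.
Proof.
move=> e0; have [n0 _ hn0] := root_log_oo b1 loo e^-1.
exists n0%:R; elim => [|n IH]; first by rewrite big_ord0 mulr0 add0r ler0n.
have [nn0|n0n] := ltnP n n0.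
  apply: (@le_trans _ _ n0%:R); first by rewrite ler_nat.
  by rewrite lerDr mulr_ge0 ?(ltW e0)// sumr_ge0.
rewrite big_ord_recr /= mulrDr -natr1.
have : 1 <= e * L n by rewrite -ler_pdivrMl// mulr1; exact: hn0.
lra.
Qed.

(** Eventually L n.+1 - L n <= (kap + e) * L n, and these increments add up. The value of [kap] is 0
    for exp(n^alpha) and B - 1 for exp(beta^n); this term accounts for the gap between 1 / d and the
    dimension in (II). *)
Let root_log_le_sum (e : R) : 0 < e ->
  exists C, forall n, L n <= (kap + e) * (\sum_(k < n) L k) + C.
Proof.
move=> e0.
have b0 : 0 < b by have b1' := b1; lra.
have k0 := kap0.
pose e1 := (1 + kap + e) `^ b - (1 + kap) `^ b.
have e10 : 0 < e1 by rewrite subr_gt0 gt0_ltr_powR ?nnegrE//; lra.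
have [n0 _ hn0] := lratio e10; have [n1 _ hn1] := loo 0.
pose m := maxn n0 n1.
have step n : (m <= n)%N -> L n.+1 <= (1 + kap + e) * L n.
  move=> mn; have h := hn0 n (leq_trans (leq_maxl _ _) mn).
  have l0 := hn1 n (leq_trans (leq_maxr _ _) mn).
  have l1 := hn1 n.+1 (leq_trans (leq_trans (leq_maxr _ _) mn) (leqnSn _)).
  move: h l0 l1 => /= h l0 l1.
  rewrite /e1 addrC subrK in h.
  have -> : (1 + kap + e) * L n = ((1 + kap + e) `^ b * l n) `^ (1 / b).
    rewrite powRM ?powR_ge0// -powRrM div1r mulfV ?gt_eqF// powRr1; last by lra.
    by rewrite /L /root_log div1r.
  apply: ge0_ler_powR; rewrite ?nnegrE ?divr_ge0 ?(ltW b0)//.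
  by rewrite mulr_ge0 ?powR_ge0.
exists (\sum_(k < m.+1) L k); elim => [|n IH].
  by rewrite big_ord0 mulr0 add0r big_ord_recl /= lerDl sumr_ge0.
have [nm|mn] := ltnP n m.
  have : L n.+1 <= \sum_(k < m.+1) L k.
    by rewrite (bigD1 (Ordinal (nm : (n.+1 < m.+1)%N)))//= lerDl sumr_ge0.
  move=> h; apply: (le_trans h); rewrite lerDr mulr_ge0 ?sumr_ge0//; lra.
rewrite big_ord_recr /= mulrDr.
have := step n mn; lra.
Qed.

Lemma growth_set_not_snull (s : R) : 0 < s -> s * (d + (d - 1) * kap) < 1 ->
  ~ snull s (birkhoff_growth_set f phi Phi).
Proof.
move=> s0 sD; have k0 := kap0; have d1' := d1; have b1' := b1.
pose gam := 1 - s * (d + (d - 1) * kap).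
have gam0 : 0 < gam by rewrite /gam; lra.
(* Perturbing [d] and [kap] by multiples of [dl] lowers [gam] by at most [M * dl], which the choice
   of [dl] keeps below half of [gam]. *)
pose M := 1 + 3 * s + s * (d - 1) + 2 * s * kap.
have M0 : 0 < M.
  have := mulr_gt0 s0 (_ : 0 < d - 1); have := mulr_ge0 (ltW s0) k0.
  by rewrite /M => h1 h2; have := h2 ltac:(lra); lra.
have [dl [dl0 dl1 dlM]] : exists dl : R, [/\ 0 < dl, dl <= 1 / 2 & 2 * M * dl <= gam].
  exists (Num.min (1 / 2) (gam / (2 * M))); split.
  - by rewrite lt_min; apply/andP; split; [lra|rewrite divr_gt0// pmulr_rgt0].
  - by rewrite ge_min lexx.
  - by rewrite mulrC -ler_pdivlMr ?pmulr_rgt0// ge_min lexx orbT.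
pose th := (1 - dl) - s * (d + dl) - s * (d - 1 + 2 * dl) * (kap + dl).
have th0 : 0 < th.
  have : dl * dl <= dl * (1 / 2) by rewrite ler_pM2l.
  move=> h1; have h2 : s * (dl * dl) <= s * (dl * (1 / 2)) by rewrite ler_pM2l.
  by have := mulr_gt0 s0 dl0; move: dlM h2 gam0; rewrite /th /gam /M; lra.
have [K1 [K2 [K10 K20 H]]] := ifs_bilipschitz hf dl0.
have [c hc] := ifs_cells hf.
(* The window has nearly the full exponent [L n], which gives the dimension, but its relative width
   exp(- dl L) is small enough for the growth. *)
pose N n := Num.truncn (expR ((1 - dl) * L n)).
have E1 n : 1 <= expR ((1 - dl) * L n).
  by rewrite -[leLHS]expR0 ler_expR mulr_ge0 ?L0//; lra.
have Nge n : expR ((1 - dl) * L n) / 2 <= (N n)%:R by exact: truncn_ge_half.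
have Nle n : (N n)%:R <= expR ((1 - dl) * L n).
  by have /andP[] := truncn_itv (le_trans ler01 (E1 n)).
have N0 n : (0 < N n)%N by rewrite -(ltr0n R); have := Nge n; have := E1 n; lra.
pose q n := (Num.truncn (expR (L n))).+1.
have u1 n : 1 <= expR (L n) by rewrite -[leLHS]expR0 ler_expR L0.
have qb n : expR (L n) <= (q n)%:R <= expR (L n) + 1.
  have /andP[h1 h2] := truncn_itv (le_trans ler01 (u1 n)).
  by apply/andP; split; [exact: ltW|rewrite -natr1 lerD2r].
have q2 n : (1 < q n)%N by rewrite ltnS -(ltr0n R); have := truncn_ge_half (u1 n); have := u1 n; lra.
pose dg (e : nat -> nat) k := (q k + 2 * e k)%N.
have dg0 e k : (0 < dg e k)%N by rewrite addn_gt0.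
have dgb e : (forall k, (e k < N k)%N) -> forall n,
    expR (L n) <= (dg e n)%:R <= expR (L n) * (1 + 3 * expR (- dl * L n)).
  move=> eN n; have /andP[q1' q2'] := qb n.
  have en : (e n)%:R + 1 <= expR ((1 - dl) * L n).
    by apply: le_trans (Nle n); rewrite natr1 ler_nat.
  have -> : expR (L n) * (1 + 3 * expR (- dl * L n)) = expR (L n) + 3 * expR ((1 - dl) * L n).
    have -> : expR ((1 - dl) * L n) = expR (L n) * expR (- dl * L n).
      by rewrite -expRD; congr expR; ring.
    ring.
  rewrite /dg natrD natrM; have := ler0n R (e n); have := E1 n; lra.
have dg4 e : (forall k, (e k < N k)%N) -> forall n, (dg e n)%:R <= 4 * expR (L n).
  move=> eN n; have /andP[_ h] := dgb e eN n; apply: (le_trans h).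
  have : expR (- dl * L n) <= 1 by rewrite -[leRHS]expR0 ler_expR mulNr oppr_le0 mulr_ge0 ?L0// ltW.
  have := expR_gt0 (L n); nra.
have exH (e : nat -> nat) : exists x, expansion f x (dg e) by apply: (expansion_exists hf); exact: dg0.
have [Hp hHp] := choice exH.
pose g i := K1 * (i%:R : R) `^ (- (d + dl)).
have g0 i : 0 <= g i by rewrite mulr_ge0 ?powR_ge0 ?ltW.
have glow i x y i0 x01 y01 := (andP (H i x y i0 x01 y01)).1.
pose k1 := ln K1 - (d + dl) * ln 4.
have gmono e n i : (forall k, (e k < N k)%N) -> (0 < i)%N -> (i <= dg e n)%N -> expR (k1 - (d + dl) * L n) <= g i.
  move=> eN i0 ii; rewrite /g powR_expR ?ltr0n//.
  have -> : k1 - (d + dl) * L n = ln K1 + - (d + dl) * ln (4 * expR (L n)).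
    by rewrite lnM ?posrE ?expR_gt0// expRK /k1; ring.
  rewrite expRD lnK// ler_pM2l// ler_expR !mulNr lerN2 ler_pM2l; last by lra.
  rewrite ler_ln ?posrE ?ltr0n// ?mulr_gt0 ?expR_gt0//.
  by apply: le_trans (dg4 e eN n); rewrite ler_nat.
(* A lower bound for the length of every selected interval of order n + 1: [n] contractions and the
   cell of the last letter. *)
pose rho n := expR (\sum_(k < n.+1) (k1 - (d + dl) * L k)).
have [C1 hC1] := root_log_le_sum dl0.
pose c2 := `|ln 2 - s * k1|.
have c20 : 0 <= c2 by exact: normr_ge0.
have [C2 hC2] : exists C, forall n, n%:R <= th / (c2 + 1) * (\sum_(k < n) L k) + C.
  by apply: linear_le_sum; rewrite divr_gt0// ltr_wpDl.
(* th is the coefficient left to the sum of the root_log k after L n and n are bounded by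
   multiples of that sum. *)
pose C3 := s * (d - 1 + 2 * dl) * C1 + c2 * C2 - s * (k1 - ln 2).
have rprod n : expR ((1 - dl) * (\sum_(k < n) L k) - n%:R * ln 2) <= radix_prod (R := R) N n.
  have -> : (1 - dl) * (\sum_(k < n) L k) - n%:R * ln 2 = \sum_(k < n) ((1 - dl) * L k - ln 2).
    by rewrite sumrB -mulr_sumr sumr_const card_ord mulr_natl.
  rewrite expR_sum; apply: ler_prod => k _; rewrite expR_ge0 /=.
  by rewrite expRB lnK// posrE.
apply: (@mixed_radix_not_snull R N N0 s (expR C3) _ Hp rho) => //.
- rewrite ltW// -(@ltr_pM2r _ d); last by lra.
  by have := mulr_ge0 (ltW s0) (mulr_ge0 (ltW (_ : 0 < d - 1)) k0); nra.
- exact: expR_gt0.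
- move=> e eN; split.
    by apply: (expansion_gt0_lt1 hc (hHp e)); rewrite /dg (leq_trans (q2 0%N))// leq_addr.
  exists (dg e); split=> //.
  have -> : (fun n => birkhoff_sum f phi (dg e) n / Phi n) =
      (fun n => (\sum_(k < n) expR (ln ((dg e k)%:R : R) `^ b)) / Phi n).
    by apply/funext => n; rewrite (birkhoff_sumE n hval).
  exact: (@window_digits_growth _ b l b1 loo Phi dl) (dgb e eN).
- by move=> n; exact: expR_gt0.
- move=> e e' n eN eN' agr lt.
  have agr' k : (k < n)%N -> dg e k = dg e' k by move=> kn; rewrite /dg agr.
  have lt' : (dg e n < dg e' n)%N by rewrite ltn_add2l ltn_mul2l.
  apply: le_trans (expansion_separation hf hc g0 glow (hHp e) (hHp e') agr' lt').
  rewrite /rho expR_sum big_ord_recr /= mulrCA.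
  apply: ler_pM.
  + by apply: prodr_ge0 => k _; exact: expR_ge0.
  + by rewrite mulr_ge0 ?expR_ge0// subr_ge0 ler_nat ltnW.
  + apply: ler_prod => k _; rewrite expR_ge0 /=; exact: gmono.
  + have le1 : (dg e n <= (dg e' n).-1)%N by rewrite -ltnS prednK.
    apply: le_trans (@cells_sub_lower c (expR (k1 - (d + dl) * L n)) _ _ le1 _).
      apply: ler_wpM2r; first exact: expR_ge0.
      by rewrite -natrB ?(ltnW lt)// ler_nat; exact: window_gap.
    move=> k ik kj; rewrite (cell_length hf hc).
    apply: (le_trans (gmono e' n k.+1 eN' isT _)).
      by rewrite (leq_trans kj)// leq_pred.
    by have := glow k.+1 1 0 isT in01_1 in01_0; rewrite subr0 normr1 mulr1.
- move=> n; have rp := rprod n; set S := \sum_(k < n) L k in rp *.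
  have S0 : 0 <= S by apply: sumr_ge0.
  have rN : expR ((1 - dl) * L n - ln 2 + (n.+1%:R * k1 - (d + dl) * (S + L n))) <= (N n)%:R * rho n.
    have -> : rho n = expR (n.+1%:R * k1 - (d + dl) * (S + L n)).
      rewrite /rho; congr expR; rewrite sumrB -mulr_sumr sumr_const card_ord mulr_natl.
      by rewrite big_ord_recr.
    rewrite expRD; apply: ler_wpM2r; first exact: expR_ge0.
    by rewrite expRB lnK ?posrE.
  apply: (@le_trans _ _ (expR C3 * expR ((1 - dl) * S - n%:R * ln 2) *
    (expR ((1 - dl) * L n - ln 2 + (n.+1%:R * k1 - (d + dl) * (S + L n)))) `^ s)); last first.
    apply: ler_pM.
    + by rewrite mulr_ge0 ?expR_ge0.
    + exact: powR_ge0.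
    + by rewrite ler_pM2l ?expR_gt0.
    + by apply: ge0_ler_powR; rewrite ?nnegrE ?(ltW s0) ?expR_ge0// mulr_ge0 ?ler0n ?expR_ge0.
  rewrite -expRM -!expRD -[leLHS]expR0 ler_expR -natr1.
  have h1 : s * (d - 1 + 2 * dl) * L n <= s * (d - 1 + 2 * dl) * ((kap + dl) * S + C1).
    by apply: ler_wpM2l; [rewrite mulr_ge0 ?(ltW s0)//; lra|exact: hC1].
  have h2 : c2 * n%:R <= c2 * (th / (c2 + 1) * S + C2) by apply: ler_wpM2l.
  have h3 : c2 * (th / (c2 + 1) * S) <= th * S.
    rewrite mulrA; apply: ler_wpM2r => //.
    by rewrite mulrCA ler_piMr ?(ltW th0)// ler_pdivrMr ?mul1r; lra.
  have h4 : (ln 2 - s * k1) * n%:R <= c2 * n%:R by rewrite ler_wpM2r ?ler_norm.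
  move: h1 h2 h3 h4; rewrite /C3 /th; lra.
- move=> M1.
  have [n0 _ hn0] := root_log_oo b1 loo (2 * ln 4).
  have N2 n : (n0 <= n)%N -> (2 <= N n)%N.
    move=> nn; rewrite -(ler_nat R); apply: le_trans (Nge n).
    rewrite ler_pdivlMr// -natrM -[leLHS]lnK ?posrE// ler_expR.
    have h : 2 * ln 4 <= L n by exact: hn0.
    have l4 : 0 <= ln (4 : R) by rewrite ln_ge0// ler1n.
    have -> : (2 * 2)%:R = 4 :> R by [].
    by nra.
  have big m : (2 : R) ^+ m <= radix_prod (R := R) N (n0 + m).
    elim: m => [|m IH].
      rewrite addn0 expr0 /radix_prod; elim: (n0) => [|n1 IH]; first by rewrite big_ord0.
      rewrite big_ord_recr /= -[leLHS]mulr1; apply: ler_pM => //.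
      by rewrite ler1n.
    rewrite addnS /radix_prod big_ord_recr /= exprSr; apply: ler_pM => //.
    by rewrite ler_nat N2// leq_addr.
  exists (n0 + (Num.truncn `|M1|).+1)%N; apply: le_trans (big _).
  apply: (le_trans (ler_norm M1)).
  have /andP[_ h] := truncn_itv (normr_ge0 M1).
  apply: (le_trans (ltW h)); rewrite -natrX ler_nat.
  by rewrite ltnW// ltn_expl.
Qed.

End growth_lower_bound.

(** * Lengths of basic intervals under bounded distortion *)

Section distortion.
Context {R : realType}.
Variables (d : R) (f : nat -> R -> R) (c : nat -> R).
Hypotheses (hf : gauss_like_ifs d f) (hc : cells f c).

(** The length of the basic interval, since word maps are monotone; see [diam_basic_interval]. *)
Definition wlen (w : seq nat) : R := `|word_map f w 1 - word_map f w 0|.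

Lemma wlen_gt0 w : word w -> 0 < wlen w.
Proof.
move=> ww; rewrite /wlen normr_gt0 subr_eq0; apply/eqP => E.
have := word_map_injective hf ww in01_1 in01_0 E; apply/eqP; exact: oner_neq0.
Qed.

Lemma word_map_add w x y z : word w -> x \in `[0, 1] -> y \in `[0, 1] -> z \in `[0, 1] ->
  x <= y -> y <= z ->
  `|word_map f w z - word_map f w x| =
  `|word_map f w z - word_map f w y| + `|word_map f w y - word_map f w x|.
Proof.
move=> ww x01 y01 z01 xy yz.
case: (word_map_monotone hf ww) => h.
  have h1 : word_map f w x <= word_map f w y by rewrite h.
  have h2 : word_map f w y <= word_map f w z by rewrite h.
  by rewrite !ger0_norm; lra.
have h1 : word_map f w y <= word_map f w x by rewrite h.
have h2 : word_map f w z <= word_map f w y by rewrite h.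
by rewrite !ler0_norm; lra.
Qed.

Lemma word_map_dist_mono w x y x' y' : word w -> 0 <= x' -> x' <= x -> x <= y -> y <= y' -> y' <= 1 ->
  `|word_map f w y - word_map f w x| <= `|word_map f w y' - word_map f w x'|.
Proof.
move=> ww h1 h2 h3 h4 h5.
have i1 : x' \in `[0, 1] by rewrite in_itv /=; lra.
have i2 : x \in `[0, 1] by rewrite in_itv /=; lra.
have i3 : y \in `[0, 1] by rewrite in_itv /=; lra.
have i4 : y' \in `[0, 1] by rewrite in_itv /=; lra.
rewrite (word_map_add ww i1 i2 i4) //; last by lra.
by rewrite (word_map_add ww i2 i3 i4) // addrAC lerDr addr_ge0.
Qed.

Lemma word_map_dist_le_wlen w x y : word w -> x \in `[0, 1] -> y \in `[0, 1] ->
  `|word_map f w x - word_map f w y| <= wlen w.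
Proof.
move=> ww; rewrite !in_itv /= => /andP[? ?] /andP[? ?].
have [xy|/ltW yx] := leP x y; first by rewrite distrC; apply: word_map_dist_mono.
exact: word_map_dist_mono.
Qed.

Lemma c_in01 n : c n \in `[0, 1].
Proof.
rewrite in_itv /= (ltW (cells_lt1 hc n)) andbT.
by have := cells_le hc (leq0n n); rewrite (cells0 hc).
Qed.

Lemma letter_endpoints j :
  (f j.+1 0 = c j /\ f j.+1 1 = c j.+1) \/ (f j.+1 0 = c j.+1 /\ f j.+1 1 = c j).
Proof.
have /andP[h1 h2] := letter_ge hc (isT : (0 < j.+1)%N) in01_0.
have /andP[h3 h4] := letter_ge hc (isT : (0 < j.+1)%N) in01_1.
have := cell_length hf hc j; have := cells_lt hc j; rewrite /= in h1 h3.
have [h|h] := leP (f j.+1 0) (f j.+1 1).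
  by rewrite ger0_norm ?subr_ge0// => ? ?; left; split; lra.
by rewrite ltr0_norm ?subr_lt0// => ? ?; right; split; lra.
Qed.

Lemma wlen_rcons u j : wlen (rcons u j.+1) = `|word_map f u (c j.+1) - word_map f u (c j)|.
Proof.
rewrite /wlen -cats1 !word_map_cat /=.
by case: (letter_endpoints j) => -[-> ->] //; rewrite distrC.
Qed.

Lemma wlen1 j : wlen [:: j.+1] = c j.+1 - c j.
Proof. by rewrite (cell_length hf hc). Qed.

Lemma wlen_nil : wlen [::] = 1.
Proof. by rewrite /wlen /= subr0 normr1. Qed.

Lemma sum_wlen_rcons u (M M' : nat) : word u -> (M <= M')%N ->
  \sum_(M <= j < M') wlen (rcons u j.+1) = `|word_map f u (c M') - word_map f u (c M)|.
Proof.
move=> wu; elim: M' => [|M' IH]; first by rewrite leqn0 => /eqP ->; rewrite big_geq// subrr normr0.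
rewrite leq_eqVlt => /orP[/eqP ->|]; first by rewrite big_geq// subrr normr0.
rewrite ltnS => MM; rewrite big_nat_recr//= IH// wlen_rcons addrC -word_map_add//; try exact: c_in01.
  exact: (cells_le hc).
by apply: ltW; exact: (cells_lt hc).
Qed.

Lemma sum_wlen_le u M : word u -> \sum_(0 <= j < M) wlen (rcons u j.+1) <= wlen u.
Proof.
move=> wu; rewrite sum_wlen_rcons//; apply: word_map_dist_le_wlen => //; exact: c_in01.
Qed.

Lemma diam_basic_interval w : word w -> fine (diam (basic_interval f w)) = wlen w.
Proof.
move=> ww; suff -> : diam (basic_interval f w) = (wlen w)%:E by [].
apply/eqP; rewrite eq_le; apply/andP; split.
  apply: diam_le; first exact: normr_ge0.
  by move=> x y [z z01 <-] [z' z01' <-]; exact: word_map_dist_le_wlen.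
by apply: le_diam; [exists 1 => //; exact: in01_1|exists 0 => //; exact: in01_0].
Qed.

Lemma wlen_distortion : bounded_distortion f -> exists K3 K4 : R, [/\ 0 < K3, 0 < K4 &
  forall u v, word u -> word v ->
    K3 * (wlen u * wlen v) <= wlen (u ++ v) <= K4 * (wlen u * wlen v)].
Proof.
move=> [K3 [K4 [K30 K40 H]]]; exists K3, K4; split=> // u v wu wv.
have wuv : word (u ++ v) by rewrite /word all_cat; apply/andP.
have := H u v wu wv; rewrite !diam_basic_interval//.
have p : 0 < wlen u * wlen v by rewrite mulr_gt0// wlen_gt0.
by rewrite ler_pdivlMr// ler_pdivrMr.
Qed.

Variables K3 K4 : R.
Hypotheses (K30 : 0 < K3) (K40 : 0 < K4).
Hypothesis distort : forall u v, word u -> word v ->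
    K3 * (wlen u * wlen v) <= wlen (u ++ v) <= K4 * (wlen u * wlen v).

Lemma word_rcons u j : word (rcons u j.+1) = word u.
Proof. by rewrite /word all_rcons. Qed.

(* Each of two sibling intervals occupies a fixed proportion of its parent, so that no child
   can occupy almost all of it. *)
Lemma wlen_decay : exists2 th : R, 0 < th < 1 & forall w, word w -> wlen w <= th ^+ size w.
Proof.
pose k := K3 * Num.min (wlen [:: 1%N]) (wlen [:: 2%N]).
have k0 : 0 < k by rewrite mulr_gt0// lt_min !wlen_gt0.
have key u j : word u -> wlen (rcons u j.+1) <= (1 - k) * wlen u.
  move=> wu.
  have lower i : (i < 2)%N -> k * wlen u <= wlen (rcons u i.+1).
    move=> i2; have wi : word [:: i.+1] by [].
    have /andP[h _] := distort wu wi; rewrite cats1 in h; apply: le_trans h.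
    rewrite /k -mulrA ler_pM2l// mulrC ler_pM2l ?wlen_gt0//.
    by case: i i2 wi => [|[|]] //= _ _; rewrite ge_min lexx ?orbT.
  have two := sum_wlen_le (maxn 2 j.+1) wu.
  suff : exists2 i, (i < 2)%N & wlen (rcons u i.+1) + wlen (rcons u j.+1) <= wlen u.
    by move=> [i i2]; have := lower i i2; lra.
  have pos i : 0 <= wlen (rcons u i.+1) by exact: normr_ge0.
  rewrite big_ltn in two; last by rewrite leq_max.
  case: j two => [|j] two; [exists 1%N => //|exists 0%N => //].
    rewrite big_ltn in two; last by rewrite leq_max.
    have : 0 <= \sum_(2 <= j < maxn 2 1) wlen (rcons u j.+1) by apply: sumr_ge0.
    lra.
  have : wlen (rcons u j.+2) <= \sum_(1 <= i < maxn 2 j.+2) wlen (rcons u i.+1).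
    rewrite (@big_cat_nat _ _ _ j.+1)//=; last by rewrite leq_max leqnSn orbT.
    rewrite [X in _ + X]big_ltn ?leq_max ?leqnn ?orbT// addrCA lerDl addr_ge0 ?sumr_ge0//.
  lra.
have k1 : k < 1.
  have := key [::] 0%N isT; rewrite wlen_nil mulr1.
  have : 0 < wlen (rcons [::] 1%N) by exact: wlen_gt0.
  lra.
exists (1 - k); first by lra.
elim/last_ind => [|u [|j] IH]; first by rewrite wlen_nil expr0.
  by rewrite /word all_rcons.
rewrite word_rcons => wu; apply: (le_trans (key u j wu)).
by rewrite size_rcons exprS; apply: ler_wpM2l; [lra|exact: IH].
Qed.

(** Distortion speaks of basic intervals only, so it is summed over the cells between [c M] and a
    far [c m]; the rest is made small by the Lipschitz constant of the word map. *)
Lemma word_map_tail_le u M : word u -> 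
  `|word_map f u 1 - word_map f u (c M)| <= K4 * wlen u * (1 - c M).
Proof.
move=> wu; have [B1 [B2 [B10 B20 H]]] := ifs_bilipschitz hf ltr01.
pose g i := B2 * (i%:R : R) `^ (- (d - 1)).
have g0 i : 0 <= g i by rewrite mulr_ge0 ?powR_ge0 ?ltW.
have up := word_map_upper hf g0 (fun i x y i0 x01 y01 => (andP (H i x y i0 x01 y01)).2) wu.
set Lp := \prod_(_ < _) _ in up.
have Lp0 : 0 <= Lp by apply: prodr_ge0.
have KU : 0 < K4 * wlen u by rewrite mulr_gt0 ?wlen_gt0.
apply/ler_addgt0Pr => e e0.
have [|M' hM'] := cells_cvg1 hc (e := e / (Lp + 1)); first by rewrite divr_gt0// ltr_wpDl.
pose m := maxn M M'.
have Mm : (M <= m)%N by rewrite leq_maxl.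
rewrite (word_map_add wu (c_in01 M) (c_in01 m) in01_1 (cells_le hc Mm) (ltW (cells_lt1 hc m))).
rewrite addrC; apply: lerD; last first.
  apply: (le_trans (up _ _ in01_1 (c_in01 m))).
  have m1 := cells_lt1 hc m; rewrite gtr0_norm; last by lra.
  have : c M' <= c m by apply: (cells_le hc); rewrite leq_maxr.
  rewrite ler_pdivlMr in hM'; last by lra.
  nra.
rewrite -sum_wlen_rcons//.
apply: (@le_trans _ _ (\sum_(M <= j < m) (K4 * wlen u * (c j.+1 - c j)))).
  apply: ler_sum => j _; rewrite -wlen1.
  by have /andP[_ h] := distort wu (isT : word [:: j.+1]); rewrite cats1 mulrA in h.
rewrite -mulr_sumr telescope_sumr// ler_pM2l// lerD2r ltW//; exact: cells_lt1 hc m.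
Qed.

Section bounded_letters.
Variable M : nat -> nat.
Hypothesis Msum : forall n, \sum_(k < n) K4 * (1 - c (M k)) <= 1 / 8.

Definition bounded_letters_set : set R :=
  [set y | (y \in `[0, 1[) /\ exists e, expansion f y e /\ forall k, (e k <= M k)%N].

Fixpoint bounded_words (n : nat) : seq (seq nat) :=
  if n is n'.+1 then [seq rcons w j.+1 | w <- bounded_words n', j <- iota 0 (M n')] else [:: [::]].

Lemma size_bounded_words n w : w \in bounded_words n -> size w = n.
Proof.
elim: n w => [|n IH] w /=; first by rewrite inE => /eqP ->.
by move=> /allpairsP[[v j] /= [/IH <- _ ->]]; rewrite size_rcons.
Qed.

Lemma word_bounded_words n w : w \in bounded_words n -> word w.
Proof.
elim: n w => [|n IH] w /=; first by rewrite inE => /eqP ->.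
by move=> /allpairsP[[v j] /= [/IH vw _ ->]]; rewrite word_rcons.
Qed.

Lemma bounded_words_uniq n : uniq (bounded_words n).
Proof.
elim: n => [//|n IH] /=; apply: allpairs_uniq => //; first exact: iota_uniq.
by move=> [w j] [v i] /= _ _ /rcons_inj[-> ->].
Qed.

Lemma sum_bounded_words n : \sum_(w <- bounded_words n) wlen w <= 1.
Proof.
elim: n => [|n IH] /=; first by rewrite big_seq1 wlen_nil.
rewrite big_allpairs_dep /=; apply: le_trans IH.
rewrite big_seq [leRHS]big_seq; apply: ler_sum => w /word_bounded_words ww.
by have := sum_wlen_le (M n) ww; rewrite /index_iota subn0.
Qed.

(** A point of [0, 1) outside the set has a bounded prefix [w] after which it falls to the right of
    [c (M (size w))]. Such tails occupy at most the proportion K4 * (1 - c (M n)) of the bounded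
    intervals of order n, whose lengths sum to at most 1, so [Msum] makes the whole exceptional part
    cost at most 1/8. *)
Lemma bounded_letters_not_snull : ~ snull 1 bounded_letters_set.
Proof.
pose ok w := w \in bounded_words (size w).
pose V w : set R := if ok w then word_map f w @` `[c (M (size w)), 1]%classic else set0.
pose D w := if ok w then K4 * wlen w * (1 - c (M (size w))) else 0.
have c1 n : 0 <= 1 - c n by have := cells_lt1 hc n; lra.
apply: (@snull1_cover01 R (seq nat) _ V D).
- move=> y; rewrite /= in_itv /= => y01.
  have [hV|hV] := pselect (exists w, V w y); [by right|left].
  split; first by rewrite in_itv.
  (* A point outside every tail always has an admissible next letter; [choice] makes this a function
     on words, and 0 is returned where nothing is asked. *)
  have step w : exists j, ok w -> basic_interval f w y ->
      [/\ (0 < j)%N, (j <= M (size w))%N & basic_interval f (rcons w j) y].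
    have [okw|nok] := boolP (ok w); last by exists 0%N.
    have [Iy|nI] := pselect (basic_interval f w y); last by exists 0%N.
    have [z z01 zy] := Iy.
    have zc : z < c (M (size w)).
      rewrite ltNge; apply/negP => cz; apply: hV; exists w; rewrite /V okw; exists z => //=.
      by move: z01; rewrite /= !in_itv /= cz => /andP[].
    have [j jM hj] : exists2 j, (j < M (size w))%N & c j <= z <= c j.+1.
      elim: (M (size w)) zc => [|m IH] zm.
        by move: z01 zm; rewrite (cells0 hc) /= in_itv /=; lra.
      have [/IH[j jm hj]|cz] := ltP z (c m); first by exists j => //; exact: ltnW.
      by exists m => //; rewrite cz ltW.
    exists j.+1 => _ _; split=> //.
    have : `[c j, c j.+1]%classic z by rewrite /= in_itv.
    rewrite -(cells_image hc) => -[z' z01' E]; exists z' => //.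
    by rewrite -cats1 word_map_cat /= E.
  have [J hJ] := choice step.
  pose W := fix W n := if n is n'.+1 then rcons (W n') (J (W n')) else [::].
  pose e n := J (W n).
  have We n : mkseq e n = W n.
    by elim: n => [//|n IH]; rewrite mkseqS IH.
  have sW n : size (W n) = n by rewrite -We size_mkseq.
  have inv n : ok (W n) /\ basic_interval f (W n) y.
    elim: n => [|n [okn In]].
      split; first by rewrite /ok /= inE.
      by exists y => //; rewrite /= in_itv /=; lra.
    have [j0 jM Ij] := hJ _ okn In; split=> //.
    rewrite /ok /= size_rcons sW /=.
    rewrite /ok sW in okn; rewrite sW in jM.
    case E : (J (W n)) j0 jM => [//|j] _ jM.
    by apply: (@allpairs_f _ _ _ (fun w j => rcons w j.+1)) => //; rewrite mem_iota.
  exists e; split; [split|].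
  + by move=> k; have [okk Ik] := inv k; have [] := hJ _ okk Ik.
  + by move=> n; rewrite We; case: (inv n).
  + by move=> k; have [okk Ik] := inv k; have [_ + _] := hJ _ okk Ik; rewrite sW.
- by move=> w; rewrite /D; case: ifP => // _; rewrite mulr_ge0// mulr_ge0 ?normr_ge0// ltW.
- move=> w x y; rewrite /V /D; case: ifP => // /word_bounded_words ww [z z01 <-] [z' z01' <-].
  apply: le_trans (word_map_tail_le (M (size w)) ww).
  have := c_in01 (M (size w)); move: z01 z01'; rewrite /= !in_itv /= => /andP[? ?] /andP[? ?] /andP[? ?].
  by have [zz|/ltW zz] := leP z z'; [rewrite distrC|]; apply: word_map_dist_mono.
- move=> l ul.
  pose S := (\max_(w <- l) size w).+1.
  have lS w : w \in l -> (size w < S)%N.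
    by move=> wl; rewrite ltnS; exact: (@leq_bigmax_seq _ l xpredT (fun w => size w)).
  rewrite (bigID ok) /= [X in _ + X]big1 ?addr0; last by move=> w /negbTE; rewrite /D => ->.
  rewrite -big_filter.
  pose LL := [seq w | n <- iota 0 S, w <- bounded_words n].
  apply: (@le_trans _ _ (\sum_(w <- LL) D w)).
    apply: ler_sum_uniq.
    + exact: filter_uniq.
    + apply: allpairs_uniq_dep; first exact: iota_uniq.
        by move=> n _; exact: bounded_words_uniq.
      move=> [n w] [n' w'] /allpairsPdep[m [v [_ vm [E1 E2]]]] /allpairsPdep[m' [v' [_ vm' [E1' E2']]]] /= ww.
      have E : n = n'.
        rewrite E1 E1' -(size_bounded_words vm) -(size_bounded_words vm').
        by rewrite -E2 -E2' ww.
      by rewrite E ww.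
    + move=> w; rewrite mem_filter => /andP[okw wl].
      by apply/allpairsPdep; exists (size w), w; split=> //; rewrite mem_iota; exact: lS.
    + by move=> w; rewrite /D; case: ifP => // _; rewrite mulr_ge0// mulr_ge0 ?normr_ge0// ltW.
  rewrite /LL big_allpairs_dep /=.
  apply: le_trans (Msum S).
  rewrite -(big_mkord xpredT (fun k => K4 * (1 - c (M k)))) /index_iota subn0.
  apply: ler_sum => n _.
  apply: (@le_trans _ _ (\sum_(w <- bounded_words n) wlen w * (K4 * (1 - c (M n))))).
    rewrite big_seq [leRHS]big_seq; apply: ler_sum => w wn.
    rewrite /D /ok (size_bounded_words wn) wn.
    by rewrite le_eqVlt; apply/orP; left; apply/eqP; ring.
  rewrite -mulr_suml -[leRHS]mul1r; apply: ler_wpM2r; last exact: sum_bounded_words.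
  by rewrite mulr_ge0// ltW.
Qed.

End bounded_letters.

End distortion.

(** * Insertion of prescribed letters *)

Section planting.
Variable r : nat -> nat.
Hypotheses (r0 : r 0%N = 0%N) (rmono : forall n, (r n <= r n.+1)%N)
  (rstep : forall n, (r n.+1 <= (r n).+1)%N).

(* r n counts the letters of q placed before position n; position n receives a letter of q
   exactly when r jumps. *)
Definition plant (q e : nat -> nat) (n : nat) : nat :=
  if r n.+1 == r n then e (n - r n)%N else q (r n).

Lemma plant_index_le n : (r n <= n)%N.
Proof. by elim: n => [|n IH]; [rewrite r0|apply: leq_trans (rstep n) _]. Qed.

Lemma plant_index_eq n : r n.+1 = r n -> (n.+1 - r n.+1 = (n - r n).+1)%N.
Proof. by move=> ->; rewrite subSn// plant_index_le. Qed.

Lemma plant_index_neq n : r n.+1 != r n ->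
  (r n.+1 = (r n).+1) /\ (n.+1 - r n.+1 = n - r n)%N.
Proof.
move=> h; have E : r n.+1 = (r n).+1.
  by apply/eqP; rewrite eqn_leq rstep /= ltn_neqAle eq_sym h rmono.
by rewrite E subSS.
Qed.

Lemma plant_gt0 q e : (forall k, (0 < q k)%N) -> (forall k, (0 < e k)%N) ->
  forall n, (0 < plant q e n)%N.
Proof. by move=> q0 e0 n; rewrite /plant; case: ifP. Qed.

(** The planted letters agree, so the first difference appears at the free position that receives
    the letter number [m]. It is found as the least [n] after which more than [m] free letters have
    been read. *)
Lemma plant_first_diff q e e' m : (forall B, exists n, (B <= n - r n)%N) ->
  (forall k, (k < m)%N -> e k = e' k) -> e m != e' m ->
  exists n, [/\ r n.+1 = r n, (n - r n = m)%N,
    forall k, (k < n)%N -> plant q e k = plant q e' k &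
    plant q e n != plant q e' n].
Proof.
move=> unb agr dif.
have ex : exists n, (m < n.+1 - r n.+1)%N.
  have [[|n] hn] := unb m.+1; first by rewrite sub0n in hn.
  by exists n.
case: (ex_minnP ex) => n hn minn.
have mono k : (k - r k <= k.+1 - r k.+1)%N.
  by have [/plant_index_eq ->|/plant_index_neq[_ ->]] := eqVneq (r k.+1) (r k).
have monole k k' : (k <= k')%N -> (k - r k <= k' - r k')%N.
  elim: k' => [|k' IH]; first by rewrite leqn0 => /eqP ->.
  by rewrite leq_eqVlt => /orP[/eqP ->//|]; rewrite ltnS => /IH /leq_trans; apply.
have nm : (n - r n <= m)%N.
  case: n hn minn => [|n] hn minn; first by rewrite sub0n.
  rewrite leqNgt; apply/negP => /minn; by rewrite ltnn.
have rn : r n.+1 = r n.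
  apply/eqP; apply/negP => /negP /plant_index_neq[_ E].
  by rewrite E ltnNge nm in hn.
have nE : (n - r n = m)%N.
  by apply/eqP; rewrite eqn_leq nm /= -ltnS -(plant_index_eq rn).
exists n; split => //.
  move=> k kn; rewrite /plant; case: (eqVneq (r k.+1) (r k)) => // rk.
  apply: agr; rewrite -nE -ltnS -(plant_index_eq rk) ltnS.
  exact: monole.
by rewrite /plant rn eqxx nE.
Qed.

End planting.

(** * Effect of planted letters on lengths and distances *)

Section planted_lower_bound.
Context {R : realType}.
Variables (d : R) (f : nat -> R -> R) (c : nat -> R).
Hypotheses (hf : gauss_like_ifs d f) (hc : cells f c).
Notation wlen := (wlen f).
Variables K3 K4 : R.
Hypotheses (K30 : 0 < K3) (K40 : 0 < K4).
Hypothesis distort : forall u v, word u -> word v ->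
    K3 * (wlen u * wlen v) <= wlen (u ++ v) <= K4 * (wlen u * wlen v).

(** Splitting off the letter uses distortion twice from below, then rejoining [u] and [v] uses it
    once from above; hence the constant. *)
Lemma wlen_delete u i v : word u -> (0 < i)%N -> word v ->
  K3 ^+ 2 / K4 * wlen [:: i] * wlen (u ++ v) <= wlen (u ++ i :: v).
Proof.
move=> wu i0 wv.
have wi : word [:: i] by rewrite /word /= i0.
have wiv : word (i :: v) by rewrite /word /= i0.
have /andP[h1 _] := distort wu wiv.
have /andP[h2 _] := distort wi wv.
have /andP[_ h3] := distort wu wv.
have pu := wlen_gt0 hf wu; have pv := wlen_gt0 hf wv; have pi := wlen_gt0 hf wi.
apply: le_trans h1; rewrite /= in h2.
apply: (@le_trans _ _ (K3 * (wlen u * (K3 * (wlen [:: i] * wlen v))))); last first.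
  by rewrite ler_pM2l// ler_pM2l.
have -> : K3 * (wlen u * (K3 * (wlen [:: i] * wlen v))) =
    K3 ^+ 2 / K4 * wlen [:: i] * (K4 * (wlen u * wlen v)) by field; rewrite gt_eqF.
by rewrite ler_pM2l// !mulr_gt0 ?invr_gt0 ?exprn_gt0.
Qed.

Lemma wlen_extend (e : nat -> nat) m m' : (forall k, (0 < e k)%N) -> (m <= m')%N ->
  wlen (mkseq e m) * \prod_(m <= k < m') (K3 * wlen [:: e k]) <= wlen (mkseq e m').
Proof.
move=> e0; elim: m' => [|m' IH]; first by rewrite leqn0 => /eqP ->; rewrite big_geq// mulr1.
rewrite leq_eqVlt => /orP[/eqP ->|]; first by rewrite big_geq// mulr1.
rewrite ltnS => mm; rewrite big_nat_recr//= mkseqS -cats1 mulrA.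
have we : word [:: e m'] by rewrite /word /= e0.
have /andP[h _] := distort (word_mkseq m' e0) we.
apply: le_trans h; rewrite mulrCA ler_pM2l// ler_pM2r ?(wlen_gt0 hf we)//.
exact: IH.
Qed.

(* The letter a n1 > 1 keeps x away from both ends of the interval of mkseq a n1, which does not
   contain x' in its interior. *)
Lemma expansion_cushion x x' a a' n n1 : expansion f x a -> expansion f x' a' ->
  (forall k, (k < n)%N -> a k = a' k) -> a n != a' n -> (n < n1)%N -> (1 < a n1)%N ->
  K3 * wlen (mkseq a n1) * Num.min (wlen [:: 1%N]) (wlen [:: (a n1).+1]) <= `|x - x'|.
Proof.
move=> ex ex' agr dif nn1 an1.
have a0 : forall k, (0 < a k)%N by case: ex.
have a0' : forall k, (0 < a' k)%N by case: ex'.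
pose u := mkseq a n1; have wu : word u by exact: word_mkseq.
pose v := mkseq a n; have wv : word v by exact: word_mkseq.
pose F := word_map f u.
have [z' [ez' Ex']] := expansion_tail hf n ex'.
have [y' y01' Ey'] := expansion_first ez'; rewrite addn0 in Ey'.
have vE : mkseq a' n = v.
  by apply/esym/eq_in_map => k; rewrite mem_iota => /andP[_ kn]; exact: agr.
rewrite vE Ey' in Ex'.
have [t wt uE] : exists2 t, word t & u = v ++ a n :: t.
  have [t wt E] := mkseq_split a nn1; exists t; first exact: wt.
  by rewrite /u E mkseqS cat_rcons.
have FE z : F z = word_map f v (f (a n) (word_map f t z)) by rewrite /F uE word_map_cat.
have in1 z : z \in `[0, 1] -> word_map f t z \in `[0, 1] by exact: (word_map_self hf wt).
have self i z : (0 < i)%N -> z \in `[0, 1] -> f i z \in `[0, 1] by move=> i0; exact: (ifs_self hf i0).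
have side : (x' <= F 0 /\ x' <= F 1) \/ (F 0 <= x' /\ F 1 <= x').
  have lt i j z y : (0 < i)%N -> (i < j)%N -> z \in `[0, 1] -> y \in `[0, 1] -> f i z <= f j y.
    move=> i0 ij z01 y01; have := letter_lt hc i0 ij z01 y01.
    have : c i <= c j.-1 by apply: (cells_le hc); rewrite -ltnS prednK// (leq_ltn_trans _ ij).
    lra.
  have s0 := self _ _ (a0 n) (in1 _ in01_0); have s1 := self _ _ (a0 n) (in1 _ in01_1).
  have s2 := self _ _ (a0' n) y01'.
  rewrite !FE Ex'; move: dif; rewrite neq_ltn => /orP[l|l];
    case: (word_map_monotone hf wv) => h; [right|left|left|right]; rewrite !h//; split;
    apply: lt => //; apply: in1; rewrite ?in01_0 ?in01_1//.
have [z [ez Ex]] := expansion_tail hf n1 ex.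
have [y y01 Ey] := expansion_first ez; rewrite addn0 in Ey.
have z01 := expansion_in01 ez.
have /andP[zl zr] := letter_ge hc (a0 n1) y01; rewrite -Ey in zl zr.
have cl : c 1%N <= c (a n1).-1 by apply: (cells_le hc); case: (a n1) an1 => [|[]].
have c0 := cells0 hc.
have z0 : 0 <= z by move: z01; rewrite in_itv /= => /andP[].
have left_gap : K3 * wlen u * wlen [:: 1%N] <= `|F z - F 0|.
  have /andP[h _] := distort wu (isT : word [:: 1%N]); rewrite cats1 (wlen_rcons hf hc) c0 in h.
  rewrite -mulrA; apply: (le_trans h); apply: (word_map_dist_mono hf wu) => //.
  - by have := cells_lt hc 0%N; rewrite c0 => /ltW.
  - by lra.
  - by move: z01; rewrite in_itv /= => /andP[].
have right_gap : K3 * wlen u * wlen [:: (a n1).+1] <= `|F 1 - F z|.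
  have /andP[h _] := distort wu (isT : word [:: (a n1).+1]); rewrite cats1 (wlen_rcons hf hc) in h.
  rewrite -mulrA; apply: (le_trans h); apply: (word_map_dist_mono hf wu) => //.
  - by apply: ltW; exact: cells_lt hc _.
  - by apply: ltW; exact: cells_lt1 hc _.
have between : (F 0 <= F z /\ F z <= F 1) \/ (F 1 <= F z /\ F z <= F 0).
  move: (z01); rewrite in_itv /= => /andP[h0 h1].
  by case: (word_map_monotone hf wu) => h; [left|right]; rewrite !h// ?in01_0 ?in01_1.
have P0 : 0 <= K3 * wlen u by apply: mulr_ge0; [exact: ltW|exact: normr_ge0].
have ml : K3 * wlen u * Num.min (wlen [:: 1%N]) (wlen [:: (a n1).+1]) <= K3 * wlen u * wlen [:: 1%N].
  by rewrite ler_wpM2l// ge_min lexx.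
have mr : K3 * wlen u * Num.min (wlen [:: 1%N]) (wlen [:: (a n1).+1]) <= K3 * wlen u * wlen [:: (a n1).+1].
  by rewrite ler_wpM2l// ge_min lexx orbT.
have -> : x = F z by rewrite Ex.
move: ml mr left_gap right_gap; rewrite -/u; set m := K3 * _ * Num.min _ _.
set gl := K3 * _ * _; set gr := K3 * _ * _ => ml mr lg rg.
case: side => -[s0 s1]; case: between => -[b0 b1].
- rewrite ger0_norm in lg; last by lra.
  by rewrite ger0_norm; lra.
- rewrite ler0_norm in rg; last by lra.
  by rewrite ger0_norm; lra.
- rewrite ger0_norm in rg; last by lra.
  by rewrite ler0_norm; lra.
- rewrite ler0_norm in lg; last by lra.
  by rewrite ler0_norm; lra.
Qed.

Variable r : nat -> nat.
Hypotheses (r0 : r 0%N = 0%N) (rmono : forall n, (r n <= r n.+1)%N)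
  (rstep : forall n, (r n.+1 <= (r n).+1)%N).

(** The suffix [v] is needed by the induction, which deletes the last planted letter from the middle
    of a word. *)
Lemma wlen_plant (q e : nat -> nat) n v : (forall k, (0 < q k)%N) -> (forall k, (0 < e k)%N) -> word v ->
  (\prod_(j < r n) (K3 ^+ 2 / K4 * wlen [:: q j])) * wlen (mkseq e (n - r n) ++ v) <=
  wlen (mkseq (plant r q e) n ++ v).
Proof.
move=> q0 e0; elim: n v => [|n IH] v wv; first by rewrite r0 big_ord0 mul1r.
rewrite mkseqS cat_rcons.
have wv' : word (plant r q e n :: v) by rewrite /word /= (plant_gt0 r q0 e0).
apply: le_trans (IH _ wv').
have pj j : 0 < K3 ^+ 2 / K4 * wlen [:: q j].
  have wq : word [:: q j] by rewrite /word /= q0.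
  by rewrite mulr_gt0 ?(wlen_gt0 hf wq)// divr_gt0// exprn_gt0.
have [E|neq] := eqVneq (r n.+1) (r n).
  by rewrite (plant_index_eq r0 rstep E) E /plant E eqxx mkseqS cat_rcons.
have [E1 E2] := plant_index_neq rmono rstep neq.
rewrite E2 /plant (negbTE neq) E1 big_ord_recr /= -mulrA.
apply: ler_wpM2l; first by apply: prodr_ge0 => j _; exact: ltW.
exact: wlen_delete (word_mkseq _ e0) (q0 _) wv.
Qed.

(** [E n] is the logarithmic cost of passing from the interval of [m = n - r n] free letters to the
    distance of the planted points: a cushion at the next planted position [n1], the deleted
    letters, and the free letters up to [n1]. A cost sublinear in [m] is smaller than any power of
    the exponentially decaying length, so every [s < 1] is allowed. *)
Lemma planted_not_snull (s K1 : R) (A : set R) (q M : nat -> nat) (E : nat -> R) :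
  0 < s -> s < 1 -> 0 < K1 ->
  (forall i, (0 < i)%N -> K1 * (i%:R : R) `^ (- (d + 1)) <= wlen [:: i]) ->
  -1 <= d ->
  (forall B, exists n, (B <= n - r n)%N) ->
  (forall k, (1 < q k)%N) ->
  (forall k k', (k <= k')%N -> (M k <= M k')%N) ->
  (forall n, \sum_(k < n) K4 * (1 - c (M k)) <= 1 / 8) ->
  (forall e x, (forall k, (0 < e k <= M k)%N) -> expansion f x (plant r q e) -> A x) ->
  (forall n, r n.+1 = r n -> exists n1, [/\ (n < n1)%N, r n1.+1 != r n1, r n1 = r n &
     expR (- E n) <= K3 * Num.min (wlen [:: 1%N]) (wlen [:: (q (r n)).+1]) *
       (\prod_(j < r n) (K3 ^+ 2 / K4 * wlen [:: q j])) *
       (K3 * (K1 * ((M n1)%:R : R) `^ (- (d + 1)))) ^+ (n1 - n)]) ->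
  (forall e : R, 0 < e -> exists C, forall n, E n <= e * (n - r n)%:R + C) ->
  ~ snull s A.
Proof.
move=> s0 s1 K10 K1l dm1 unb q2 Mmono Msum HA Enext Esub hA.
have q0 k : (0 < q k)%N by apply: ltnW.
have [th /andP[th0 th1] decay] := wlen_decay hf hc K30 distort.
(* With [la] the length after [m] free letters, la <= th^m and la = la^s * la^(1 - s), so the last
   factor is at most exp(- s tau m), which pays for the [s]-th power of exp(- E n). *)
pose tau := - ((1 - s) * ln th) / s.
have lth : ln th < 0 by rewrite ln_lt0// th0.
have tau0 : 0 < tau by rewrite divr_gt0// oppr_gt0 pmulr_rlt0// subr_gt0.
have [C hC] := Esub _ tau0.
apply: (bounded_letters_not_snull hf hc K40 distort Msum).
have ex (y : R) : exists p : (nat -> nat) * R, bounded_letters_set f M y ->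
    [/\ expansion f y p.1, forall k, (p.1 k <= M k)%N & expansion f p.2 (plant r q p.1)].
  have [[y01 [e [ey eM]]]|nT] := pselect (bounded_letters_set f M y); last by exists ((fun=> 0%N), 0).
  have e0 : forall k, (0 < e k)%N by case: ey.
  have [x hx] := expansion_exists hf (plant_gt0 r q0 e0).
  by exists (e, x).
have [p hp] := choice ex.
apply: (@snull_holder R s (expR (s * C)) _ A (fun y => (p y).2)) => //.
- exact: expR_gt0.
- move=> y Ty; have [ey eM ex'] := hp y Ty; apply: HA ex' => k.
  by rewrite eM andbT; case: ey.
move=> y y' Ty Ty'; have [ey eM ex1] := hp y Ty; have [ey' eM' ex1'] := hp y' Ty'.
set e := (p y).1 in ey eM ex1; set e' := (p y').1 in ey' eM' ex1'.
have e0 : forall k, (0 < e k)%N by case: ey.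
have e0' : forall k, (0 < e' k)%N by case: ey'.
have agree_le m : (forall k, (k < m)%N -> e k = e' k) -> `|y - y'| <= wlen (mkseq e m).
  move=> agr; have [z [ez ->]] := expansion_tail hf m ey; have [z' [ez' ->]] := expansion_tail hf m ey'.
  have -> : mkseq e' m = mkseq e m.
    by apply/esym/eq_in_map => k; rewrite mem_iota => /andP[_ km]; exact: agr.
  apply: (word_map_dist_le_wlen hf (word_mkseq m e0)); [exact: expansion_in01 ez|exact: expansion_in01 ez'].
have [agr|] := pselect (forall k, e k = e' k).
  have -> : `|y - y'| = 0.
    apply/eqP; rewrite eq_le normr_ge0 andbT; apply/ler_addgt0Pr => ep ep0; rewrite add0r.
    have := cvg_expr (_ : `|th| < 1); rewrite gtr0_norm// => /(_ th1) /cvgrPdist_le /(_ ep ep0) [n _ /(_ n (leqnn n))].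
    rewrite /= sub0r normrN gtr0_norm ?exprn_gt0// => hn.
    apply: le_trans hn; apply: (le_trans (agree_le n (fun k _ => agr k))).
    by rewrite -[in leRHS](size_mkseq e n); apply: decay; exact: word_mkseq.
  by rewrite mulr_ge0 ?powR_ge0 ?expR_ge0.
move=> /existsNP exd.
have {}exd : exists k, e k != e' k by case: exd => k /eqP; exists k.
case: (ex_minnP exd) => m dm minm.
have agr k : (k < m)%N -> e k = e' k.
  by move=> km; apply/eqP; apply: contraTT km => /minm; rewrite -leqNgt.
have [n [rn nm agrX difX]] := plant_first_diff r0 rmono rstep q unb agr dm.
have [n1 [nn1 rn1 rnn1 hE]] := Enext n rn.
have qn1 : plant r q e n1 = q (r n) by rewrite /plant (negbTE rn1) rnn1.
have h1 := expansion_cushion ex1 ex1' agrX difX nn1; rewrite qn1 in h1.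
have {}h1 := h1 (q2 _).
have h2 := wlen_plant n1 q0 e0 (isT : word [::]); rewrite !cats0 rnn1 in h2.
have mn1 : (m <= n1 - r n)%N by rewrite -nm leq_sub2r// ltnW.
have h3 := wlen_extend e0 mn1.
set la := wlen (mkseq e m) in h3.
have la0 : 0 < la by apply: (wlen_gt0 hf); exact: word_mkseq.
have h4 : (K3 * (K1 * ((M n1)%:R : R) `^ (- (d + 1)))) ^+ (n1 - n) <=
    \prod_(m <= k < n1 - r n) (K3 * wlen [:: e k]).
  have -> : (n1 - n = n1 - r n - m)%N.
    by rewrite -nm -subnDA subnKC// (plant_index_le r0 rstep).
  rewrite -prodr_const_nat.
  rewrite big_nat [leRHS]big_nat; apply: ler_prod => k /andP[_ kk].
  rewrite !mulr_ge0 ?powR_ge0 ?(ltW K30) ?(ltW K10)//= ler_pM2l//.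
  apply: le_trans (K1l _ (e0 _)); rewrite ler_pM2l// !powRN lef_pV2 ?posrE ?powR_gt0 ?ltr0n//; last first.
    by apply: leq_trans (e0 0%N) _; apply: leq_trans (eM 0%N) _; exact: Mmono.
  apply: ge0_ler_powR; rewrite ?nnegrE ?ler0n//; first by lra.
  rewrite ler_nat; apply: leq_trans (eM _) _; apply: Mmono.
  exact: leq_trans (ltnW kk) (leq_subr _ _).
have key : la * expR (- E n) <= `|(p y).2 - (p y').2|.
  apply: le_trans h1.
  set mn := Num.min _ _ in hE *; set pr := \prod_(j < r n) _ in hE h2.
  set gp := _ ^+ _ in hE h4.
  have wq : word [:: (q (r n)).+1] by [].
  have mn0 : 0 < mn by rewrite lt_min (wlen_gt0 hf wq) (wlen_gt0 hf (isT : word [:: 1%N])).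
  have pr0 : 0 <= pr.
    apply: prodr_ge0 => j _; rewrite mulr_ge0 ?normr_ge0// divr_ge0 ?exprn_ge0 ?ltW//.
  apply: (@le_trans _ _ (la * (K3 * mn * pr * gp))); first by rewrite ler_pM2l.
  have -> : la * (K3 * mn * pr * gp) = K3 * mn * (pr * (la * gp)) by ring.
  rewrite [leRHS]mulrAC ler_pM2l ?mulr_gt0//.
  apply: le_trans h2; apply: ler_wpM2l => //.
  by apply: le_trans h3; rewrite ler_pM2l.
apply: (le_trans (agree_le m agr)); rewrite -/la.
apply: (@le_trans _ _ (expR (s * C) * (la * expR (- E n)) `^ s)); last first.
  rewrite ler_pM2l ?expR_gt0//; apply: ge0_ler_powR; rewrite ?nnegrE ?(ltW s0)//.
  by rewrite mulr_ge0 ?expR_ge0 ?ltW.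
rewrite powRM ?expR_ge0 ?(ltW la0)// -expRM powR_expR//.
rewrite -{1}[la]lnK ?posrE// -!expRD ler_expR.
have h5 : ln la <= m%:R * ln th.
  rewrite mulr_natl -lnXn// ler_ln ?posrE ?exprn_gt0//.
  by rewrite -[in leRHS](size_mkseq e m); apply: decay; exact: word_mkseq.
have h6 := hC n; rewrite nm in h6.
have h7 : (1 - s) * ln la <= (1 - s) * (m%:R * ln th) by rewrite ler_wpM2l//; lra.
have h8 : s * E n <= s * (tau * m%:R + C) by rewrite ler_wpM2l// ltW.
have h9 : s * tau = - ((1 - s) * ln th) by rewrite /tau mulrC divfK// gt_eqF.
have h10 : s * (tau * m%:R + C) = (s * tau) * m%:R + s * C by ring.
rewrite h10 h9 in h8; move: h7 h8; lra.
Qed.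

End planted_lower_bound.

(** * Growth rates *)

Section power_growth.
Context {R : realType}.

(** Superadditivity of the power 1 / p, applied to the p-th powers of [x] and [y]. *)
Lemma powR_subadditive (x y p : R) : 0 <= x -> 0 <= y -> 0 < p -> p <= 1 ->
  (x + y) `^ p <= x `^ p + y `^ p.
Proof.
move=> x0 y0 p0 p1.
have ip : 1 <= p^-1 by rewrite invf_ge1.
have := powR_superadditive (powR_ge0 x p) (powR_ge0 y p) ip.
rewrite -!powRrM mulfV ?gt_eqF// !powRr1// => h.
have -> : x `^ p + y `^ p = ((x `^ p + y `^ p) `^ p^-1) `^ p.
  by rewrite -powRrM mulVf ?gt_eqF// powRr1// addr_ge0 ?powR_ge0.
apply: ge0_ler_powR; rewrite ?nnegrE ?powR_ge0 ?(ltW p0)//.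
by rewrite addr_ge0.
Qed.

Lemma powR_sublinear (p e : R) : 0 < p -> p < 1 -> 0 < e ->
  exists C, forall x, 0 <= x -> x `^ p <= e * x + C.
Proof.
move=> p0 p1 e0; have q0 : 0 < 1 - p by lra.
(* The point where x^p meets the line e x. *)
pose X := e^-1 `^ (1 - p)^-1.
have X0 : 0 < X by rewrite powR_gt0// invr_gt0.
exists (X `^ p) => x x0; have [xX|Xx] := leP x X.
  apply: (@le_trans _ _ (X `^ p)); last by rewrite lerDr mulr_ge0// ltW.
  by apply: ge0_ler_powR; rewrite ?nnegrE ?(ltW p0) ?(ltW X0).
have {}x0 : 0 < x by apply: lt_trans Xx.
apply: (@le_trans _ _ (e * x)); last by rewrite lerDl powR_ge0.
have h : e^-1 <= x `^ (1 - p).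
  have -> : e^-1 = X `^ (1 - p) by rewrite /X -powRrM mulVf ?gt_eqF// powRr1// invr_ge0 ltW.
  by apply: ge0_ler_powR; rewrite ?nnegrE ?(ltW q0) ?(ltW X0) ?(ltW x0) ?(ltW Xx).
have E : x `^ p * x `^ (1 - p) = x.
  rewrite -powRD; last by apply/implyP => _; rewrite gt_eqF.
  have -> : p + (1 - p) = 1 by ring.
  by rewrite powRr1// ltW.
rewrite -{2}E mulrCA ler_peMr ?powR_ge0//.
by rewrite -ler_pdivrMl// mulr1.
Qed.

Lemma powR_natr_oo (p M : R) : 0 < p -> \forall n \near \oo, M <= (n%:R : R) `^ p.
Proof.
move=> p0; pose X := `|M| `^ p^-1.
have X0 : 0 <= X by exact: powR_ge0.
exists (Num.truncn X).+1 => // n /= hn.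
have /andP[_ h] := truncn_itv X0.
apply: (le_trans (ler_norm M)).
have -> : `|M| = X `^ p by rewrite /X -powRrM mulVf ?gt_eqF// powRr1 ?normr_ge0.
apply: ge0_ler_powR; rewrite ?nnegrE ?(ltW p0)//.
by apply: (le_trans (ltW h)); rewrite ler_nat.
Qed.

Lemma ln_natr_le (a e : R) : 0 < a -> 0 < e ->
  exists C, forall n, (0 < n)%N -> ln (n.+1%:R : R) <= e * (n%:R : R) `^ a + C.
Proof.
move=> a0 e0.
have a2 : 0 < a / 2 by lra.
pose K := 2 / a * 2 `^ (a / 2).
have K0 : 0 < K by rewrite mulr_gt0 ?powR_gt0 ?divr_gt0.
have [C hC] := @powR_sublinear (1 / 2) (e / K) ltac:(lra) ltac:(lra) (divr_gt0 e0 K0).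
exists (K * C) => n n0.
have n0' : 0 < n%:R :> R by rewrite ltr0n.
have n1 : 0 < n.+1%:R :> R by rewrite ltr0n.
have -> : ln (n.+1%:R : R) = 2 / a * ln (n.+1%:R `^ (a / 2)).
  by rewrite ln_powR; field; rewrite gt_eqF.
have h1 : ln (n.+1%:R `^ (a / 2)) <= (n.+1%:R : R) `^ (a / 2).
  by apply: ltW; apply: ln_sublinear; rewrite powR_gt0.
have h2 : (n.+1%:R : R) `^ (a / 2) <= 2 `^ (a / 2) * n%:R `^ (a / 2).
  rewrite -powRM ?ler0n//; apply: ge0_ler_powR; rewrite ?nnegrE ?(ltW a2) ?ler0n ?mulr_ge0//.
  by rewrite -natrM ler_nat; lia.
have h3 : (n%:R : R) `^ (a / 2) = (n%:R `^ a) `^ (1 / 2) by rewrite -powRrM; congr (_ `^ _); field.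
have h4 := hC (n%:R `^ a) (powR_ge0 _ _).
apply: (@le_trans _ _ (2 / a * (2 `^ (a / 2) * n%:R `^ (a / 2)))).
  by rewrite ler_pM2l ?divr_gt0//; apply: le_trans h2.
rewrite h3 mulrA -/K; apply: (@le_trans _ _ (K * (e / K * n%:R `^ a + C))).
  by rewrite ler_pM2l.
by rewrite mulrDr !mulrA [K * e]mulrC mulfK ?gt_eqF.
Qed.

Lemma powR_incr_vanish (p : R) (m : nat) (e : R) : 0 < e -> 0 < p ->
  \forall n \near \oo, ((n%:R : R) + m%:R) `^ p <= (1 + e) * n%:R `^ p.
Proof.
move=> e0 p0.
pose K := (m.+1%:R : R) `^ p * (p * m%:R) / e.
have K0 : 0 <= K by rewrite !mulr_ge0 ?powR_ge0 ?invr_ge0 ?ler0n// ltW.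
exists (Num.truncn K).+1 => // n /= hn.
have n0 : 0 < n%:R :> R by rewrite ltr0n (leq_trans _ hn).
have Kn : K <= n%:R.
  by have /andP[_ /ltW h] := truncn_itv K0; apply: (le_trans h); rewrite ler_nat.
have h1 := powR_incr_le n0 (ler0n R m) (ltW p0).
have h2 : (n%:R + m%:R) `^ p <= (m.+1%:R : R) `^ p * n%:R `^ p.
  rewrite -powRM ?ler0n//; apply: ge0_ler_powR; rewrite ?nnegrE ?(ltW p0) ?addr_ge0 ?mulr_ge0 ?ler0n//.
  rewrite -natrM -natrD ler_nat mulSn leq_add2l leq_pmulr//.
  by rewrite -(ltr0n R).
have P0 : 0 < (n%:R : R) `^ p by rewrite powR_gt0.
have h3 : (n%:R + m%:R) `^ p * (p * (m%:R / n%:R)) <= e * n%:R `^ p.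
  apply: (@le_trans _ _ ((m.+1%:R : R) `^ p * n%:R `^ p * (p * (m%:R / n%:R)))).
    by apply: ler_wpM2r => //; rewrite mulr_ge0 ?divr_ge0 ?ler0n// ltW.
  have -> : (m.+1%:R : R) `^ p * n%:R `^ p * (p * (m%:R / n%:R)) =
      (K / n%:R) * e * n%:R `^ p by rewrite /K; field; rewrite !gt_eqF.
  by rewrite ler_pM2r// ler_piMl ?(ltW e0)// ler_pdivrMr// mul1r.
lra.
Qed.

(** With P = n^a, this compares the upper bound (1 + t) P for one increment exponent with the lower
    bound (1 - t) P - C for the preceding one. *)
Lemma perturbed_ratio (t P N C : R) : 0 < t -> 8 * t <= 1 -> C <= N -> 0 <= N ->
  4 * N <= P * t -> 0 <= P -> (1 + t) * P <= (1 + 8 * t) * ((1 - t) * P - C).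
Proof.
move=> t0 t1 CN N0 hN P0.
have h8 : (1 + 8 * t) * C <= 2 * N by nra.
have : 0 <= (1 - 8 * t) * (t * P) by rewrite !mulr_ge0// ?(ltW t0)//; lra.
nra.
Qed.

(** * Increments of exp(n^a) *)

Section exponential_of_power.
Variable a : R.
Hypothesis a0 : 0 < a.

Definition exp_pow (n : nat) : R := expR ((n%:R : R) `^ a).
Definition exp_pow_log (n : nat) : R := ln (exp_pow n.+1 - exp_pow n).

Lemma exp_pow_lt n : exp_pow n < exp_pow n.+1.
Proof. by rewrite ltr_expR gt0_ltr_powR ?nnegrE ?ler0n// ltr_nat. Qed.

Lemma exp_powD n : exp_pow n.+1 - exp_pow n = expR (exp_pow_log n).
Proof. by rewrite lnK// posrE subr_gt0 exp_pow_lt. Qed.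

Lemma exp_pow_oo (M : R) : \forall n \near \oo, M <= exp_pow n.
Proof.
apply: filterS (powR_natr_oo M a0) => n h; apply: (le_trans h).
by apply: le_trans (expR_ge1Dx _); lra.
Qed.

Lemma exp_pow_log_le n : exp_pow_log n <= (n.+1%:R : R) `^ a.
Proof.
rewrite -ler_expR -exp_powD /exp_pow gerBl; exact: expR_ge0.
Qed.

(** From n to n + 1 the power n^a grows by at least a / (n + 1), even for a < 1. So the logarithm of
    the increment falls short of n^a by at most ln (n + 1) - ln a. *)
Lemma exp_pow_log_ge (e : R) : 0 < e ->
  exists C, forall n, (0 < n)%N -> (1 - e) * (n%:R : R) `^ a - C <= exp_pow_log n.
Proof.
move=> e0; have [C hC] := ln_natr_le a0 e0.
exists (C - ln a) => n n0.
have n0' : 0 < n%:R :> R by rewrite ltr0n.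
have n1 : 0 < n.+1%:R :> R by rewrite ltr0n.
have P1 : 1 <= (n%:R : R) `^ a by rewrite -[leLHS](powRr0 n%:R) ler_powR ?ler1n// ltW.
have D : a / n.+1%:R <= (n.+1%:R : R) `^ a - n%:R `^ a.
  have := powR_tangent_le a n1 n0'; have := ln_sub_le n0' n1.
  have -> : (n%:R - n.+1%:R : R) / n.+1%:R = - n.+1%:R^-1 by rewrite -natr1; field; rewrite gt_eqF// natr1.
  set i := n.+1%:R^-1; set x := ln n.+1%:R; set y := ln n%:R => h1 h2.
  have i0 : 0 < i by rewrite invr_gt0.
  have h3 : a * i <= a * (x - y) by rewrite ler_pM2l//; lra.
  have h4 : 0 <= a * i by rewrite mulr_ge0 ?ltW.
  set P := n%:R `^ a in P1 h2 *; nra.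
have D0 : 0 < a / n.+1%:R by rewrite divr_gt0.
have low : expR (n%:R `^ a + ln (a / n.+1%:R)) <= exp_pow n.+1 - exp_pow n.
  rewrite expRD lnK ?posrE// /exp_pow.
  have -> : (n.+1%:R : R) `^ a = n%:R `^ a + (n.+1%:R `^ a - n%:R `^ a) by ring.
  rewrite [expR (n%:R `^ a + _)]expRD.
  have := expR_ge1Dx (n.+1%:R `^ a - n%:R `^ a); move: D.
  set D := _ - n%:R `^ a; have := expR_gt0 (n%:R `^ a : R); set x := expR (_ `^ _).
  set y := expR D; set z := a / _ => x0 Dz yD.
  have -> : x * y - x = x * (y - 1) by ring.
  by rewrite ler_pM2l//; lra.
rewrite exp_powD ler_expR in low; apply: le_trans low.
rewrite ln_div ?posrE//; have := hC n n0; lra.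
Qed.

Lemma exp_pow_log_oo (M : R) : \forall n \near \oo, M <= exp_pow_log n.
Proof.
have [C hC] := @exp_pow_log_ge (1 / 2) ltac:(lra).
near=> n.
have n0 : (0 < n)%N by near: n; exists 1%N.
have h : 2 * (M + C) <= (n%:R : R) `^ a by near: n; exact: powR_natr_oo.
have := hC n n0; lra.
Unshelve. all: by end_near.
Qed.

Lemma exp_pow_log_ratio (e : R) : 0 < e ->
  \forall n \near \oo, exp_pow_log n.+1 <= (1 + e) * exp_pow_log n.
Proof.
move=> e0.
wlog e1 : e e0 / e <= 1.
  move=> wl; have m0 : 0 < Num.min e 1 by rewrite lt_min e0 ltr01.
  have h := wl (Num.min e 1) m0 ltac:(by rewrite ge_min lexx orbT).
  near=> n.
  have h1 : exp_pow_log n.+1 <= (1 + Num.min e 1) * exp_pow_log n by near: n.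
  have h2 : 0 <= exp_pow_log n by near: n; exact: (exp_pow_log_oo 0).
  apply: (le_trans h1); apply: ler_wpM2r => //.
  by rewrite lerD2l ge_min lexx.
pose t := e / 8; have t0 : 0 < t by rewrite /t; lra.
have [C hC] := exp_pow_log_ge t0.
near=> n.
have n0 : (0 < n)%N by near: n; exists 1%N.
have h1 : ((n%:R : R) + 2) `^ a <= (1 + t) * n%:R `^ a.
  by near: n; exact: (@powR_incr_vanish a 2 t t0 a0).
have h2 : 4 * `|C| / t <= (n%:R : R) `^ a by near: n; exact: powR_natr_oo.
have h3 := hC n n0.
have h4 := exp_pow_log_le n.+1.
have h5 : (n.+2%:R : R) = n%:R + 2 by rewrite -addn2 natrD.
rewrite h5 in h4.
rewrite ler_pdivrMr// in h2.
have h6 := ler_norm C.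
have e10 : 0 < 1 + e by exact: addr_gt0.
have h7 : (1 + e) * ((1 - t) * n%:R `^ a - C) <= (1 + e) * exp_pow_log n by rewrite ler_pM2l.
apply: (le_trans h4); apply: (le_trans h1); apply: le_trans h7.
have E : e = 8 * t by rewrite /t; field.
rewrite E in e1 *; exact: (perturbed_ratio t0 e1 h6 (normr_ge0 C) h2 (powR_ge0 _ _)).
Unshelve. all: by end_near.
Qed.

End exponential_of_power.
End power_growth.

(** * Dimension one *)

Section planting_schedule.
Context {R : realType}.
Variable eta : R.
Hypotheses (eta0 : 0 < eta) (eta1 : eta < 1).

Definition schedule (n : nat) : nat := Num.truncn ((n%:R : R) `^ eta).

Lemma schedule_itv n : (schedule n)%:R <= (n%:R : R) `^ eta < (schedule n)%:R + 1.
Proof. by rewrite natr1; apply: truncn_itv; exact: powR_ge0. Qed.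

Lemma schedule0 : schedule 0 = 0%N.
Proof. by rewrite /schedule powR0 ?gt_eqF// truncn0. Qed.

Lemma schedule1 : schedule 1 = 1%N.
Proof. by rewrite /schedule powR1 truncn1. Qed.

Lemma schedule_mono n m : (n <= m)%N -> (schedule n <= schedule m)%N.
Proof.
move=> nm; apply: le_truncn; apply: ge0_ler_powR; rewrite ?nnegrE ?ler0n ?(ltW eta0)//.
by rewrite ler_nat.
Qed.

(** Subadditivity of the power [eta] bounds the increase of n^eta by 1, so its integer part jumps by
    at most one. *)
Lemma schedule_step n : (schedule n.+1 <= (schedule n).+1)%N.
Proof.
rewrite -ltnS -(ltr_nat R).
have /andP[h1 _] := schedule_itv n.+1; have /andP[_ h2] := schedule_itv n.
apply: (le_lt_trans h1).
have := powR_subadditive (ler0n R n) ler01 eta0 (ltW eta1).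
rewrite powR1 natr1 -[(_.+2)%:R]natr1 -[(_.+1)%:R]natr1 => h3; lra.
Qed.

Lemma schedule_oo (B : nat) : \forall n \near \oo, (B <= schedule n)%N.
Proof.
near=> n.
have h : (B%:R : R) <= n%:R `^ eta by near: n; exact: powR_natr_oo.
have /andP[_ h2] := schedule_itv n.
by rewrite -ltnS -(ltr_nat R) -natr1; apply: le_lt_trans h2.
Unshelve. all: by end_near.
Qed.

Lemma schedule_le_half : exists C : R, forall n, n%:R <= 2 * (n - schedule n)%:R + C.
Proof.
have half : 0 < 1 / 2 :> R by lra.
have [C hC] := powR_sublinear eta0 eta1 half.
exists (2 * C) => n.
have /andP[h1 _] := schedule_itv n.
have h2 := hC n%:R (ler0n R n).
rewrite natrB; first lra.
exact: (plant_index_le schedule0 schedule_step).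
Qed.

Lemma schedule_complement_oo B : exists n, (B <= n - schedule n)%N.
Proof.
have [C hC] := schedule_le_half.
pose n := (Num.truncn `|2 * B%:R + C|).+1.
exists n; have /andP[_ h] := truncn_itv (normr_ge0 (2 * B%:R + C)).
rewrite -/n in h; have := hC n; have := ler_norm (2 * B%:R + C) => h1 h2.
by rewrite -(ler_nat R); lra.
Qed.

(** Up to the next jump n1^eta stays below schedule n + 1 <= n^eta + 1. Taking the power 1 / eta
    bounds [n1], and the increment of that power between n^eta and n^eta + 1 bounds the gap by
    O(n^(1 - eta)). *)
Lemma schedule_next n : schedule n.+1 = schedule n -> exists n1,
  [/\ (n < n1)%N, schedule n1.+1 != schedule n1, schedule n1 = schedule n,
   (n1%:R : R) <= 2 `^ eta^-1 * n%:R &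
   (n1 - n)%:R <= 2 `^ eta^-1 / eta * (n%:R : R) `^ (1 - eta)].
Proof.
move=> rn.
have n0 : (0 < n)%N by case: n rn => //; rewrite schedule0 schedule1.
have ex : exists k, (n < k)%N && (schedule k.+1 != schedule k).
  apply: contrapT => nex.
  have const k : (n < k)%N -> schedule k = schedule n.
    elim: k => [//|k IH]; rewrite ltnS leq_eqVlt => /orP[/eqP <-//|nk].
    rewrite -(IH nk); apply/eqP; apply/negPn/negP => h; apply: nex; exists k; by rewrite nk.
  have [N _ hN] := schedule_oo (schedule n).+1.
  have := hN (maxn N n.+1) (leq_maxl _ _); rewrite /= const ?ltnn//.
  by rewrite leq_maxr.
case: (ex_minnP ex) => n1 /andP[nn1 rn1] minn.
have const k : (n <= k)%N -> (k <= n1)%N -> schedule k = schedule n.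
  elim: k => [|k IH]; first by rewrite leqn0 => /eqP ->.
  rewrite leq_eqVlt => /orP[/eqP <-//|]; rewrite ltnS => nk kn1.
  have [->|nk'] := eqVneq k n; first by [].
  rewrite -(IH nk (ltnW kn1)); apply/eqP; apply/negPn/negP => h.
  have /minn : (n < k)%N && (schedule k.+1 != schedule k).
    by rewrite h andbT ltn_neqAle eq_sym nk' nk.
  by rewrite leqNgt kn1.
have rn1n := const n1 (ltnW nn1) (leqnn _).
exists n1; split => //; set y := (n%:R : R) `^ eta.
all: have n0' : 0 < n%:R :> R by rewrite ltr0n.
all: have y0 : 0 < y by rewrite powR_gt0.
all: have y1 : 1 <= y by rewrite -[leLHS](powRr0 n%:R) ler_powR ?ler1n// ltW.
all: have yK : y `^ eta^-1 = n%:R by rewrite /y -powRrM mulfV ?gt_eqF// powRr1.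
all: have ie0 : 0 < eta^-1 by rewrite invr_gt0.
all: have up : n1%:R <= (y + 1) `^ eta^-1.
1,3: have -> : (n1%:R : R) = (n1%:R `^ eta) `^ eta^-1 by rewrite -powRrM mulfV ?gt_eqF// powRr1.
1,2: apply: ge0_ler_powR; rewrite ?nnegrE ?(ltW ie0) ?powR_ge0//; first lra.
1,2: have /andP[_ h1] := schedule_itv n1; have /andP[h2 _] := schedule_itv n; rewrite rn1n in h1; rewrite /y; lra.
all: have y2 : (y + 1) `^ eta^-1 <= 2 `^ eta^-1 * n%:R.
1,3: rewrite -yK -powRM ?(ltW y0)//; apply: ge0_ler_powR; rewrite ?nnegrE ?(ltW ie0)//; lra.
  by apply: le_trans y2.
rewrite natrB; last exact: ltnW.
have h := powR_incr_le y0 ler01 (ltW ie0); rewrite yK in h.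
apply: (@le_trans _ _ ((y + 1) `^ eta^-1 * (eta^-1 * (1 / y)))); first lra.
have -> : 2 `^ eta^-1 / eta * (n%:R : R) `^ (1 - eta) = 2 `^ eta^-1 * n%:R * (eta^-1 * (1 / y)).
  rewrite powRB; last by apply/implyP => _; rewrite gt_eqF.
  by rewrite powRr1 ?(ltW n0')// -/y; field; rewrite !gt_eqF.
by apply: ler_wpM2r => //; rewrite mulr_ge0 ?divr_ge0// ltW.
Qed.

End planting_schedule.

Section planted_sums.
Context {R : realType}.

Lemma plant_sum (r : nat -> nat) (q e : nat -> nat) (F : nat -> R) n :
  r 0%N = 0%N -> (forall n, (r n <= r n.+1)%N) -> (forall n, (r n.+1 <= (r n).+1)%N) ->
  \sum_(k < n) F (plant r q e k) =
  \sum_(j < r n) F (q j) + \sum_(k < n - r n) F (e k).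
Proof.
move=> r0 rm rs; elim: n => [|n IH]; first by rewrite r0 !big_ord0 addr0.
rewrite big_ord_recr /= IH /plant; have [E|neq] := eqVneq (r n.+1) (r n).
  by rewrite (plant_index_eq r0 rs E) E big_ord_recr /= addrA.
have [E1 E2] := plant_index_neq rm rs neq.
by rewrite E2 E1 big_ord_recr /= addrAC.
Qed.

End planted_sums.

Section planted_digit_bounds.
Context {R : realType}.
Variables (b th : R).
Hypotheses (b1 : 1 < b) (th0 : 0 < th) (th1 : th < 1).

(** The letters planted produce growth exp(j^th) in their own counter j. As j is about n^eta,
    [th = al / eta] turns this into exp(n^al). *)
Definition planted_log := root_log b (@exp_pow_log R th).
Definition planted_digit j : nat := (Num.truncn (expR (planted_log j))).+1.

Lemma planted_log_le j : planted_log j <= (j.+1%:R : R) `^ (th / b).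
Proof.
have b1' := b1; have b0 : 0 < b by lra.
have th0' := th0.
rewrite /planted_log /root_log.
have [l0|l0] := ltP (exp_pow_log th j) 0.
  rewrite lt0_powR1// -[leLHS](powRr0 j.+1%:R) ler_powR ?ler1n//.
  by rewrite divr_ge0// ltW.
have -> : th / b = th * (1 / b) by rewrite div1r.
rewrite powRrM; apply: ge0_ler_powR; rewrite ?nnegrE ?powR_ge0 ?divr_ge0 ?(ltW b0)//.
exact: exp_pow_log_le.
Qed.

Lemma planted_digit_itv j :
  expR (planted_log j) <= (planted_digit j)%:R <= expR (planted_log j) + 1.
Proof.
have u1 : 1 <= expR (planted_log j) by rewrite -[leLHS]expR0 ler_expR root_log_ge0.
have /andP[h1 h2] := truncn_itv (le_trans ler01 u1).
by apply/andP; split; [exact: ltW|rewrite -natr1 lerD2r].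
Qed.

Lemma planted_digit_gt1 j : (1 < planted_digit j)%N.
Proof.
have u1 : 1 <= expR (planted_log j) by rewrite -[leLHS]expR0 ler_expR root_log_ge0.
by rewrite ltnS -(ltr0n R); have := truncn_ge_half u1; lra.
Qed.

Lemma planted_digit_growth :
  (fun n => (\sum_(k < n) expR (ln ((planted_digit k)%:R : R) `^ b)) / exp_pow th n) @ \oo --> (1 : R).
Proof.
apply: (@window_digits_growth _ b (@exp_pow_log R th) b1 _ (@exp_pow R th) 1) => //.
- by move=> M; exact: exp_pow_log_oo.
- by move=> M; exact: exp_pow_oo.
- by near=> n; exact: exp_powD.
- move=> n; have /andP[-> h /=] := planted_digit_itv n; apply: (le_trans h).
  rewrite mulrDr mulr1 mulrCA -expRD mulN1r subrr expR0; lra.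
Unshelve. all: by end_near.
Qed.

End planted_digit_bounds.

Section letter_cutoff.
Context {R : realType}.

(** Stretched exponential bounds are a compromise: fast enough to discard a set of small measure
    only, slow enough, for small [w], to contribute nothing to the growth and little to the cost. *)
Definition cutoff (w : R) (k0 k : nat) : nat := Num.truncn (expR (((k + k0)%:R : R) `^ w)).

Lemma cutoff_le w k0 k : (cutoff w k0 k)%:R <= expR (((k + k0)%:R : R) `^ w).
Proof. by have /andP[] := truncn_itv (expR_ge0 (((k + k0)%:R : R) `^ w)). Qed.

Lemma cutoff_ge_half w k0 k : expR (((k + k0)%:R : R) `^ w) / 2 <= (cutoff w k0 k)%:R.
Proof. by apply: truncn_ge_half; rewrite -[leLHS]expR0 ler_expR powR_ge0. Qed.

Lemma cutoff_gt0 w k0 k : (0 < cutoff w k0 k)%N.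
Proof.
rewrite -(ltr0n R); apply: lt_le_trans (cutoff_ge_half w k0 k).
by rewrite divr_gt0 ?expR_gt0.
Qed.

Lemma cutoff_mono w k0 k k' : 0 <= w -> (k <= k')%N -> (cutoff w k0 k <= cutoff w k0 k')%N.
Proof.
move=> w0 kk; apply: le_truncn; rewrite ler_expR.
by apply: ge0_ler_powR; rewrite ?nnegrE ?ler0n// ler_nat leq_add2r.
Qed.

Variables (d : R) (f : nat -> R -> R) (c : nat -> R).
Hypotheses (d1 : 1 < d) (hf : gauss_like_ifs d f) (hc : cells f c).

(** The tails decay like a stretched exponential, hence at least like (k + k0)^(-2); starting late
    enough pushes the total below 1/8. *)
Lemma cutoff_summable (w K : R) : 0 < w -> 0 < K -> exists2 k0, (0 < k0)%N &
  forall n, \sum_(k < n) K * (1 - c (cutoff w k0 k)) <= 1 / 8.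
Proof.
move=> w0 K0; have d1' := d1.
pose q := (d - 1) / 2; have q0 : 0 < q by rewrite /q; lra.
have q1 : q < d - 1 by rewrite /q; lra.
have [C C0 hC] := cell_tail_le hf hc q0 q1.
have E : d - 1 - q = q by rewrite /q; field.
rewrite E in hC.
(* Chosen so that x = y^w satisfies x^p = y^2. *)
pose p := 2 / w; have p0 : 0 < p by rewrite divr_gt0.
pose C3 := C * (2 `^ q * (p / q) `^ p).
have C30 : 0 < C3.
  by apply: (mulr_gt0 C0); apply: mulr_gt0; apply: powR_gt0 => //; exact: (divr_gt0 p0 q0).
pose v := (Num.truncn (8 * (K * C3))).+1.
exists v.+1 => // n.
have step k : 1 - c (cutoff w v.+1 k) <= C3 * ((k + v).+1%:R : R) `^ (- (1 + 1)).
  apply: (le_trans (hC _ (cutoff_gt0 _ _ _))).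
  rewrite /C3 -mulrA ler_pM2l//.
  have := cutoff_ge_half w v.+1 k; rewrite addnS.
  set y := ((k + v).+1%:R : R); set x := y `^ w => hx.
  have y0 : 0 < y by rewrite ltr0n.
  have x0 : 0 < x by rewrite powR_gt0.
  have ex0 : 0 < expR x / 2 by rewrite divr_gt0 ?expR_gt0.
  have h1 : (cutoff w v.+1 k)%:R `^ (- q) <= (expR x / 2) `^ (- q).
    rewrite !powRN lef_pV2 ?posrE ?powR_gt0//; last by rewrite ltr0n cutoff_gt0.
    by apply: ge0_ler_powR; rewrite ?nnegrE ?(ltW q0) ?ler0n ?(ltW ex0).
  apply: (le_trans h1).
  rewrite powRM ?expR_ge0 ?invr_ge0// -expRM -powR_inv1// -[(2 `^ (-1)) `^ _]powRrM mulN1r opprK.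
  rewrite mulrC -mulrA ler_pM2l ?powR_gt0//.
  have h2 := powR_le_expR p0 q0 (ltW x0).
  have h3 : x `^ p = (y `^ (- (1 + 1)))^-1.
    rewrite -powRN opprK /x -powRrM /p; congr (_ `^ _); field; by rewrite gt_eqF.
  rewrite h3 in h2.
  have P0 : 0 < y `^ (- (1 + 1)) by rewrite powR_gt0.
  have -> : expR (x * - q) = (expR (q * x))^-1 by rewrite -expRN; congr expR; ring.
  rewrite -(ler_pM2r (expR_gt0 (q * x))) mulVf ?gt_eqF ?expR_gt0//.
  rewrite -(ler_pM2l P0) mulfV ?gt_eqF// in h2.
  by apply: (le_trans h2); rewrite le_eqVlt; apply/orP; left; apply/eqP; ring.
apply: (@le_trans _ _ (\sum_(k < n) K * (C3 * ((k + v).+1%:R : R) `^ (- (1 + 1))))).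
  by apply: ler_sum => k _; rewrite ler_pM2l.
rewrite -(big_mkord xpredT (fun k => K * (C3 * ((k + v).+1%:R : R) `^ (- (1 + 1))))).
have -> : \sum_(0 <= k < n) K * (C3 * ((k + v).+1%:R : R) `^ (- (1 + 1))) =
    K * C3 * \sum_(v <= k < n + v) (k.+1%:R : R) `^ (- (1 + 1)).
  rewrite -[in RHS](add0n v) big_addn addnK mulr_sumr; apply: eq_bigr => k _.
  by rewrite mulrA.
have KC : 0 < K * C3 by rewrite mulr_gt0.
have h := @tail_sum_le R 1 v (n + v) ltr01 isT.
rewrite powR_inv1 ?ler0n// divr1 in h.
apply: (@le_trans _ _ (K * C3 * (v%:R)^-1)); first by rewrite ler_pM2l.
rewrite ler_pdivrMr ?ltr0n//.
have /andP[_ h2] : (Num.truncn (8 * (K * C3)))%:R <= 8 * (K * C3) < v%:R.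
  by apply: truncn_itv; rewrite mulr_ge0// ltW.
lra.
Qed.

End letter_cutoff.

Section planted_growth.
Context {R : realType}.
Variables (b al eta w : R) (k0 : nat).
Hypotheses (b1 : 1 < b) (al0 : 0 < al) (al1 : al < 1) (eta0 : 0 < eta) (eta1 : eta < 1)
  (aleta : al < eta) (w0 : 0 < w) (wb : w * b <= al / 2) (k00 : (0 < k0)%N).

Let th := al / eta.
Let th0 : 0 < th. Proof. by rewrite divr_gt0. Qed.
Let th1 : th < 1. Proof. by rewrite ltr_pdivrMr// mul1r. Qed.
Let r := @schedule R eta.

(** Rounding n^eta to an integer changes its power [th] by at most O(r^(th - 1)), which vanishes
    because [th < 1]; this is the role of [al < eta]. *)
Lemma exp_pow_schedule_cvg : (fun n => exp_pow th (r n) / exp_pow al n) @ \oo --> (1 : R).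
Proof.
have -> : (fun n => exp_pow th (r n) / exp_pow al n) =
    (fun n => expR (((r n)%:R : R) `^ th - (n%:R : R) `^ al)).
  by apply/funext => n; rewrite expRB.
rewrite -[X in _ --> X]expR0.
apply: (@cvg_comp _ _ _ (fun n => ((r n)%:R : R) `^ th - (n%:R : R) `^ al) expR \oo (nbhs (0 : R))); last exact: continuous_expR.
apply/cvgrPdist_le => e e0; have th0' := th0; have th1' := th1.
have e40 : 0 < e / 4 by lra.
have [C hC] := powR_sublinear th0 th1 e40.
pose B := (Num.truncn (2 * `|C| / e)).+1.
near=> n.
have rB : (B <= r n)%N by near: n; exact: schedule_oo.
have /andP[h1 h2] := schedule_itv eta n; rewrite -/(r n) in h1 h2.
have nal : (n%:R : R) `^ al = (n%:R `^ eta) `^ th.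
  by rewrite -powRrM /th; congr (_ `^ _); field; rewrite gt_eqF.
have rn1 : 1 <= (r n)%:R :> R by rewrite ler1n (leq_trans _ rB).
have rn0 : 0 < (r n)%:R :> R by lra.
have Bh : 2 * `|C| / e <= (r n)%:R.
  have /andP[_ /ltW h] : (Num.truncn (2 * `|C| / e))%:R <= 2 * `|C| / e < B%:R.
    by apply: truncn_itv; rewrite divr_ge0 ?mulr_ge0// ltW.
  by apply: (le_trans h); rewrite ler_nat.
rewrite nal sub0r normrN ler0_norm; last first.
  rewrite subr_le0; apply: ge0_ler_powR; rewrite ?nnegrE ?powR_ge0 ?(ltW th0)//; lra.
have h3 : (n%:R `^ eta) `^ th <= ((r n)%:R + 1) `^ th.
  apply: ge0_ler_powR; rewrite ?nnegrE ?powR_ge0 ?(ltW th0)//; lra.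
have h4 := powR_incr_le rn0 ler01 (ltW th0).
have h5 := hC ((r n)%:R + 1) ltac:(lra).
set P := ((r n)%:R + 1) `^ th in h3 h4 h5.
have P0 : 0 <= P by exact: powR_ge0.
have h6 : P * (th * (1 / (r n)%:R)) <= P / (r n)%:R.
  apply: ler_wpM2l => //; rewrite mul1r ler_piMl ?invr_ge0//; lra.
have h7 : P / (r n)%:R <= e.
  rewrite ler_pdivrMr//; rewrite ler_pdivrMr// in Bh.
  have := ler_norm C; nra.
lra.
Unshelve. all: by end_near.
Qed.

(** By [wb] each free letter contributes at most exp((n + k0)^(al / 2)), and n such terms are
    negligible against exp(n^al). *)
Lemma free_letters_cvg0 (e : nat -> nat) :
  (forall k, (0 < e k <= @cutoff R w k0 k)%N) ->
  (fun n => (\sum_(k < n - r n) expR (ln ((e k)%:R : R) `^ b)) / exp_pow al n) @ \oo --> (0 : R).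
Proof.
move=> he; apply/cvgrPdist_le => ep ep0.
have b0 : 0 < b by have := b1; lra.
have al0' := al0; have al1' := al1.
have q0 : 0 < 1 / 4 :> R by lra.
have half0 : 0 < 1 / 2 :> R by lra.
have half1 : 1 / 2 < 1 :> R by lra.
have [C1 hC1] := powR_sublinear half0 half1 q0.
have [C2 hC2] := ln_natr_le al0 q0.
pose C0 := C1 + C2 + (k0%:R : R) `^ (al / 2).
near=> n.
have n0 : (0 < n)%N by near: n; exists 1%N.
have big : 2 * (C0 - ln ep) <= (n%:R : R) `^ al by near: n; exact: powR_natr_oo.
have n0' : 0 < n%:R :> R by rewrite ltr0n.
have term k : (k < n - r n)%N -> expR (ln ((e k)%:R : R) `^ b) <= expR ((n%:R + k0%:R) `^ (al / 2)).
  move=> kn; have /andP[e0 eM] := he k; rewrite ler_expR.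
  have e0' : 0 < (e k)%:R :> R by rewrite ltr0n.
  have l1 : ln ((e k)%:R : R) <= ((k + k0)%:R : R) `^ w.
    rewrite -[leRHS]expRK ler_ln ?posrE ?expR_gt0//.
    by apply: le_trans (cutoff_le w k0 k); rewrite ler_nat.
  apply: (@le_trans _ _ ((((k + k0)%:R : R) `^ w) `^ b)).
    by apply: ge0_ler_powR; rewrite ?nnegrE ?powR_ge0 ?(ltW b0)// ln_ge0// ler1n.
  rewrite -powRrM; apply: (@le_trans _ _ (((k + k0)%:R : R) `^ (al / 2))).
    by apply: ler_powR => //; rewrite ler1n addn_gt0 k00 orbT.
  apply: ge0_ler_powR; rewrite ?nnegrE ?ler0n ?addr_ge0 ?ler0n//; first lra.
  rewrite -natrD ler_nat leq_add2r; apply: leq_trans (ltnW kn) _; exact: leq_subr.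
have sum_le : \sum_(k < n - r n) expR (ln ((e k)%:R : R) `^ b) <=
    n.+1%:R * expR ((n%:R + k0%:R) `^ (al / 2)).
  apply: (@le_trans _ _ (\sum_(k < n - r n) expR ((n%:R + k0%:R) `^ (al / 2)))).
    by apply: ler_sum => k _; exact: term.
  rewrite sumr_const card_ord -[leLHS]mulr_natl ler_pM2r ?expR_gt0// ler_nat.
  by apply: leq_trans (leq_subr _ _) _.
rewrite sub0r normrN ger0_norm; last first.
  by rewrite divr_ge0 ?expR_ge0// sumr_ge0// => k _; exact: expR_ge0.
rewrite ler_pdivrMr; last exact: expR_gt0.
apply: (le_trans sum_le).
have -> : n.+1%:R = expR (ln n.+1%:R) :> R by rewrite lnK// posrE ltr0n.
have -> : ep = expR (ln ep) by rewrite lnK.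
rewrite -!expRD ler_expR.
have h1 := hC2 n n0.
have h2 : (n%:R + k0%:R) `^ (al / 2) <= n%:R `^ (al / 2) + (k0%:R : R) `^ (al / 2).
  by apply: powR_subadditive; rewrite ?ler0n//; lra.
have h3 := hC1 (n%:R `^ al) (powR_ge0 _ _).
have h4 : (n%:R : R) `^ (al / 2) = (n%:R `^ al) `^ (1 / 2).
  by rewrite -powRrM; congr (_ `^ _); field.
rewrite -h4 in h3.
move: big h1 h2 h3; rewrite /C0; set P := n%:R `^ al; lra.
Unshelve. all: by end_near.
Qed.

Lemma planted_growth (e : nat -> nat) :
  (forall k, (0 < e k <= @cutoff R w k0 k)%N) ->
  (fun n => (\sum_(k < n) expR (ln ((plant r (@planted_digit R b th) e k)%:R : R) `^ b)) /
     exp_pow al n) @ \oo --> (1 : R).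
Proof.
move=> he.
have rs := schedule_step eta0 eta1; have r0 := schedule0 eta0.
have rm n : (r n <= r n.+1)%N by exact: (schedule_mono eta0 (leqnSn n)).
pose Q n := (\sum_(k < n) expR (ln ((@planted_digit R b th k)%:R : R) `^ b)) / exp_pow th n.
have cr : r @ \oo --> \oo.
  by apply/cvgnyPge => B; exact: schedule_oo.
have cQ : Q (r n) @[n --> \oo] --> (1 : R).
  have h : Q @ \oo --> (1 : R) by exact: planted_digit_growth.
  exact: (cvg_comp r Q cr h).
have c1 : (fun n => Q (r n) * (exp_pow th (r n) / exp_pow al n)) @ \oo --> (1 * 1 : R).
  by apply: cvgM; [exact: cQ|exact: exp_pow_schedule_cvg].
have c2 : (fun n => Q (r n) * (exp_pow th (r n) / exp_pow al n) +
    (\sum_(k < n - r n) expR (ln ((e k)%:R : R) `^ b)) / exp_pow al n) @ \oo --> (1 * 1 + 0 : R).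
  by apply: cvgD; [exact: c1|exact: free_letters_cvg0].
rewrite mulr1 addr0 in c2.
apply: cvg_trans c2; apply: near_eq_cvg; near=> n.
rewrite (plant_sum (planted_digit b th) e (fun i => expR (ln ((i%:R) : R) `^ b)) n r0 rm rs) /=.
have p1 : exp_pow th (r n) != 0 by rewrite gt_eqF// expR_gt0.
have p2 : exp_pow al n != 0 by rewrite gt_eqF// expR_gt0.
rewrite /Q; set u := exp_pow th (r n) in p1 *; set v := exp_pow al n in p2 *.
rewrite mulrA divfK; last exact: p1.
by rewrite mulrDl.
Unshelve. all: by end_near.
Qed.

End planted_growth.

(** * Sublinear cost of planting *)

Section planted_cost.
Context {R : realType}.
Variables (b al eta w d K1 K3 K5 : R) (k0 : nat) (W : nat -> R).
Hypotheses (b1 : 1 < b) (al0 : 0 < al) (eta0 : 0 < eta) (eta1 : eta < 1)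
  (aleta : al < eta) (etab : eta + al / b < 1) (w0 : 0 < w) (weta : w <= eta / 2).
Hypotheses (K10 : 0 < K1) (K30 : 0 < K3) (K50 : 0 < K5) (d1 : 1 < d).
Hypothesis W_ge : forall i, (0 < i)%N -> K1 * (i%:R : R) `^ (- (d + 1)) <= W i.

Let th := al / eta.
Let th0 : 0 < th. Proof. by rewrite divr_gt0. Qed.
Let th1 : th < 1. Proof. by rewrite ltr_pdivrMr// mul1r. Qed.
Let r := @schedule R eta.
Let q := @planted_digit R b th.
Let M := @cutoff R w k0.

Let W_ge_expR (i : nat) (x : R) : (0 < i)%N -> (i%:R : R) <= expR x ->
  expR (ln K1 - (d + 1) * x) <= W i.
Proof.
move=> i0 ix; apply: le_trans (W_ge i0).
have i0' : 0 < i%:R :> R by rewrite ltr0n.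
rewrite expRD lnK ?posrE// ler_pM2l// powR_expR// ler_expR mulNr lerN2.
have d1' := d1; rewrite ler_pM2l; last lra.
by rewrite -[leRHS]expRK ler_ln ?posrE ?expR_gt0.
Qed.

(** About n^eta planted letters, each with logarithm at most n^(al / b), cost at most a multiple of
    n^(eta + al / b) apart from constants per letter. *)
Lemma planted_product_ge n :
  expR (- ((`|ln (K5 * K1)| + (d + 1) * ln 2) * (n%:R : R) `^ eta +
    (d + 1) * (n%:R `^ eta * n%:R `^ (al / b)))) <=
  \prod_(j < r n) (K5 * W (q j)).
Proof.
have b0 : 0 < b by have := b1; lra.
have thb0 : 0 < th / b by rewrite divr_gt0.
have d1' := d1.
pose B := `|ln (K5 * K1)| + (d + 1) * ln 2 + (d + 1) * n%:R `^ (al / b).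
have ln20 : 0 <= ln (2 : R) by rewrite ln_ge0// ler1n.
have B0 : 0 <= B by rewrite !addr_ge0 ?mulr_ge0 ?powR_ge0//; lra.
have /andP[h1 _] := schedule_itv eta n; rewrite -/(r n) in h1.
apply: (@le_trans _ _ (\prod_(j < r n) expR (- B))); last first.
  apply: ler_prod => j _; rewrite expR_ge0 /=.
  have qj : (q j)%:R <= expR (ln 2 + planted_log b th j).
    have /andP[h2 h3] := planted_digit_itv b th j; apply: (le_trans h3).
    rewrite expRD lnK ?posrE//.
    have : 1 <= expR (planted_log b th j) by rewrite -[leLHS]expR0 ler_expR root_log_ge0.
    lra.
  have q0 : (0 < q j)%N by [].
  have h := W_ge_expR q0 qj; rewrite -(ler_pM2l K50) in h; apply: le_trans h.
  have -> : K5 * expR (ln K1 - (d + 1) * (ln 2 + planted_log b th j)) =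
      expR (ln (K5 * K1) - (d + 1) * (ln 2 + planted_log b th j)).
    by rewrite lnM ?posrE// -addrA [in RHS]expRD lnK.
  rewrite ler_expR.
  have h4 : planted_log b th j <= n%:R `^ (al / b).
    apply: (le_trans (planted_log_le b1 th0 j)).
    have -> : n%:R `^ (al / b) = (n%:R `^ eta) `^ (th / b).
      by rewrite -powRrM; congr (_ `^ _); rewrite /th; field; rewrite !gt_eqF.
    apply: ge0_ler_powR; rewrite ?nnegrE ?powR_ge0 ?(ltW thb0)//.
    by apply: le_trans h1; rewrite ler_nat.
  have h5 : (d + 1) * planted_log b th j <= (d + 1) * n%:R `^ (al / b) by rewrite ler_pM2l//; lra.
  have := ler_norm (- ln (K5 * K1)); rewrite normrN /B; lra.
rewrite prodr_const card_ord -expRM_natl ler_expR.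
have h6 : (r n)%:R * B <= n%:R `^ eta * B by rewrite ler_wpM2r.
have : n%:R `^ eta * B = (`|ln (K5 * K1)| + (d + 1) * ln 2) * n%:R `^ eta +
  (d + 1) * (n%:R `^ eta * n%:R `^ (al / b)) by rewrite /B; ring.
lra.
Qed.

Lemma cushion_ge n :
  expR (ln K1 - (d + 1) * (ln 3 + (n%:R `^ eta + 1))) <= Num.min (W 1%N) (W (q (r n)).+1).
Proof.
have b0 : 0 < b by have := b1; lra.
have b1' := b1; have th1' := th1.
have ln30 : 0 <= ln (3 : R) by rewrite ln_ge0// ler1n.
have x0 := powR_ge0 (n%:R : R) eta.
rewrite le_min; apply/andP; split; apply: W_ge_expR => //.
  by rewrite -[leLHS]expR0 ler_expR; lra.
have /andP[h1 _] := schedule_itv eta n; rewrite -/(r n) in h1.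
have /andP[h2 h3] := planted_digit_itv b th (r n).
have h4 : planted_log b th (r n) <= n%:R `^ eta + 1.
  apply: (le_trans (planted_log_le b1 th0 _)).
  apply: (@le_trans _ _ ((r n).+1%:R)); last by rewrite -natr1 lerD2r.
  rewrite -[leRHS]powRr1 ?ler0n//; apply: ler_powR; first by rewrite ler1n.
  by rewrite ler_pdivrMr// mul1r; lra.
have : 1 <= expR (planted_log b th (r n)) by rewrite -[leLHS]expR0 ler_expR root_log_ge0.
rewrite expRD lnK ?posrE// -natr1 => h5.
have : expR (planted_log b th (r n)) <= expR (n%:R `^ eta + 1) by rewrite ler_expR.
rewrite /q; lra.
Qed.

(** The O(n^(1 - eta)) free letters before the next planted one have logarithms of order n^w plus a
    constant, for a cost of order n^(1 - eta + w). *)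
Lemma gap_ge (n n1 : nat) : (0 < n)%N ->
  (n1%:R : R) <= 2 `^ eta^-1 * n%:R ->
  (n1 - n)%:R <= 2 `^ eta^-1 / eta * (n%:R : R) `^ (1 - eta) ->
  expR (- (2 `^ eta^-1 / eta * (`|ln (K3 * K1)| + (d + 1) * (k0%:R : R) `^ w) * n%:R `^ (1 - eta) +
     2 `^ eta^-1 / eta * ((d + 1) * (2 `^ eta^-1) `^ w) * (n%:R `^ (1 - eta) * n%:R `^ w))) <=
  (K3 * (K1 * ((M n1)%:R : R) `^ (- (d + 1)))) ^+ (n1 - n).
Proof.
move=> n0 hn1 hg; have d1' := d1.
have w0' := w0; have weta' := weta; have eta1' := eta1.
set Cg := 2 `^ eta^-1 in hn1 hg *.
have Cg0 : 0 < Cg by rewrite powR_gt0.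
pose B := `|ln (K3 * K1)| + (d + 1) * (k0%:R : R) `^ w + (d + 1) * (Cg `^ w * n%:R `^ w).
have B0 : 0 <= B by rewrite !addr_ge0 ?mulr_ge0 ?powR_ge0//; lra.
have base : expR (- B) <= K3 * (K1 * ((M n1)%:R : R) `^ (- (d + 1))).
  have M0 : 0 < (M n1)%:R :> R by rewrite ltr0n cutoff_gt0.
  have -> : K3 * (K1 * ((M n1)%:R : R) `^ (- (d + 1))) = expR (ln (K3 * K1) - (d + 1) * ln (M n1)%:R).
    by rewrite expRD lnK ?posrE ?mulr_gt0// powR_expR// mulNr mulrA.
  rewrite ler_expR.
  have l1 : ln ((M n1)%:R : R) <= ((n1 + k0)%:R : R) `^ w.
    by rewrite -[leRHS]expRK ler_ln ?posrE ?expR_gt0//; exact: cutoff_le.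
  have l2 : ((n1 + k0)%:R : R) `^ w <= n1%:R `^ w + k0%:R `^ w.
    by rewrite natrD; apply: powR_subadditive => //; lra.
  have l3 : (n1%:R : R) `^ w <= Cg `^ w * n%:R `^ w.
    rewrite -powRM ?(ltW Cg0)//; apply: ge0_ler_powR; rewrite ?nnegrE ?(ltW w0)//.
    by rewrite mulr_ge0// ltW.
  have l4 : (d + 1) * ln ((M n1)%:R : R) <= (d + 1) * (Cg `^ w * n%:R `^ w + k0%:R `^ w).
    by rewrite ler_pM2l//; lra.
  by have := ler_norm (- ln (K3 * K1)); rewrite normrN /B; lra.
apply: (@le_trans _ _ (expR (- B) ^+ (n1 - n))); last first.
  by apply: lerXn2r; rewrite ?nnegrE ?expR_ge0//; apply: le_trans base; exact: expR_ge0.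
rewrite -expRM_natl ler_expR.
have h : (n1 - n)%:R * B <= Cg / eta * n%:R `^ (1 - eta) * B by rewrite ler_wpM2r.
have : Cg / eta * n%:R `^ (1 - eta) * B =
  Cg / eta * (`|ln (K3 * K1)| + (d + 1) * (k0%:R : R) `^ w) * n%:R `^ (1 - eta) +
     Cg / eta * ((d + 1) * Cg `^ w) * (n%:R `^ (1 - eta) * n%:R `^ w) by rewrite /B; ring.
lra.
Qed.

(** All costs are multiples of powers of n with exponents eta, eta + al / b, 1 - eta and 1 - eta +
    w, each below 1 by [eta1], [etab], [eta0] and [weta]. *)
Lemma planted_cost : exists E : nat -> R,
  (forall n, r n.+1 = r n -> exists n1, [/\ (n < n1)%N, r n1.+1 != r n1, r n1 = r n &
     expR (- E n) <= K3 * Num.min (W 1%N) (W (q (r n)).+1) *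
       (\prod_(j < r n) (K5 * W (q j))) *
       (K3 * (K1 * ((M n1)%:R : R) `^ (- (d + 1)))) ^+ (n1 - n)]) /\
  (forall e : R, 0 < e -> exists C, forall n, E n <= e * (n - r n)%:R + C).
Proof.
have d1' := d1; have b0 : 0 < b by have := b1; lra.
have w0' := w0; have weta' := weta; have eta1' := eta1; have eta0' := eta0.
have alb0 : 0 < al / b by rewrite divr_gt0.
have etab' := etab.
pose a1 : R := - (ln K3 + (ln K1 - (d + 1) * (ln 3 + 1))).
pose a2 := (d + 1) + (`|ln (K5 * K1)| + (d + 1) * ln 2).
pose a3 := 2 `^ eta^-1 / eta * (`|ln (K3 * K1)| + (d + 1) * (k0%:R : R) `^ w).
pose a4 := 2 `^ eta^-1 / eta * ((d + 1) * (2 `^ eta^-1) `^ w).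
exists (fun n => a1 + a2 * (n%:R : R) `^ eta + (d + 1) * n%:R `^ (eta + al / b) +
  a3 * n%:R `^ (1 - eta) + a4 * n%:R `^ (1 - eta + w)); split.
  move=> n rn; have n0 : (0 < n)%N.
    by case: n rn => //; rewrite /r schedule0// schedule1.
  have n0' : n%:R != 0 :> R by rewrite pnatr_eq0 -lt0n.
  have [n1 [nn1 rn1 rn1n h1 h2]] := schedule_next eta0 rn.
  exists n1; split=> //.
  have g := gap_ge n0 h1 h2; have cu := cushion_ge n; have p := planted_product_ge n.
  have -> : (n%:R : R) `^ (eta + al / b) = n%:R `^ eta * n%:R `^ (al / b).
    by apply: powRD; apply/implyP.
  have -> : (n%:R : R) `^ (1 - eta + w) = n%:R `^ (1 - eta) * n%:R `^ w.
    by apply: powRD; apply/implyP.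
  apply: (@le_trans _ _ (K3 * expR (ln K1 - (d + 1) * (ln 3 + (n%:R `^ eta + 1))) *
    expR (- ((`|ln (K5 * K1)| + (d + 1) * ln 2) * (n%:R : R) `^ eta +
    (d + 1) * (n%:R `^ eta * n%:R `^ (al / b)))) *
    expR (- (a3 * n%:R `^ (1 - eta) + a4 * (n%:R `^ (1 - eta) * n%:R `^ w))))); last first.
    apply: ler_pM => //; rewrite ?mulr_ge0 ?expR_ge0 ?(ltW K30)//.
    apply: ler_pM => //; rewrite ?mulr_ge0 ?expR_ge0 ?(ltW K30)//.
    by rewrite ler_pM2l.
  have -> : K3 = expR (ln K3) by rewrite lnK.
  rewrite -!expRD ler_expR le_eqVlt; apply/orP; left; apply/eqP.
  rewrite /a1 /a2; ring.
have a20 : 0 <= a2.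
  have : 0 <= ln (2 : R) by rewrite ln_ge0// ler1n.
  move=> ln2; rewrite /a2 !addr_ge0 ?mulr_ge0//; lra.
have Cg0 : 0 <= 2 `^ eta^-1 / eta by rewrite divr_ge0 ?powR_ge0// ltW.
have a30 : 0 <= a3 by rewrite !mulr_ge0 ?addr_ge0 ?mulr_ge0 ?powR_ge0 ?invr_ge0 ?(ltW eta0)//; lra.
have a40 : 0 <= a4 by rewrite !mulr_ge0 ?powR_ge0 ?invr_ge0 ?(ltW eta0)//; lra.
have sub (p a : R) (e : R) : 0 < p -> p < 1 -> 0 <= a -> 0 < e ->
    exists C, forall n : nat, a * (n%:R : R) `^ p <= e * n%:R + C.
  move=> p0 p1 a0 e0.
  have e1 : 0 < e / (a + 1) by rewrite divr_gt0// ltr_wpDl.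
  have [C hC] := powR_sublinear p0 p1 e1.
  exists (a * C) => n; have h := ler_wpM2l a0 (hC n%:R (ler0n R n)).
  apply: (le_trans h); rewrite mulrDr lerD2r mulrA; apply: ler_wpM2r; first exact: ler0n.
  rewrite mulrCA ler_piMr ?(ltW e0)// ler_pdivrMr ?mul1r; lra.
move=> e e0.
(* The four powers together give e / 2 * n, and n is at most twice the number of free letters plus a
   constant. *)
have e8 : 0 < e / 8 by lra.
have [C1 h1] := sub eta a2 _ eta0 eta1 a20 e8.
have [C2 h2] := sub (eta + al / b) (d + 1) (e / 8) ltac:(lra) ltac:(lra) ltac:(lra) e8.
have [C3 h3] := sub (1 - eta) a3 (e / 8) ltac:(lra) ltac:(lra) a30 e8.
have [C4 h4] := sub (1 - eta + w) a4 (e / 8) ltac:(lra) ltac:(lra) a40 e8.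
have [C5 h5] := schedule_le_half eta0 eta1.
exists (a1 + C1 + C2 + C3 + C4 + e / 2 * C5) => n.
have h6 : e / 2 * n%:R <= e / 2 * (2 * (n - r n)%:R + C5) by rewrite ler_pM2l//; lra.
have := h1 n; have := h2 n; have := h3 n; have := h4 n; lra.
Qed.

End planted_cost.

Section full_dimension.
Context {R : realType}.

Lemma full_dimension_not_snull (d b al s : R) (f : nat -> R -> R) (phi : R -> R) :
  1 < d -> gauss_like_ifs d f -> 1 < b ->
  (forall j : nat, (0 < j)%N -> potential_value f phi j = expR (ln (j%:R : R) `^ b)) ->
  bounded_distortion f -> 0 < al -> al < b / (b + 1) -> 0 < s -> s < 1 ->
  ~ snull s (birkhoff_growth_set f phi (fun n => expR ((n%:R : R) `^ al))).
Proof.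
move=> d1 hf b1 hval bd al0 alb s0 s1.
have b0 : 0 < b by lra.
have {}alb : al + al / b < 1.
  rewrite ltr_pdivlMr in alb; last lra.
  have -> : al + al / b = al * (b + 1) / b by field; rewrite gt_eqF.
  by rewrite ltr_pdivrMr// mul1r.
have x0 : 0 < al / b by rewrite divr_gt0.
(* The midpoint between [al], needed for the growth, and 1 - al / b, needed for the cost. *)
pose eta := (al + 1 - al / b) / 2.
have eta0 : 0 < eta by rewrite /eta; lra.
have eta1 : eta < 1 by rewrite /eta; lra.
have aleta : al < eta by rewrite /eta; lra.
have etab : eta + al / b < 1 by rewrite /eta; lra.
have al1 : al < 1 by lra.
(* The first bound keeps the cost of the gaps sublinear, the second the contribution of the free
   letters negligible. *)
pose w := Num.min (eta / 2) (al / (2 * b)).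
have b20 : 0 < 2 * b by lra.
have w0 : 0 < w by rewrite /w lt_min; apply/andP; split; [lra|rewrite divr_gt0].
have weta : w <= eta / 2 by rewrite /w ge_min lexx.
have wb : w * b <= al / 2.
  have : w <= al / (2 * b) by rewrite /w ge_min lexx orbT.
  by rewrite ler_pdivlMr// => h; lra.
clearbody w.
have [c hc] := ifs_cells hf.
have [K3 [K4 [K30 K40 dis]]] := wlen_distortion hf bd.
have [K1 [K2 [K10 K20 Hlen]]] := cell_length_bounds hf hc ltr01.
have W_ge i : (0 < i)%N -> K1 * (i%:R : R) `^ (- (d + 1)) <= wlen f [:: i].
  by case: i => [//|i] _; rewrite (wlen1 hf hc); have /andP[] := Hlen i.
have [k0 k00 Msum] := cutoff_summable d1 hf hc w0 K40.
have K50 : 0 < K3 ^+ 2 / K4 by rewrite divr_gt0// exprn_gt0.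
have [E [Enext Esub]] := @planted_cost R b al eta w d K1 K3 (K3 ^+ 2 / K4) k0
  (fun i => wlen f [:: i]) b1 al0 eta0 eta1 aleta etab w0 weta K10 K30 K50 d1 W_ge.
have th0 : 0 < al / eta by rewrite divr_gt0.
have rm n : (@schedule R eta n <= @schedule R eta n.+1)%N by exact: (schedule_mono eta0 (leqnSn n)).
apply: (@planted_not_snull R d f c hf hc K3 K4 K30 K40 dis (@schedule R eta)
  (schedule0 eta0) rm (schedule_step eta0 eta1) s K1 _ (@planted_digit R b (al / eta))
  (@cutoff R w k0) E s0 s1 K10 W_ge _ (schedule_complement_oo eta0 eta1) _ _ Msum _ Enext Esub).
- by lra.
- by move=> k; exact: planted_digit_gt1.
- by move=> k k'; apply: cutoff_mono; exact: ltW.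
- move=> e x he ex; split.
    apply: (expansion_gt0_lt1 hc ex).
    by rewrite /plant schedule1 (schedule0 eta0) /=; exact: planted_digit_gt1.
  exists (plant (@schedule R eta) (@planted_digit R b (al / eta)) e); split=> //.
  have -> : (fun n => birkhoff_sum f phi (plant (@schedule R eta) (@planted_digit R b (al / eta)) e) n / expR ((n%:R : R) `^ al)) =
      (fun n => (\sum_(k < n) expR (ln ((plant (@schedule R eta) (@planted_digit R b (al / eta)) e k)%:R : R) `^ b)) / exp_pow al n).
    by apply/funext => n; rewrite (birkhoff_sumE n hval)//; case: ex.
  exact: (planted_growth b1 al0 al1 eta0 eta1 aleta wb k00 he).
Qed.

End full_dimension.

Lemma half_bounds (n N : nat) : (n.*2.+1 <= N)%N -> (3 <= N)%N ->
  [/\ (n <= N./2)%N, (N./2 <= N)%N, (N./2 * 2 <= N)%N & (N <= N./2 * 3)%N].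
Proof. by move=> h1 h2; split; lia. Qed.

(** * Digits of points with prescribed growth *)

Section digits_of_growth_sets.
Context {R : realType}.

(** A ten percent pinch survives taking differences when Phi at least doubles: 18/10 - 11/10 >=
    1/2. *)
Lemma increment_ge_half (P P' S F : R) : 0 <= P -> S <= 11 / 10 * P ->
  9 / 10 * P' <= S + F -> 2 * P <= P' -> P <= F * 2.
Proof. by move=> *; lra. Qed.

Variables (b : R) (a : nat -> nat).
Hypotheses (b1 : 1 < b) (a0 : forall k, (0 < a k)%N).

Variables F S : nat -> R.
Hypotheses (FE : forall k, F k = expR (ln ((a k)%:R : R) `^ b))
  (SS : forall n, S n.+1 = S n + F n).

Let ln_ge n : 0 <= ln ((a n)%:R : R). Proof. by rewrite ln_ge0// ler1n. Qed.

Lemma cvg1_pinch (T Phi : nat -> R) : (forall n, 0 < Phi n) ->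
  (fun n => T n / Phi n) @ \oo --> (1 : R) ->
  \forall n \near \oo, 9 / 10 * Phi n <= T n <= 11 / 10 * Phi n.
Proof.
move=> P0 /cvgrPdist_le /(_ (1 / 10)) h.
have {h} : \forall n \near \oo, `|1 - T n / Phi n| <= 1 / 10 by apply: h; lra.
apply: filterS => n; rewrite ler_norml => /andP[h1 h2].
have Pn := P0 n.
by apply/andP; split; [rewrite -ler_pdivlMr//; lra|rewrite -ler_pdivrMr//; lra].
Qed.

Lemma ln_digit_ge (c x : R) k : 0 <= c -> c `^ b <= x -> expR x <= F k -> c <= ln ((a k)%:R : R).
Proof.
move=> c0 cx; rewrite FE ler_expR => xF.
have b0 : 0 < b by have := b1; lra.
rewrite leNgt; apply/negP => h.
have : ln ((a k)%:R : R) `^ b < c `^ b by apply: gt0_ltr_powR; rewrite ?nnegrE.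
by rewrite ltNge (le_trans cx xF).
Qed.

Lemma log_mean_of_digits_oo (L : R) :
  (forall c : R, \forall k \near \oo, c <= ln ((a k)%:R : R)) ->
  exists N0, forall N, (N0 <= N)%N -> L * N%:R <= \sum_(k < N) ln ((a k)%:R : R).
Proof.
move=> aoo; have [n0 _ hn0] := aoo (2 * `|L|).
have L0 := normr_ge0 L.
have key n : (n0 <= n)%N -> 2 * `|L| * (n%:R - n0%:R) <= \sum_(k < n) ln ((a k)%:R : R).
  elim: n => [|n IH].
    by rewrite leqn0 => /eqP ->; rewrite big_ord0 subrr mulr0.
  rewrite leq_eqVlt => /orP[/eqP ->|].
    by rewrite subrr mulr0 sumr_ge0.
  rewrite ltnS => nn; rewrite big_ord_recr /= -natr1.
  by have := hn0 n nn; have := IH nn => /=; lra.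
exists (2 * n0)%N => N hN.
have nN : (n0 <= N)%N by lia.
apply: le_trans (key N nN).
have : (2 * n0)%:R <= N%:R :> R by rewrite ler_nat.
rewrite natrM => h; have h2 := ler_norm L; have N0 := ler0n R N.
have h3 : L * N%:R <= `|L| * N%:R by rewrite ler_wpM2r.
apply: (le_trans h3).
have : `|L| * (2 * n0%:R) <= `|L| * N%:R by rewrite ler_wpM2l.
lra.
Qed.

(** For al >= 1 the function exp(n^al) at least doubles at every step, so each single term must be
    comparable with the whole sum before it. *)
Lemma digits_oo_of_growth (al : R) : 1 <= al ->
  (fun n => S n / exp_pow al n) @ \oo --> (1 : R) ->
  forall c : R, \forall k \near \oo, c <= ln ((a k)%:R : R).
Proof.
move=> al1 hS c.
have al0 : 0 < al by lra.
have [n0 _ hp] := cvg1_pinch (fun n => expR_gt0 _) hS.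
have {}hp n : (n0 <= n)%N -> 9 / 10 * exp_pow al n <= S n <= 11 / 10 * exp_pow al n := hp n.
have e2 : 2 <= expR 1 :> R by have := expR_ge1Dx (1 : R); lra.
near=> n.
apply: (le_trans (ler_norm c)).
apply: (@ln_digit_ge `|c| (n%:R `^ al - 1)) => //.
  have : `|c| `^ b + 1 <= (n%:R : R) `^ al by near: n; exact: powR_natr_oo.
  lra.
have nn0 : (n0 <= n)%N by near: n; exists n0.
have /andP[h1 h2] := hp n nn0; have /andP[h3 h4] := hp n.+1 (leqW nn0).
have h5 : 2 * exp_pow al n <= exp_pow al n.+1.
  apply: (@le_trans _ _ (expR 1 * exp_pow al n)); first by rewrite ler_pM2r ?expR_gt0.
  rewrite /exp_pow -expRD ler_expR addrC.
  by have := powR_superadditive (ler0n R n) ler01 al1; rewrite powR1 natr1.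
rewrite SS in h3; rewrite expRB.
have P0 := expR_gt0 ((n%:R : R) `^ al).
rewrite ler_pdivrMr ?expR_gt0//.
have F0 : 0 < F n by rewrite FE expR_gt0.
apply: (le_trans (increment_ge_half (ltW P0) h2 h3 h5)).
by rewrite ler_pM2l.
Unshelve. all: by end_near.
Qed.

(* Beyond N / 2, either F k < eta * S k and ln S grows by at most eta, or ln (a k) is at
   least c2 * N^(al / b) while ln S grows by at most 2. *)
Lemma log_mean_of_slow_growth (al L : R) : 0 < al -> al < 1 -> 1 < al + al / b ->
  (fun n => S n / exp_pow al n) @ \oo --> (1 : R) ->
  \forall N \near \oo, L * N%:R <= \sum_(k < N) ln ((a k)%:R : R).
Proof.
move=> al0 al1 alb hS.
have b0 : 0 < b by have := b1; lra.
have [n0 _ hp] := cvg1_pinch (fun n => expR_gt0 _) hS.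
have {}hp n : (n0 <= n)%N -> 9 / 10 * exp_pow al n <= S n <= 11 / 10 * exp_pow al n := hp n.
have n910 : 0 < 9 / 10 :> R by lra.
have n1110 : 0 < 11 / 10 :> R by lra.
have ln119 : ln (11 / 10) - ln (9 / 10) <= 1 / 4 :> R.
  apply: (@le_trans _ _ ((11 / 10 - 9 / 10) / (9 / 10))); last by lra.
  by apply: ln_sub_le; lra.
(* gam N^al is the growth of k^al between N / 2 and N. Below, t3 N^al = (N / 3)^al bounds k^al from
   below for k >= N./2. *)
pose gam : R := 1 - (1 / 2) `^ al.
have gam0 : 0 < gam.
  have h0 : 0 <= 1 / 2 :> R by lra.
  have := gt0_ltr_powR al0 (x := 1 / 2) (y := 1) h0 ler01; rewrite /gam powR1 => h.
  by rewrite subr_gt0; apply: h; lra.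
pose t3 : R := (1 / 3) `^ al.
have t30 : 0 < t3 by rewrite powR_gt0//; lra.
pose c2 := (t3 / 2) `^ (1 / b).
have c20 : 0 < c2 by rewrite powR_gt0// divr_gt0.
have t34 : 0 < t3 / 4 by lra.
have [C hC] := ln_natr_le al0 t34.
have rho0 : 0 < al + al / b - 1 by lra.
near=> N.
have N3 : (3 <= N)%N by near: N; exists 3%N.
have Nn0 : (n0.*2.+1 <= N)%N by near: N; exists n0.*2.+1.
have big1 : 4 / gam <= (N%:R : R) `^ al by near: N; exact: powR_natr_oo.
have big2 : 8 * `|L| / (c2 * gam) <= (N%:R : R) `^ (al + al / b - 1) by near: N; exact: powR_natr_oo.
have big3 : 4 / t3 * (C - ln (gam / 2) - ln (9 / 10)) <= (N%:R : R) `^ al by near: N; exact: powR_natr_oo.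
set x := N%:R : R in big1 big2 big3 *.
have x0 : 0 < x by rewrite ltr0n; exact: leq_trans N3.
pose m := N./2.
have [m1 mN m2 m3] : [/\ (n0 <= m)%N, (m <= N)%N, (m * 2 <= N)%N & (N <= m * 3)%N].
  exact: half_bounds.
have mle : m%:R <= x / 2 by rewrite ler_pdivlMr// -natrM ler_nat.
have mge : x / 3 <= m%:R by rewrite ler_pdivrMr// -natrM ler_nat.
(* At most N steps of size [eta] give gam / 2 * N^al, half of the main term of the growth of ln S;
   the rest must come from large letters. *)
have [eta etaE eta0] : exists2 eta, eta = gam / 2 * x `^ (al - 1) & 0 < eta.
  by eexists => //; rewrite mulr_gt0 ?powR_gt0// divr_gt0.
have S0 k : (n0 <= k)%N -> 0 < S k.
  by move=> /hp /andP[h _]; apply: lt_le_trans h; rewrite mulr_gt0 ?expR_gt0//; lra.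
have lnS k : (n0 <= k)%N -> ln (9 / 10) + (k%:R : R) `^ al <= ln (S k) <= ln (11 / 10) + (k%:R : R) `^ al.
  move=> nk; have /andP[h1 h2] := hp k nk; have Sk := S0 k nk.
  have e1 : ln (9 / 10) + (k%:R : R) `^ al = ln (9 / 10 * exp_pow al k).
    by rewrite /exp_pow [RHS]lnM ?posrE ?expR_gt0 ?expRK.
  have e2 : ln (11 / 10) + (k%:R : R) `^ al = ln (11 / 10 * exp_pow al k).
    by rewrite /exp_pow [RHS]lnM ?posrE ?expR_gt0 ?expRK.
  have P0 : 0 < exp_pow al k by exact: expR_gt0.
  have pp (z : R) : 0 < z -> 0 < z * exp_pow al k by move=> z0; exact: mulr_gt0.
  rewrite e1 e2; apply/andP; split; rewrite ler_ln ?posrE //; exact: pp.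
have cx : 0 < c2 * x `^ (al / b) by apply: (mulr_gt0 c20); exact: powR_gt0.
have step k : (m <= k)%N -> ln (S k.+1) - ln (S k) <= eta + 2 / (c2 * x `^ (al / b)) * ln ((a k)%:R : R).
  move=> mk; have nk : (n0 <= k)%N by exact: leq_trans mk.
  have Sk := S0 k nk; have Sk1 := S0 k.+1 (leqW nk).
  have [small|large] := ltP (F k) (eta * S k).
    apply: (@le_trans _ _ eta); last first.
      by rewrite lerDl mulr_ge0// divr_ge0// ltW.
    apply: (le_trans (ln_sub_le Sk1 Sk)).
    by rewrite ler_pdivrMr// SS addrAC subrr add0r ltW.
  (* One step of k^al adds at most 1 by subadditivity, and the pinch adds at most 1/4. *)
  apply: (@le_trans _ _ 2).
    have /andP[_ h1] := lnS k.+1 (leqW nk); have /andP[h2 _] := lnS k nk.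
    have := powR_subadditive (ler0n R k) ler01 al0 (ltW al1); rewrite powR1 natr1; lra.
  apply: (@le_trans _ _ (2 / (c2 * x `^ (al / b)) * ln ((a k)%:R : R))); last by rewrite lerDr ltW.
  rewrite mulrAC ler_pdivlMr// ler_pM2l//.
  have E : c2 * x `^ (al / b) = (t3 * x `^ al / 2) `^ (1 / b).
    rewrite mulrAC powRM ?powR_ge0 ?(ltW t30)//; last by rewrite divr_ge0// ltW.
    by rewrite -powRrM; congr (_ * _ `^ _); field; rewrite gt_eqF.
  have tx0 : 0 <= t3 * x `^ al / 2 by rewrite !mulr_ge0 ?powR_ge0// ?ltW// invr_ge0.
  apply: (@ln_digit_ge _ (t3 * x `^ al / 2)); first by rewrite ltW.
    by rewrite E -powRrM div1r mulVf ?gt_eqF// powRr1.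
  apply: le_trans large.
  (* The logarithm of eta * S k is k^al up to O(ln N), hence at least t3 / 2 * N^al for large N. *)
  have -> : eta * S k = expR (ln (gam / 2) + (al - 1) * ln x + ln (S k)).
    rewrite !expRD !lnK ?posrE ?divr_gt0//.
    by rewrite etaE (powR_expR _ x0).
  rewrite ler_expR.
  have /andP[h2 _] := lnS k nk.
  have h3 : t3 * x `^ al <= (k%:R : R) `^ al.
    rewrite /t3 -powRM ?(ltW x0) ?divr_ge0//.
    have xk : 1 / 3 * x <= k%:R by apply: (@le_trans _ _ m%:R); [lra|rewrite ler_nat].
    by apply: ge0_ler_powR; rewrite ?nnegrE ?(ltW al0) ?ler0n//; lra.
  have N0 : (0 < N)%N by apply: leq_trans N3.
  have h4 := hC N N0; rewrite -/x in h4.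
  have h5 : ln x <= ln N.+1%:R by rewrite ler_ln ?posrE ?ltr0n// ler_nat.
  have h6 : 0 <= ln x by rewrite ln_ge0// ler1n.
  have h7 : - ln x <= (al - 1) * ln x by nra.
  rewrite mulrAC ler_pdivrMr// in big3.
  rewrite mulrC in big3; move: big3 h2 h3 h4 h5 h7.
  set X := x `^ al; lra.
have tele : ln (S N) - ln (S m) <= eta * x + 2 / (c2 * x `^ (al / b)) * \sum_(k < N) ln ((a k)%:R : R).
  rewrite -(telescope_sumr (fun k => ln (S k)) mN).
  apply: (@le_trans _ _ (\sum_(m <= k < N) (eta + 2 / (c2 * x `^ (al / b)) * ln ((a k)%:R : R)))).
    by rewrite big_nat [leRHS]big_nat; apply: ler_sum => k /andP[mk _]; exact: step.
  rewrite big_split /= -mulr_sumr; apply: lerD.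
    apply: (@le_trans _ _ (eta * (N - m)%:R)); first by rewrite sumr_const_nat mulr_natr.
    by rewrite ler_pM2l// ler_nat leq_subr.
  apply: ler_wpM2l; first by rewrite divr_ge0// ltW.
  rewrite -(big_mkord xpredT (fun k => ln ((a k)%:R : R))) [leRHS](@big_cat_nat _ _ _ m)//= lerDr.
  by apply: sumr_ge0.
have etax : eta * x = gam / 2 * x `^ al.
  rewrite etaE -mulrA; congr (_ * _).
  by rewrite mulrC mulr_powRB1// ltW.
have low : gam * x `^ al - 1 / 4 <= ln (S N) - ln (S m).
  have /andP[h1 _] := lnS N (leq_trans m1 mN); have /andP[_ h2] := lnS m m1.
  have : (m%:R : R) `^ al <= (1 / 2) `^ al * x `^ al.
    rewrite -powRM ?(ltW x0) ?divr_ge0//.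
    by apply: ge0_ler_powR; rewrite ?nnegrE ?(ltW al0) ?ler0n//; lra.
  by rewrite -/x in h1; rewrite /gam; lra.
have X0 : 0 < x `^ al by rewrite powR_gt0.
rewrite ler_pdivrMr// in big1.
have h1 : gam / 4 * x `^ al <= 2 / (c2 * x `^ (al / b)) * \sum_(k < N) ln ((a k)%:R : R).
  by rewrite etax in tele; lra.
rewrite [leRHS]mulrAC ler_pdivlMr// in h1.
have h2 : x `^ al * x `^ (al / b) = x * x `^ (al + al / b - 1).
  rewrite mulr_powRB1 ?(ltW x0)//; last by lra.
  by rewrite powRD//; apply/implyP => _; rewrite gt_eqF.
rewrite ler_pdivrMr ?mulr_gt0// in big2.
have h3 : x * (8 * `|L|) <= x * (x `^ (al + al / b - 1) * (c2 * gam)) by rewrite ler_pM2l.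
have h4 : x * L <= x * `|L| by rewrite ler_pM2l// ler_norm.
have h5 : gam / 4 * x `^ al * (c2 * x `^ (al / b)) = gam / 4 * c2 * (x `^ al * x `^ (al / b)) by ring.
rewrite h5 h2 in h1.
move: h1 h3 h4; set P := x `^ _; set T := \sum_(_ < _) _ => h1 h3 h4.
have h6 : gam / 4 * c2 * (x * P) = 1 / 4 * (x * (P * (c2 * gam))) by field.
rewrite h6 in h1; lra.
Unshelve. all: by end_near.
Qed.

Lemma log_mean_of_growth (al L : R) : b / (b + 1) < al ->
  (fun n => S n / exp_pow al n) @ \oo --> (1 : R) ->
  exists N0, forall N, (N0 <= N)%N -> L * N%:R <= \sum_(k < N) ln ((a k)%:R : R).
Proof.
move=> alb hS; have b1' := b1; have b0 : 0 < b by lra.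
have al0 : 0 < al by apply: lt_trans alb; rewrite divr_gt0//; lra.
have [al1|al1] := leP 1 al.
  by apply: log_mean_of_digits_oo; exact: digits_oo_of_growth hS.
have alb' : 1 < al + al / b.
  rewrite ltr_pdivrMr in alb; last by lra.
  have -> : al + al / b = al * (b + 1) / b by field; rewrite gt_eqF.
  by rewrite ltr_pdivlMr// mul1r.
have [N0 _ hN0] := @log_mean_of_slow_growth al L al0 al1 alb' hS.
by exists N0.
Qed.

End digits_of_growth_sets.

(** * The growth exp(beta^n) *)

Section double_exponential.
Context {R : realType}.

(** If x > y + 1, superadditivity gives x^b > (y + 1)^b >= y^b + 1. *)
Lemma powR_le_add1 (b x y : R) : 1 < b -> 0 <= x -> 0 <= y ->
  x `^ b <= y `^ b + 1 -> x <= y + 1.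
Proof.
move=> b1 x0 y0 h; have b0 : 0 < b by lra.
rewrite leNgt; apply/negP => yx.
have := powR_superadditive y0 ler01 (ltW b1); rewrite powR1 => h1.
have y10 : 0 <= y + 1 by lra.
have := gt0_ltr_powR b0 (x := y + 1) (y := x) y10 x0 yx.
lra.
Qed.

(** The factor 3 leaves 9/10 - 11/30, which exceeds 1/2; a factor 2 would not suffice for the second
    bound. *)
Lemma increment_pinch (P P' S F : R) : 0 <= S -> S <= 11 / 10 * P ->
  9 / 10 * P' <= S + F -> S + F <= 11 / 10 * P' -> 3 * P <= P' ->
  F <= P' * 2 /\ P' <= F * 2.
Proof. by move=> *; split; lra. Qed.

Variables (b beta : R).
Hypotheses (b1 : 1 < b) (beta1 : 1 < beta).

Let B := beta `^ (1 / b).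

Lemma root_beta_gt1 : 1 < B.
Proof.
have b0 : 0 < 1 / b by rewrite divr_gt0//; have := b1; lra.
have h0 : 0 <= beta by have := beta1; lra.
have := gt0_ltr_powR b0 (x := 1) (y := beta) ler01 h0 beta1.
by rewrite powR1.
Qed.

Lemma root_beta_powR : B `^ b = beta.
Proof.
have b0 : 0 < b by have := b1; lra.
by rewrite /B -powRrM div1r mulVf ?gt_eqF// powRr1//; have := beta1; lra.
Qed.

Lemma root_beta_exprn n : (B ^+ n) `^ b = beta ^+ n.
Proof.
have B0 : 0 <= B by exact: powR_ge0.
have h0 : 0 <= beta by have := beta1; lra.
by rewrite -powR_mulrn// -powRrM mulrC powRrM root_beta_powR powR_mulrn.
Qed.

Lemma exprn_oo (M : R) : \forall n \near \oo, M <= beta ^+ n.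
Proof.
have [n0 _ h] := @exp_beats_linear R beta 0 M 1 0 beta1 ltr01.
exists n0 => // n /= nn; rewrite mul0r add0r mul1r in h; apply: (le_trans h).
by rewrite ler_weXn2l// ltW.
Qed.

Definition exp_exp (n : nat) : R := expR (beta ^+ n).
Definition exp_exp_log (n : nat) : R := ln (exp_exp n.+1 - exp_exp n).

Lemma exp_exp_lt n : exp_exp n < exp_exp n.+1.
Proof.
have := beta1 => h; rewrite ltr_expR exprS.
have : 0 < beta ^+ n by rewrite exprn_gt0//; lra.
by set x := beta ^+ n => x0; nra.
Qed.

Lemma exp_expD n : exp_exp n.+1 - exp_exp n = expR (exp_exp_log n).
Proof. by rewrite lnK// posrE subr_gt0 exp_exp_lt. Qed.

Lemma exp_exp_oo (M : R) : \forall n \near \oo, M <= exp_exp n.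
Proof.
apply: filterS (exprn_oo M) => n h; apply: (le_trans h).
by apply: le_trans (expR_ge1Dx _); lra.
Qed.

Lemma exp_exp_triple : \forall n \near \oo, 3 * exp_exp n <= exp_exp n.+1.
Proof.
near=> n.
have h : 2 / (beta - 1) <= beta ^+ n by near: n; exact: exprn_oo.
have h1 := beta1.
rewrite ler_pdivrMr in h; last by lra.
apply: (@le_trans _ _ (expR 2 * exp_exp n)).
  by rewrite ler_pM2r ?expR_gt0//; have := expR_ge1Dx (2 : R); lra.
rewrite /exp_exp -expRD ler_expR exprS; set x := beta ^+ n in h *; lra.
Unshelve. all: by end_near.
Qed.

Lemma exp_exp_log_le n : exp_exp_log n <= beta ^+ n.+1.
Proof. by rewrite -ler_expR -exp_expD gerBl expR_ge0. Qed.

Lemma exp_exp_log_ge : \forall n \near \oo, beta ^+ n.+1 - 1 <= exp_exp_log n.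
Proof.
apply: filterS exp_exp_triple => n h.
rewrite -ler_expR -exp_expD expRB ler_pdivrMr ?expR_gt0// -/(exp_exp n.+1).
have e2 : 2 <= expR 1 :> R by have := expR_ge1Dx (1 : R); lra.
have P0 : 0 < exp_exp n by exact: expR_gt0.
set x := exp_exp n.+1 in h *; set y := exp_exp n in h P0 *.
have : (x - y) * 2 <= (x - y) * expR 1 by rewrite ler_pM2l//; lra.
lra.
Qed.

Lemma exp_exp_log_oo (M : R) : \forall n \near \oo, M <= exp_exp_log n.
Proof.
near=> n.
have h1 : beta ^+ n.+1 - 1 <= exp_exp_log n by near: n; exact: exp_exp_log_ge.
have h2 : `|M| + 1 <= beta ^+ n by near: n; exact: exprn_oo.
have h := beta1; have h3 := ler_norm M; have h4 := normr_ge0 M.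
rewrite exprS in h1; set x := beta ^+ n in h1 h2; have : x <= beta * x by rewrite ler_peMl//; lra.
lra.
Unshelve. all: by end_near.
Qed.

Lemma exp_exp_log_ratio (e : R) : 0 < e ->
  \forall n \near \oo, exp_exp_log n.+1 <= ((1 + (B - 1)) `^ b + e) * exp_exp_log n.
Proof.
move=> e0; have h := beta1.
have -> : 1 + (B - 1) = B by ring.
rewrite root_beta_powR; near=> n.
have h1 : beta ^+ n.+1 - 1 <= exp_exp_log n by near: n; exact: exp_exp_log_ge.
have h2 : beta / e <= exp_exp_log n by near: n; exact: exp_exp_log_oo.
apply: (le_trans (exp_exp_log_le n.+1)); rewrite exprS.
rewrite ler_pdivrMr// in h2.
have : beta * (beta ^+ n.+1 - 1) <= beta * exp_exp_log n by rewrite ler_pM2l//; lra.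
lra.
Unshelve. all: by end_near.
Qed.

(** The last term of the sum up to k + 1 is within a factor 2 < e of exp(beta^(k+1)), so (ln (a
    k))^b and (B^(k+1))^b differ by at most 1, and [powR_le_add1] takes the root. Letters count from
    0, whence the exponent k + 1. *)
Lemma digits_of_exp_exp (a : nat -> nat) : (forall k, (0 < a k)%N) ->
  (fun n => (\sum_(k < n) expR (ln ((a k)%:R : R) `^ b)) / exp_exp n) @ \oo --> (1 : R) ->
  exists N0, forall k, (N0 <= k)%N -> B ^+ k.+1 - 1 <= ln ((a k)%:R : R) <= B ^+ k.+1 + 1.
Proof.
move=> a0 hS; have b1' := b1; have B1 := root_beta_gt1; have b0 : 0 < b by lra.
pose S n : R := \sum_(k < n) expR (ln ((a k)%:R : R) `^ b).
have SS n : S n.+1 = S n + expR (ln ((a n)%:R : R) `^ b) by rewrite /S big_ord_recr.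
have [n0 _ hp] := @cvg1_pinch R S exp_exp (fun n => expR_gt0 _) hS.
have {}hp n : (n0 <= n)%N -> 9 / 10 * exp_exp n <= S n <= 11 / 10 * exp_exp n := hp n.
have Spos n : 0 <= S n by apply: sumr_ge0 => k _; exact: expR_ge0.
have [n1 _ ht] := exp_exp_triple.
have {}ht n : (n1 <= n)%N -> 3 * exp_exp n <= exp_exp n.+1 := ht n.
exists (maxn n0 n1) => k hk.
have k0 : (n0 <= k)%N by apply: leq_trans hk; rewrite leq_maxl.
have k1 : (n1 <= k)%N by apply: leq_trans hk; rewrite leq_maxr.
have /andP[u1 u2] := hp k k0; have /andP[u3 u4] := hp k.+1 (leqW k0).
have t := ht k k1; have Sk := Spos k.
have P0 : 0 < exp_exp k by exact: expR_gt0.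
rewrite SS in u3 u4; clearbody S.
have l0 : 0 <= ln ((a k)%:R : R) by rewrite ln_ge0// ler1n.
have e2 : 2 <= expR 1 :> R by have := expR_ge1Dx (1 : R); lra.
set l := ln _ in l0 u3 u4 *; set X := B ^+ k.+1.
have X0 : 0 <= X by rewrite exprn_ge0// powR_ge0.
have XE : exp_exp k.+1 = expR (X `^ b) by rewrite /X root_beta_exprn.
have [F1 F2] := increment_pinch Sk u2 u3 u4 t.
have up : l `^ b <= X `^ b + 1.
  by rewrite -ler_expR expRD -XE; apply: (le_trans F1); rewrite ler_pM2l ?expR_gt0.
have dn : X `^ b <= l `^ b + 1.
  by rewrite -ler_expR expRD -XE; apply: (le_trans F2); rewrite ler_pM2l ?expR_gt0.
have h1 := powR_le_add1 b1 l0 X0 up; have h2 := powR_le_add1 b1 X0 l0 dn.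
by rewrite lerBlDr h2 h1.
Qed.

End double_exponential.

Section full_upper_bound.
Context {R : realType}.

(** Cutting into n equal intervals costs n^(1 - s), which tends to 0. *)
Lemma snull_gt1_unit_interval (s : R) (A : set R) : 1 < s -> A `<=` `]0, 1[%classic -> snull s A.
Proof.
move=> s1 A01 eps e0; have s0 : 0 < s by lra.
suff h : snull s A by exact: h.
apply: snull_subset A01 _.
move=> {}eps {}e0.
have sp : 0 < s - 1 by lra.
have [n0 _ hn0] := powR_natr_oo eps^-1 sp.
pose n := maxn n0 1.
have n0' : (0 < n)%N by rewrite leq_max orbT.
have nR : 0 < n%:R :> R by rewrite ltr0n.
have hn : eps^-1 <= (n%:R : R) `^ (s - 1) by apply: hn0; rewrite /= leq_maxl.
exists (fun k => if (k < n)%N then `[k%:R / n%:R, k.+1%:R / n%:R]%classic else set0),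
  (fun k => if (k < n)%N then n%:R^-1 else 0); split.
- move=> x; rewrite /= in_itv /= => /andP[x0 x1].
  have xn : 0 <= x * n%:R by rewrite mulr_ge0 ?ltW.
  have /andP[h1 h2] := truncn_itv xn.
  exists (Num.truncn (x * n%:R)) => //.
  have -> : (Num.truncn (x * n%:R) < n)%N.
    by rewrite -(ltr_nat R); apply: (le_lt_trans h1); rewrite -[ltRHS]mul1r ltr_pM2r.
  by rewrite /= in_itv /= ler_pdivrMr// ler_pdivlMr// h1 ltW.
- by move=> k; case: ifP => // _; rewrite invr_ge0 ltW.
- move=> k x y; case: ifP => // _; rewrite /= !in_itv /= -[k.+1%:R]natr1 mulrDl mul1r.
  by set i := n%:R^-1; set z := k%:R * i => /andP[? ?] /andP[? ?]; rewrite ler_norml; lra.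
- move=> N.
  apply: (@le_trans _ _ (\sum_(k < n) (n%:R^-1 : R) `^ s)).
    rewrite -(big_mkord xpredT (fun k => (if (k < n)%N then n%:R^-1 else 0) `^ s)).
    rewrite -(big_mkord xpredT (fun k => (n%:R^-1 : R) `^ s)).
    have [Nn|nN] := leqP N n.
      rewrite [leRHS](@big_cat_nat _ _ _ N)//= -[leLHS]addr0; apply: lerD; last first.
        by apply: sumr_ge0 => k _; exact: powR_ge0.
      rewrite big_nat [leRHS]big_nat; apply: ler_sum => k /andP[_ kN].
      by rewrite (leq_trans kN Nn).
    rewrite (@big_cat_nat _ _ _ n)//=; last exact: ltnW.
    rewrite -[leRHS]addr0; apply: lerD.
      by rewrite big_nat [leRHS]big_nat; apply: ler_sum => k /andP[_ ->].
    rewrite big_nat big1// => k /andP[nk _].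
    by rewrite ltnNge nk /= powR0// gt_eqF.
  rewrite sumr_const card_ord -[leLHS]mulr_natl.
  have E : (n%:R^-1 : R) `^ s = n%:R^-1 * (n%:R `^ (s - 1))^-1.
    rewrite -powR_inv1 ?ler0n// -powRrM mulN1r -powRN -powRD; first by congr (_ `^ _); ring.
    by apply/implyP => _; rewrite gt_eqF.
  rewrite E mulrA mulfV ?gt_eqF// mul1r.
  by rewrite -[leRHS]invrK lef_pV2 ?posrE ?invr_gt0 ?powR_gt0.
Qed.

End full_upper_bound.

(** * The dimension formulas *)

Unset Implicit Arguments.

Theorem theorem1p3 (R : realType) (d : R) (f : nat -> R -> R) (b : R)
  (phi : R -> R)
  (hd : 1 < d) (hf : gauss_like_ifs d f) (hb : 1 < b)
  (hphi : potential f phi)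
  (hval : forall j : nat, (0 < j)%N ->
    potential_value f phi j = expR (ln (j%:R : R) `^ b)) :
  (forall alpha : R, 0 < alpha ->
    (alpha < b / (b + 1) -> bounded_distortion f ->
      hausdorff_dim (birkhoff_growth_set f phi
        (fun n : nat => expR (n%:R `^ alpha))) = 1%:E) /\
    (b / (b + 1) < alpha ->
      hausdorff_dim (birkhoff_growth_set f phi
        (fun n : nat => expR (n%:R `^ alpha))) = (1 / d)%:E)) /\
  (forall beta : R, 1 < beta ->
    hausdorff_dim (birkhoff_growth_set f phi
      (fun n : nat => expR (beta ^+ n))) =
    (1 / (d * beta `^ (1 / b) - beta `^ (1 / b) + 1))%:E).
Proof.
have d0 : 0 < d by lra.
have digits (Phi : nat -> R) x : birkhoff_growth_set f phi Phi x -> exists a,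
    [/\ expansion f x a, forall k, (0 < a k)%N &
    (fun n => (\sum_(k < n) expR (ln ((a k)%:R : R) `^ b)) / Phi n) @ \oo --> (1 : R)].
  move=> [_ [a [ea h]]]; exists a; have a0 : forall k, (0 < a k)%N by case: ea.
  split=> //.
  have -> : (fun n => (\sum_(k < n) expR (ln ((a k)%:R : R) `^ b)) / Phi n) =
      (fun n => birkhoff_sum f phi a n / Phi n).
    by apply/funext => n; rewrite (birkhoff_sumE n hval).
  exact: h.
split=> [alpha al0|beta beta1].
- split=> [alb bd|alb]; apply/eqP; rewrite eq_le; apply/andP; split.
  + apply: (@hausdorff_dim_le R 1 2) => //; first by lra.
    move=> s s1 _; apply: snull_gt1_unit_interval => // x [x01 _].
    exact: x01.
  + apply: le_hausdorff_dim => // s s0 s1.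
    exact: (full_dimension_not_snull hd hf hb hval bd al0 alb s0 s1).
  + have id0 : 0 < 1 / d by rewrite divr_gt0.
    apply: (@hausdorff_dim_le R (1 / d) (1 / d + 1)); [exact: ltW|by rewrite ltrDl|].
    move=> s ds _; apply: (snull_log_mean hd hf ds) => x /digits[a [ea a0 ha]].
    exists a; split=> // L.
    apply: (@log_mean_of_growth R b a hb a0 (fun k => expR (ln ((a k)%:R : R) `^ b))
      (fun n => \sum_(k < n) expR (ln ((a k)%:R : R) `^ b)) _ _ alpha L alb ha) => //.
    by move=> n; rewrite big_ord_recr.
  + have id0 : 0 < 1 / d by rewrite divr_gt0.
    apply: le_hausdorff_dim => // s s0 sd.
    (* Here [kap = 0]: the ratio of consecutive increment logarithms is eventually at most 1 + e for
       every e > 0. *)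
    apply: (@growth_set_not_snull R d b f phi hd hf hb hval (@exp_pow R alpha)
      (@exp_pow_log R alpha) 0).
    * by move=> M; exact: exp_pow_oo.
    * by move=> M; exact: exp_pow_log_oo.
    * by exists 0%N => // n _; exact: exp_powD.
    * exact: lexx.
    * by move=> e e0; rewrite addr0 powR1; exact: exp_pow_log_ratio.
    * exact: s0.
    * by rewrite mulr0 addr0 -ltr_pdivlMr.
- set B := beta `^ (1 / b).
  have B1 : 1 < B by exact: root_beta_gt1.
  have E : d * B - B + 1 = d + (d - 1) * (B - 1) by ring.
  have dB : 0 < (d - 1) * (B - 1) by rewrite mulr_gt0// subr_gt0.
  have D0 : 0 < d + (d - 1) * (B - 1) by rewrite addr_gt0.
  have iD0 : 0 < 1 / (d + (d - 1) * (B - 1)) by rewrite divr_gt0.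
  rewrite E; apply/eqP; rewrite eq_le; apply/andP; split.
  (* The expected value is below 1 / d, so exponents under 1 / d suffice; this is the range where
     counting letters outweighs their contraction. *)
  + apply: (@hausdorff_dim_le R _ (1 / d)); first exact: ltW.
      by rewrite !div1r ltf_pV2 ?posrE// ltrDl.
    move=> s s1 s2; apply: (snull_log_geometric hd hf B1 s1 s2) => x /digits[a [ea a0 ha]].
    by exists a; split=> //; exact: digits_of_exp_exp.
  + apply: le_hausdorff_dim => // s s0 sd.
    apply: (@growth_set_not_snull R d b f phi hd hf hb hval (@exp_exp R beta)
      (@exp_exp_log R beta) (B - 1)).
    * by move=> M; exact: exp_exp_oo.
    * by move=> M; exact: exp_exp_log_oo.
    * by exists 0%N => // n _; exact: exp_expD.
    * by rewrite subr_ge0 ltW.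
    * by move=> e e0; exact: exp_exp_log_ratio.
    * exact: s0.
    * by rewrite -ltr_pdivlMr.
Qed.
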